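(* Let $n\ge2$, let $\varphi$ be a $C^\infty$ function with compact support in $\mathbb{R}^n_+$, and let $\Phi=H\varphi$. Define, for $x=(x',x_n)\in\mathbb{R}^n$, $$g(x)=\pi^{1-n}\int_{\mathbb{R}^{n-1}}(x_n-2z'\cdot x'+|z'|^2)_+^{-1/2}\,\Phi\Big(z',\sqrt{x_n-2z'\cdot x'+|z'|^2}\Big)\,\frac{dz'}{(1+4|z'|^2)^{(n-1)/2}}.$$ If $n$ is odd, then $\varphi(y)=(Q_1^{-1}\psi)(y)$, $y\in\mathbb{R}^n_+$, with $$\psi(x)=(-\Delta)^{(n-1)/2}g(x).$$ If $n$ is even, then $\varphi(y)=(Q_1^{-1}\psi)(y)$, $y\in\mathbb{R}^n_+$, with $$\psi(x)=c_n\int_{\mathbb{R}^n}\frac{(-\Delta)^{n/2-1}g(x)-(-\Delta)^{n/2-1}g(x-z)}{|z|^{n+1}}\,dz,\qquad c_n=\frac{\Gamma((n+1)/2)}{\pi^{(n+1)/2}},$$ where $\int_{\mathbb{R}^n}=\lim_{\varepsilon\to0}\int_{|z|>\varepsilon}$ uniformly in $x\in\mathbb{R}^n$.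
   Context: $\mathbb{R}^n_+=\{y=(y',y_n): y'\in\mathbb{R}^{n-1},\ y_n>0\}$. The hemispherical (sonar) transform of a function $\varphi$ on $\mathbb{R}^n_+$ is $$(H\varphi)(x',r)=\int_{S_+(x',r)}\varphi(y)\,d\sigma(y),\qquad x'\in\mathbb{R}^{n-1},\ r>0,$$ where $S_+(x',r)=\{y\in\mathbb{R}^n_+:|y-x'|=r\}$ (with $x'$ identified with $(x',0)$) and $d\sigma$ is the induced surface area measure. For real $X$, $(X)_+^{\lambda}=X^\lambda$ if $X>0$ and $(X)_+^\lambda=0$ otherwise (an expression containing the factor $(X)_+^{\lambda}$ is taken to be $0$ when $X\le0$). $\Delta=\partial^2/\partial x_1^2+\dots+\partial^2/\partial x_n^2$ is the Laplace operator. The map $Q_1^{-1}$ takes a function $\psi$ on $\mathbb{R}^n$ to the function $(Q_1^{-1}\psi)(y)=y_n\,\psi(y',\,y_n^2+|y'|^2)$, $y\in\mathbb{R}^n_+$. *)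

(* Defs.v *)
From HB Require Import structures.
From mathcomp Require Import all_boot all_order all_algebra.
From mathcomp Require Import all_classical all_reals all_analysis.
Set Implicit Arguments.
Unset Strict Implicit.
Unset Printing Implicit Defensive.
Import Order.TTheory GRing.Theory Num.Theory.
Import numFieldNormedType.Exports.
Local Open Scope classical_set_scope.
Local Open Scope ring_scope.

(* Points of R^(m+1) are written (x', t) with x' in R^m. *)

Definition rVpair (R : realType) (m : nat) (x' : 'rV[R]_m) (t : R) : 'rV[R]_m.+1 :=
  \row_i (if unlift ord_max i is Some j then x' 0 j else t).

Definition rVhead (R : realType) (m : nat) (x : 'rV[R]_m.+1) : 'rV[R]_m :=
  \row_j x 0 (lift ord_max j).

Definition rVlast (R : realType) (m : nat) (x : 'rV[R]_m.+1) : R := x 0 ord_max.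

Lemma rVpair_head (R : realType) (m : nat) (x' : 'rV[R]_m) (t : R) :
  rVhead (rVpair x' t) = x'.
Proof. by apply/rowP => j; rewrite !mxE liftK. Qed.

Lemma rVpair_last (R : realType) (m : nat) (x' : 'rV[R]_m) (t : R) :
  rVlast (rVpair x' t) = t.
Proof. by rewrite /rVlast mxE unlift_none. Qed.

Lemma rVpairK (R : realType) (m : nat) (x : 'rV[R]_m.+1) :
  rVpair (rVhead x) (rVlast x) = x.
Proof. by apply/rowP => i; rewrite mxE; case: unliftP => [j|] ->; rewrite ?mxE. Qed.

Definition dotp (R : realType) (n : nat) (x y : 'rV[R]_n) : R :=
  \sum_i x 0 i * y 0 i.

(* The norm [`|x|] of the library on row vectors is the sup norm. *)
Definition enorm (R : realType) (n : nat) (x : 'rV[R]_n) : R :=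
  Num.sqrt (dotp x x).

(* Lebesgue measure on R^n: the n-fold product of the one-dimensional one, *)
(* on the sigma-algebra generated by the coordinate functions.             *)

Definition rV_coord (R : realType) (n : nat) (i : 'I_n) (x : 'rV[R]_n) : R := x 0 i.

Definition rV_display : measure_display. Proof. exact. Qed.

Definition rV_measurable (R : realType) (n : nat) : set (set 'rV[R]_n) :=
  g_sigma_preimage (@rV_coord R n).

Lemma rV_measurable0 (R : realType) (n : nat) : @rV_measurable R n set0.
Proof. exact: sigma_algebra0. Qed.

Lemma rV_measurableC (R : realType) (n : nat) (A : set 'rV[R]_n) :
  rV_measurable A -> rV_measurable (~` A).
Proof. exact: sigma_algebraC. Qed.

Lemma rV_measurable_bigcup (R : realType) (n : nat) (F : (set 'rV[R]_n)^nat) :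
  (forall i, rV_measurable (F i)) -> rV_measurable (\bigcup_i F i).
Proof. exact: sigma_algebra_bigcup. Qed.

HB.instance Definition _ (R : realType) (n : nat) :=
  @isMeasurable.Build rV_display 'rV[R]_n (@rV_measurable R n)
    (@rV_measurable0 R n) (@rV_measurableC R n) (@rV_measurable_bigcup R n).

Lemma measurable_rV_coord (R : realType) (n : nat) (i : 'I_n) :
  measurable_fun [set: 'rV[R]_n] (rV_coord i).
Proof.
move=> _ Y mY; rewrite setTI; apply: sub_sigma_algebra => /=.
rewrite -bigcup_seq/=; exists i => /=; first by rewrite mem_index_enum.
by exists Y => //; rewrite setTI.
Qed.

Lemma measurable_fun_rV (d : measure_display) (T : measurableType d)
    (R : realType) (n : nat) (f : T -> 'rV[R]_n) :
  (forall i, measurable_fun setT (rV_coord i \o f)) -> measurable_fun setT f.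
Proof.
move=> mf _ A mA; rewrite setTI.
move: A mA; apply: smallest_sub.
  split => [|A|F]; rewrite /=.
  - by rewrite preimage_set0.
  - by rewrite setTD preimage_setC => /measurableC.
  - by move=> h; rewrite preimage_bigcup; exact: bigcup_measurable.
rewrite -bigcup_seq => A [i _] [B mB <-].
rewrite /= setTI -comp_preimage.
by have := mf i measurableT B mB; rewrite setTI.
Qed.

Lemma measurable_rVpair (R : realType) (m : nat) :
  measurable_fun [set: 'rV[R]_m * measurableTypeR R]
    (fun p => rVpair p.1 (p.2 : R)).
Proof.
apply: measurable_fun_rV => i.
case: (unliftP ord_max i) => [j ->|->].
  rewrite [X in measurable_fun _ X](_ : _ = rV_coord j \o fst).
    by apply: measurableT_comp => //; exact: measurable_rV_coord.
  by apply/funext => p; rewrite /rV_coord /= mxE liftK.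
rewrite [X in measurable_fun _ X](_ : _ = snd) //.
by apply/funext => p; rewrite /rV_coord /= mxE unlift_none.
Qed.

Lemma measurable_rVhead (R : realType) (m : nat) :
  measurable_fun [set: 'rV[R]_m.+1] (@rVhead R m).
Proof.
apply: measurable_fun_rV => i.
rewrite [X in measurable_fun _ X](_ : _ = rV_coord (lift ord_max i)).
  exact: measurable_rV_coord.
by apply/funext => p; rewrite /rV_coord /= mxE.
Qed.

Definition lebesgue_step (R : realType) (m : nat)
    (mu : {sigma_finite_measure set 'rV[R]_m -> \bar R}) :
    set 'rV[R]_m.+1 -> \bar R :=
  pushforward (mu \x (@lebesgue_measure R))%E (fun p => rVpair p.1 (p.2 : R)).

Lemma lebesgue_step0 (R : realType) (m : nat)
    (mu : {sigma_finite_measure set 'rV[R]_m -> \bar R}) :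
  (lebesgue_step mu set0 = 0)%E.
Proof. by rewrite /lebesgue_step /pushforward preimage_set0 measure0. Qed.

Lemma lebesgue_step_ge0 (R : realType) (m : nat)
    (mu : {sigma_finite_measure set 'rV[R]_m -> \bar R}) A :
  (0 <= lebesgue_step mu A)%E.
Proof. by rewrite /lebesgue_step /pushforward; exact: measure_ge0. Qed.

Lemma lebesgue_step_sigma_additive (R : realType) (m : nat)
    (mu : {sigma_finite_measure set 'rV[R]_m -> \bar R}) :
  semi_sigma_additive (lebesgue_step mu).
Proof.
move=> F mF tF mUF; rewrite /lebesgue_step /pushforward preimage_bigcup.
apply: measure_semi_sigma_additive.
- by move=> n; rewrite -[X in measurable X]setTI; exact: measurable_rVpair.
- apply/trivIsetP => /= i j _ _ ij; rewrite -preimage_setI.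
  by move/trivIsetP : tF => /(_ _ _ _ _ ij) ->//; rewrite preimage_set0.
- by rewrite -preimage_bigcup -[X in measurable X]setTI; exact: measurable_rVpair.
Qed.

HB.instance Definition _ (R : realType) (m : nat)
    (mu : {sigma_finite_measure set 'rV[R]_m -> \bar R}) :=
  isMeasure.Build _ _ _ (lebesgue_step mu) (lebesgue_step0 mu)
    (lebesgue_step_ge0 mu) (@lebesgue_step_sigma_additive R m mu).

Lemma lebesgue_step_sigma_finite (R : realType) (m : nat)
    (mu : {sigma_finite_measure set 'rV[R]_m -> \bar R}) :
  sigma_finite setT (lebesgue_step mu).
Proof.
have /sigma_finiteP[F [TF ndF Foo]] := sigma_finiteT mu.
have /sigma_finiteP[G [TG ndG Goo]] := sigma_finiteT (@lebesgue_measure R).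
exists (fun k => [set x | F k (rVhead x)] `&` [set x | G k (rVlast x)]).
  apply/esym; rewrite -subTset => x _.
  have [i _ Fi] : (\bigcup_i F i) (rVhead x) by rewrite -TF.
  have [j _ Gj] : (\bigcup_i G i) (rVlast x) by rewrite -TG.
  exists (maxn i j) => //; split.
  - by have /subsetPset := ndF _ _ (leq_maxl i j); exact.
  - by have /subsetPset := ndG _ _ (leq_maxr i j); exact.
move=> k; have [mF Fk] := Foo k; have [mG Gk] := Goo k; split.
  apply: measurableI.
  - by have := @measurable_rVhead R m measurableT _ mF; rewrite setTI.
  - by have := @measurable_rV_coord R m.+1 ord_max measurableT _ mG; rewrite setTI.
rewrite /lebesgue_step /pushforward.
rewrite [X in product_measure1 _ _ X](_ : _ = F k `*` G k); last first.
  by apply/seteqP; split=> -[x t]; rewrite /preimage /= rVpair_head rVpair_last.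
by rewrite product_measure1E// lte_mul_pinfty// ge0_fin_numE.
Qed.

HB.instance Definition _ (R : realType) (m : nat)
    (mu : {sigma_finite_measure set 'rV[R]_m -> \bar R}) :=
  Measure_isSigmaFinite.Build _ _ _ (lebesgue_step mu)
    (lebesgue_step_sigma_finite mu).

Fixpoint lebesgue_rV (R : realType) (n : nat) :
    {sigma_finite_measure set 'rV[R]_n -> \bar R} :=
  if n is m.+1 then lebesgue_step (lebesgue_rV R m) else \d_(0 : 'rV[R]_0).

Definition upper_half_space (R : realType) (m : nat) : set 'rV[R]_m.+1 :=
  [set y | 0 < rVlast y].
Arguments upper_half_space : clear implicits.

Definition partial (R : realType) (n : nat) (i : 'I_n) (f : 'rV[R]_n -> R) :
    'rV[R]_n -> R :=
  fun x => 'D_(delta_mx 0 i) f x.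

Definition iter_partial (R : realType) (n : nat) (s : seq 'I_n)
    (f : 'rV[R]_n -> R) : 'rV[R]_n -> R :=
  foldr (@partial R n) f s.

(* Meant for open [U]. *)
Definition smooth_on (R : realType) (n : nat) (U : set 'rV[R]_n)
    (f : 'rV[R]_n -> R) : Prop :=
  forall (s : seq 'I_n) (x : 'rV[R]_n), U x ->
    {for x, continuous (iter_partial s f)} /\
    forall i, derivable (iter_partial s f) x (delta_mx 0 i).

(* [f] is regarded as a function on [U]: its values outside [U] are ignored. *)
Definition support_in (R : realType) (n : nat) (U : set 'rV[R]_n)
    (f : 'rV[R]_n -> R) : set 'rV[R]_n :=
  closure (U `&` [set x | f x != 0]).

Definition compactly_supported_in (R : realType) (n : nat) (U : set 'rV[R]_n)
    (f : 'rV[R]_n -> R) : Prop :=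
  compact (support_in U f) /\ support_in U f `<=` U.

Definition laplacian (R : realType) (n : nat) (f : 'rV[R]_n -> R) :
    'rV[R]_n -> R :=
  fun x => \sum_i partial i (partial i f) x.

Definition neg_laplacian (R : realType) (n : nat) (f : 'rV[R]_n -> R) :
    'rV[R]_n -> R :=
  fun x => - laplacian f x.

Definition laplacian_exists (R : realType) (n : nat) (f : 'rV[R]_n -> R) : Prop :=
  forall (x : 'rV[R]_n) (i : 'I_n),
    derivable f x (delta_mx 0 i) /\ derivable (partial i f) x (delta_mx 0 i).

(* Integration against the surface measure of a hypersurface [S] of R^(m+1)   *)
(* contained in the graph of [h]: in the chart u |-> (u, h u) the induced     *)
(* measure is sqrt (1 + |grad h|^2) du.                                       *)

Definition graph_domain (R : realType) (m : nat) (S : set 'rV[R]_m.+1)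
    (h : 'rV[R]_m -> R) : set 'rV[R]_m :=
  [set u | S (rVpair u (h u))].

Definition graph_integrand (R : realType) (m : nat) (h : 'rV[R]_m -> R)
    (f : 'rV[R]_m.+1 -> R) : 'rV[R]_m -> R :=
  fun u => f (rVpair u (h u)) * Num.sqrt (1 + \sum_i partial i h u ^+ 2).

Definition hemisphere (R : realType) (m : nat) (x' : 'rV[R]_m) (r : R) :
    set 'rV[R]_m.+1 :=
  [set y | 0 < rVlast y /\ enorm (y - rVpair x' 0) = r].

Definition hemisphere_height (R : realType) (m : nat) (x' : 'rV[R]_m) (r : R) :
    'rV[R]_m -> R :=
  fun u => Num.sqrt (r ^+ 2 - enorm (u - x') ^+ 2).

Lemma dotp_ge0 (R : realType) (n : nat) (x : 'rV[R]_n) : 0 <= dotp x x.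
Proof. by apply: sumr_ge0 => i _; rewrite -expr2 sqr_ge0. Qed.

Lemma enorm_sq (R : realType) (n : nat) (x : 'rV[R]_n) : enorm x ^+ 2 = dotp x x.
Proof. by rewrite sqr_sqrtr// dotp_ge0. Qed.

Lemma enorm_sub_rVpair (R : realType) (m : nat) (y : 'rV[R]_m.+1) (x' : 'rV[R]_m) :
  enorm (y - rVpair x' 0) ^+ 2 = enorm (rVhead y - x') ^+ 2 + rVlast y ^+ 2.
Proof.
rewrite !enorm_sq /dotp big_ord_recr /=; congr (_ + _); last first.
  by rewrite !mxE unlift_none subr0 -expr2.
apply: eq_bigr => i _.
have -> : widen_ord (leqnSn m) i = lift ord_max i.
  by apply/val_inj; rewrite /= /bump leqNgt ltn_ord.
by rewrite !mxE liftK.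
Qed.

Lemma hemisphere_graph (R : realType) (m : nat) (x' : 'rV[R]_m) (r : R)
    (y : 'rV[R]_m.+1) : 0 < r ->
  hemisphere x' r y <->
  enorm (rVhead y - x') < r /\ rVlast y = hemisphere_height x' r (rVhead y).
Proof.
move=> r0; rewrite /hemisphere_height.
have E := enorm_sub_rVpair y x'; split=> [[y0 yr]|[yr yE]].
  have yE : r ^+ 2 - enorm (rVhead y - x') ^+ 2 = rVlast y ^+ 2.
    by rewrite -yr E addrC addKr.
  rewrite yE sqrtr_sqr gtr0_norm //; split=> //.
  rewrite -(@ltr_pXn2r _ 2) ?nnegrE ?sqrtr_ge0 ?(ltW r0)//.
  by rewrite -subr_gt0 yE exprn_gt0.
have d0 : 0 < r ^+ 2 - enorm (rVhead y - x') ^+ 2.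
  by rewrite subr_gt0 ltr_pXn2r ?nnegrE ?sqrtr_ge0 ?(ltW r0).
split; first by rewrite yE sqrtr_gt0.
apply/eqP; rewrite -(@eqrXn2 _ 2) ?sqrtr_ge0 ?(ltW r0)//.
by rewrite E yE [X in _ + X]sqr_sqrtr ?(ltW d0)// subrKC.
Qed.

Definition hemispherical_transform (R : realType) (m : nat)
    (phi : 'rV[R]_m.+1 -> R) (x' : 'rV[R]_m) (r : R) : R :=
  let h := hemisphere_height x' r in
  \int[lebesgue_rV R m]_(u in graph_domain (hemisphere x' r) h)
    graph_integrand h phi u.

Definition hemispherical_transform_exists (R : realType) (m : nat)
    (phi : 'rV[R]_m.+1 -> R) (x' : 'rV[R]_m) (r : R) : Prop :=
  let h := hemisphere_height x' r in
  (lebesgue_rV R m).-integrable (graph_domain (hemisphere x' r) h)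
    (EFin \o graph_integrand h phi).

(* X_+^lambda; the library convention for [0 `^ lambda] is not used. *)
Definition pos_power (R : realType) (X lambda : R) : R :=
  if 0 < X then X `^ lambda else 0.

(* In R^n with n = m + 1, so m = n - 1 in the exponents below. *)
Definition backprojection_integrand (R : realType) (m : nat)
    (Phi : 'rV[R]_m -> R -> R) (x : 'rV[R]_m.+1) (z' : 'rV[R]_m) : R :=
  let X := rVlast x - 2 * dotp z' (rVhead x) + enorm z' ^+ 2 in
  pos_power X (- 2^-1) * Phi z' (Num.sqrt X)
    / (1 + 4 * enorm z' ^+ 2) `^ (m%:R / 2).

Definition backprojection (R : realType) (m : nat)
    (Phi : 'rV[R]_m -> R -> R) (x : 'rV[R]_m.+1) : R :=
  pi ^- m * \int[lebesgue_rV R m]_z' backprojection_integrand Phi x z'.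

Definition Q1inv (R : realType) (m : nat) (psi : 'rV[R]_m.+1 -> R)
    (y : 'rV[R]_m.+1) : R :=
  rVlast y * psi (rVpair (rVhead y) (rVlast y ^+ 2 + enorm (rVhead y) ^+ 2)).

Definition Gamma (R : realType) (s : R) : R :=
  \int[@lebesgue_measure R]_(t in `]0, +oo[) (t `^ (s - 1) * expR (- t)).

Definition riesz_constant (R : realType) (n : nat) : R :=
  Gamma (n.+1%:R / 2 : R) / pi `^ (n.+1%:R / 2).

Definition difference_quotient (R : realType) (n : nat) (f : 'rV[R]_n -> R)
    (x z : 'rV[R]_n) : R :=
  (f x - f (x - z)) / enorm z ^+ n.+1.

Definition truncated_integral (R : realType) (n : nat) (f : 'rV[R]_n -> R)
    (eps : R) (x : 'rV[R]_n) : R :=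
  \int[lebesgue_rV R n]_(z in [set z | eps < enorm z]) difference_quotient f x z.

Definition singular_integral (R : realType) (n : nat) (f : 'rV[R]_n -> R)
    (x : 'rV[R]_n) : R :=
  lim (truncated_integral f eps x @[eps --> 0^'+]).

(* Main.v *)
(** Put [psi0 (x', x_n) = phi (y) / y_n] with [y = (x', y_n)] and
    [y_n = sqrt (x_n - |x'|^2)], so that [phi = Q_1^{-1} psi0]. The map
    [y |-> (y', |y|^2)] turns hemispheres centred on the boundary into pieces of
    hyperplanes, [H phi] becomes the hyperplane transform of [psi0], and [g] is
    its backprojection. Expanding the weight [(1 + 4 |z'|^2)^{-(n-1)/2}] as an
    integral of Gaussians, the backprojection becomes a normalized integral of
    [s^{n-2} e^{s^2 Delta} psi0 ds] over [s > 0], that is,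
    [g = (- Delta)^{-(n-1)/2} psi0]. Since
    [d/ds e^{s^2 Delta} = 2 s Delta e^{s^2 Delta}], an integration by parts in [s]
    shows that each application of [- Delta] lowers the power of [s] by two. For
    odd [n] this ends with [psi0]; for even [n] it ends with
    [f = (- Delta)^{-1/2} psi0], and one half Laplacian remains. As [|z|^{-n-1}]
    is the integral of the Gaussians of width [s] against [s^{-2} ds], the
    principal value is a multiple of the integral of
    [s^{-2} (f - e^{s^2 Delta} f)], which the semigroup law and polar coordinates
    in a quadrant of the [(q, t)]-plane reduce to [psi0]. *)

From HB Require Import structures.
Require Import Defs.
From mathcomp Require Import all_boot all_order all_algebra.
From mathcomp Require Import all_classical all_reals all_analysis.
From mathcomp Require Import measurable_realfun ring lra.
Set Implicit Arguments.
Unset Strict Implicit.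
Unset Printing Implicit Defensive.
Import Order.TTheory GRing.Theory Num.Theory.
Import numFieldNormedType.Exports.
Local Open Scope classical_set_scope.
Local Open Scope ring_scope.

(** * Integration on row vectors *)

(** The main obstacle is changing variables in several dimensions. Each change is reduced to
    one-dimensional affine substitutions, to shears (a rotation is a product of three) and to
    Tonelli; it is proved for nonnegative extended-real functions and then transferred to integrable
    signed ones. Homogeneous kernels are written as superpositions of Gaussians, so that every
    constant is a product of one-dimensional Gaussian moments.

    The exponent (n-1)/2 of the weight is geometric: a hyperplane of slope 2w has surface measure
    sqrt (1 + 4 |w|^2) dv, and the measure of directions is a multiple of (1 + 4 |w|^2)^(-n/2) dw,
    so that the weighted integral averages uniformly over the hyperplanes through x.

    Convergence of the moments rests on the decay s^-n of the heat semigroup on integrable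
    functions, and on one more power of s for derivatives. In the even case the difference quotient
    is too singular at z = 0 to be dominated; averaging over z and -z turns it into a second
    difference, integrable against |z|^(-n-1), with an error of order eps that is uniform in x. *)

Lemma measurable_affine (R : realType) (c d : R) :
  measurable_fun [set: measurableTypeR R] (fun x => c * x + d : measurableTypeR R).
Proof. by apply: measurable_funD => //; apply: measurable_funM. Qed.

(** Lebesgue measure is determined by its values on half-open intervals, and [c] times its image
    under the affine map has the same values there. *)
Lemma ge0_integral_affine_gt0 (R : realType) (c d : R) (f : R -> \bar R) :
  0 < c -> measurable_fun [set: R] f -> (forall x, 0 <= f x)%E ->
  (\int[lebesgue_measure]_x f x = c%:E * \int[lebesgue_measure]_x f (c * x + d)%R)%E.
Proof.
move=> c0 mf f0.
pose phi : measurableTypeR R -> measurableTypeR R := fun x => c * x + d.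
have mphi : measurable_fun setT phi by exact: measurable_affine.
pose phiM := isMeasurableFun.Build _ _ _ _ _ mphi.
pose phiP : {mfun _ >-> _} := HB.pack phi phiM.
pose k : {nonneg R} := NngNum (ltW c0).
have E := @ge0_integral_pushforward _ _ _ _ R phi mphi lebesgue_measure setT f measurableT mf (fun y _ => f0 y).
rewrite -[X in (_ * X)%E]E.
rewrite -(@ge0_integral_mscale _ _ R (pushforward lebesgue_measure phiP) setT measurableT k f mf (fun x _ => f0 x)).
apply: eq_measure_integral => A mA _.
apply: (@lebesgue_measure_unique _ (mscale k (pushforward lebesgue_measure phiP))) => // _ [[a b] _ <-].
rewrite /= /mscale /= /pushforward.
have -> : phi @^-1` [set` `]a, b]] = [set` `](a - d) / c, (b - d) / c]].
  apply/seteqP; split => x; rewrite /phi /= !in_itv /= ltr_pdivrMr// ler_pdivlMr// ltrBlDr lerBrDr mulrC//.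
rewrite !lebesgue_measure_itv /= !lte_fin ltr_pM2r ?invr_gt0// ltrD2r.
case: ifPn => _; last by rewrite mule0.
rewrite -!EFinD -EFinM; congr EFin; field. lra.
Qed.

Lemma ge0_integral_opp (R : realType) (f : R -> \bar R) :
  measurable_fun [set: R] f -> (forall x, 0 <= f x)%E ->
  (\int[lebesgue_measure]_x f x = \int[lebesgue_measure]_x f (- x)%R)%E.
Proof.
move=> mf f0.
pose phi : measurableTypeR R -> measurableTypeR R := -%R.
have mphi : measurable_fun setT phi by exact: measurable_funN.
rewrite -(@ge0_integral_pushforward _ _ _ _ R phi mphi lebesgue_measure setT f measurableT mf (fun y _ => f0 y)).
by apply: eq_measure_integral => A mA _; exact/esym/lebesgue_measureN.
Qed.

Lemma ge0_integral_affine (R : realType) (c d : R) (f : R -> \bar R) :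
  c != 0 -> measurable_fun [set: R] f -> (forall x, 0 <= f x)%E ->
  (\int[lebesgue_measure]_x f x = `|c|%:E * \int[lebesgue_measure]_x f (c * x + d)%R)%E.
Proof.
move=> c0 mf f0; have [c1|c1] := ltP 0 c.
  by rewrite (ge0_integral_affine_gt0 d c1)// gtr0_norm.
have {c0}c1 : c < 0 by rewrite lt_neqAle c0.
rewrite ltr0_norm// ge0_integral_opp// (@ge0_integral_affine_gt0 _ (- c) (- d))//; first last.
- by apply: measurableT_comp => //.
- by rewrite oppr_gt0.
by congr (_ * _)%E; apply: eq_integral => x _; congr f; ring.
Qed.

Lemma ge0_integral_rVS (R : realType) (m : nat) (f : 'rV[R]_m.+1 -> \bar R) :
  measurable_fun [set: 'rV[R]_m.+1] f -> (forall x, 0 <= f x)%E ->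
  (\int[lebesgue_rV R m.+1]_x f x =
   \int[lebesgue_rV R m]_x \int[lebesgue_measure]_t f (rVpair x t))%E.
Proof.
move=> mf f0.
rewrite /= [LHS](@ge0_integral_pushforward _ _ _ _ R _ (@measurable_rVpair R m) (lebesgue_rV R m \x lebesgue_measure)%E setT f)//.
rewrite preimage_setT (@fubini_tonelli1 _ _ _ _ R (lebesgue_rV R m) lebesgue_measure)//.
- by apply: measurableT_comp => //; exact: measurable_rVpair.
- by move=> x; exact: f0.
Qed.

Section curried_tonelli.
Local Open Scope ereal_scope.
Context d1 d2 (T1 : measurableType d1) (T2 : measurableType d2) (R : realType).
Variables (m1 : {sigma_finite_measure set T1 -> \bar R})
          (m2 : {sigma_finite_measure set T2 -> \bar R}).
Variable f : T1 -> T2 -> \bar R.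
Hypothesis mf : measurable_fun [set: T1 * T2] (fun p => f p.1 p.2).
Hypothesis f0 : forall x y, 0 <= f x y.

Lemma measurable_integral_r : measurable_fun [set: T1] (fun x => \int[m2]_y f x y).
Proof. exact: (measurable_fun_fubini_tonelli_F (fun p => f p.1 p.2)). Qed.

Lemma measurable_integral_l : measurable_fun [set: T2] (fun y => \int[m1]_x f x y).
Proof. exact: (measurable_fun_fubini_tonelli_G (fun p => f p.1 p.2)). Qed.

Lemma tonelli_swap : \int[m1]_x \int[m2]_y f x y = \int[m2]_y \int[m1]_x f x y.
Proof. exact: (@fubini_tonelli _ _ T1 T2 R m1 m2 (fun p => f p.1 p.2) mf (fun p => f0 _ _)). Qed.

Lemma tonelli_prod : \int[m1 \x m2]_p f p.1 p.2 = \int[m1]_x \int[m2]_y f x y.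
Proof. exact: (fubini_tonelli1 (fun p => f p.1 p.2)). Qed.

End curried_tonelli.
Arguments measurable_integral_r {d1 d2 T1 T2 R} m2 f.
Arguments measurable_integral_l {d1 d2 T1 T2 R} m1 f.
Arguments tonelli_swap {d1 d2 T1 T2 R} m1 m2 f.
Arguments tonelli_prod {d1 d2 T1 T2 R} m1 m2 f.

Lemma rVpair_lin (R : realType) (m : nat) c (x a : 'rV[R]_m) (t b : R) :
  c *: rVpair x t + rVpair a b = rVpair (c *: x + a) (c * t + b).
Proof. by apply/rowP => i; rewrite !mxE; case: unliftP => [j|] _; rewrite ?mxE. Qed.

Lemma measurable_rV_lin (R : realType) d (T : measurableType d) (n : nat) (c : T -> R) (f g : T -> 'rV[R]_n) :
  measurable_fun [set: T] c -> measurable_fun [set: T] f -> measurable_fun [set: T] g ->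
  measurable_fun [set: T] (fun x => c x *: f x + g x).
Proof.
move=> mc mf mg; apply: measurable_fun_rV => i.
rewrite [X in measurable_fun _ X](_ : _ = (fun x => c x * (rV_coord i \o f) x + (rV_coord i \o g) x)).
  apply: measurable_funD; first apply: measurable_funM => //.
    by apply: measurableT_comp => //; exact: measurable_rV_coord.
  by apply: measurableT_comp => //; exact: measurable_rV_coord.
by apply/funext => x; rewrite /= /rV_coord !mxE.
Qed.

Lemma measurable_rVpair_r (R : realType) (m : nat) (x : 'rV[R]_m) :
  measurable_fun [set: R] (rVpair x).
Proof.
apply: measurable_fun_rV => i; rewrite /rV_coord /comp.
under [X in measurable_fun _ X]eq_fun do rewrite mxE.
case: (unlift ord_max i) => [j|]; first exact: measurable_cst.
exact: measurable_id.
Qed.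

(** Induction on the dimension through [ge0_integral_rVS]: the last coordinate contributes one
    factor [|c|], the head the others. In dimension 0 there is a single point and the map is the
    identity. *)
Lemma ge0_integral_rV_affine (R : realType) (n : nat) (c : R) (a : 'rV[R]_n) (f : 'rV[R]_n -> \bar R) :
  c != 0 -> measurable_fun [set: 'rV[R]_n] f -> (forall x, 0 <= f x)%E ->
  (\int[lebesgue_rV R n]_x f x = (`|c| ^+ n)%:E * \int[lebesgue_rV R n]_x f (c *: x + a)%R)%E.
Proof.
move=> c0; elim: n => [|n IH] in a f *; move=> mf f0.
  rewrite /= expr0 mul1e; apply: eq_integral => x _; congr f.
  by apply/rowP => -[].
have mc : measurable_fun setT (fun x : 'rV[R]_n.+1 => f (c *: x + a)).
  by apply: measurableT_comp => //; exact: measurable_rV_lin.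
rewrite !ge0_integral_rVS//.
have mF : measurable_fun setT (fun p : 'rV[R]_n * measurableTypeR R => f (rVpair p.1 p.2)).
  by apply: measurableT_comp => //; exact: measurable_rVpair.
have mF1 := @measurable_fun_fubini_tonelli_F _ _ _ _ R lebesgue_measure _ mF (fun=> f0 _).
rewrite (IH (rVhead a))//; last first.
  by move=> x; apply: integral_ge0.
rewrite exprSr EFinM -muleA; congr (_ * _)%E.
rewrite -ge0_integralZl//; last 2 first.
- apply: (measurable_integral_r lebesgue_measure (fun (x : 'rV[R]_n) (t : measurableTypeR R) => f (c *: rVpair x t + a))) => //.
  apply: measurableT_comp => //; apply: measurable_rV_lin => //; exact: measurable_rVpair.
- by move=> x _; apply: integral_ge0.
apply: eq_integral => x _.
rewrite (@ge0_integral_affine _ c (rVlast a) (fun t => f (rVpair _ t)))//.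
  by congr (_ * _)%E; apply: eq_integral => t _; rewrite -[in RHS](rVpairK a) rVpair_lin.
by apply: measurableT_comp => //; exact: measurable_rVpair_r.
Qed.
(** The sigma-algebra is generated by the coordinates, not by the open sets, so continuity gives
    measurability only through an approximation: [f] is the pointwise limit of its values at the
    grid points floor ((k+1) x) / (k+1), and each approximant takes countably many values, on
    boxes. *)
Lemma continuous_measurable_rV (R : realType) (n : nat) (f : 'rV[R]_n -> R) :
  continuous f -> measurable_fun [set: 'rV[R]_n] f.
Proof.
move=> cf.
pose q k (x : 'rV[R]_n) : 'rV[int]_n := \row_i Num.floor (k.+1%:R * x 0 i).
pose g k (v : 'rV[int]_n) : 'rV[R]_n := \row_i ((v 0 i)%:~R / k.+1%:R).
apply: (@measurable_fun_cvg _ _ _ _ (fun k => f \o g k \o q k)).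
- move=> k _ B mB; rewrite setTI.
  have -> : (f \o g k \o q k) @^-1` B = \bigcup_v ([set x | q k x = v] `&` [set x | B (f (g k v))]).
    apply/seteqP; split=> [x Bx|x [v _ [/= <-]]//]; by exists (q k x).
  apply: countable_bigcupT_measurable => [|v]; first exact: countableP.
  apply: measurableI; last first.
    have [BB|BB] := pselect (B (f (g k v))).
      by rewrite (_ : [set x | _] = setT)//; apply/seteqP; split.
    by rewrite (_ : [set x | _] = set0)//; apply/seteqP; split.
  rewrite (_ : [set x | _] = \bigcap_(i in [set: 'I_n])
     (@rV_coord R n i @^-1` [set t | Num.floor (k.+1%:R * t) = v 0 i])); last first.
    apply/seteqP; split => [x /= <- i _ /=|x /= H]; first by rewrite mxE.
    by apply/rowP => i; rewrite mxE; exact: H.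
  apply: fin_bigcap_measurable => // i _.
  rewrite -[X in measurable X]setTI; apply: measurable_rV_coord => //.
  rewrite (_ : [set t | _] = [set` `[(v 0 i)%:~R / k.+1%:R, (v 0 i + 1)%:~R / k.+1%:R[])//.
  apply/seteqP; split => t /=; rewrite in_itv /= ler_pdivrMr// ltr_pdivlMr// [t * _]mulrC.
    by move=> <-; exact: floor_itv.
  by move=> ?; exact: floor_def.
- move=> x _; apply: (@cvg_comp _ _ _ (fun k => g k (q k x)) f _ (nbhs x)); last exact: cf.
  apply/cvgrPdist_le => e e0.
  near=> k.
  rewrite /Num.norm /= mx_normrE; apply: bigmax_le; first exact: ltW.
  move=> [i j] _; rewrite !mxE /= ord1.
  have /andP[h1 h2] := floor_itv (k.+1%:R * x 0 j).
  have -> : x 0 j - (Num.floor (k.+1%:R * x 0 j))%:~R / k.+1%:R = (k.+1%:R * x 0 j - (Num.floor (k.+1%:R * x 0 j))%:~R) / k.+1%:R.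
    by rewrite mulrBl [_ * x 0 j]mulrC mulfK// gt_eqF.
  rewrite ger0_norm; last by rewrite divr_ge0// subr_ge0.
  apply: (@le_trans _ _ (k.+1%:R^-1)).
    rewrite ler_pdivrMr// mulVf//; move: h2; rewrite intrD; lra.
  by near: k; move: (near_infty_natSinv_lt (PosNum e0)); apply: filterS => k /ltW.
Unshelve. all: by end_near. Qed.

(** * From nonnegative functions to signed integrable ones *)

Section transfer.
Context d1 d2 d3 (X : measurableType d1) (Y : measurableType d2) (Z : measurableType d3) (R : realType).
Variables (mu : {measure set X -> \bar R}) (nu : {measure set Y -> \bar R}).
Variables (k : X -> R) (l : Y -> R) (p : X -> Z) (q : Y -> Z).
Hypotheses (mk : measurable_fun [set: X] k) (ml : measurable_fun [set: Y] l)
  (mp : measurable_fun [set: X] p) (mq : measurable_fun [set: Y] q)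
  (k0 : forall x, 0 <= k x) (l0 : forall y, 0 <= l y).
Hypothesis same : forall F : Z -> \bar R, measurable_fun [set: Z] F ->
  (forall z, 0 <= F z)%E ->
  (\int[mu]_x ((k x)%:E * F (p x)) = \int[nu]_y ((l y)%:E * F (q y)))%E.
Variable f : Z -> R.
Hypothesis mf : measurable_fun [set: Z] f.
Hypothesis intf : nu.-integrable setT (fun y => (l y * f (q y))%:E).

(** [same] says that the weighted measures [k mu] and [l nu] have the same image in [Z], but only
    when tested on nonnegative functions. Testing it on the absolute value of [f] transports
    integrability. *)
Lemma transfer_integrable : mu.-integrable setT (fun x => (k x * f (p x))%:E).
Proof.
apply/integrableP; split.
  by apply/measurable_EFinP/measurable_funM => //; exact: measurableT_comp.
have /integrableP[_] := intf.
under eq_integral do rewrite /= normrM ger0_norm// EFinM.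
under [in X in _ -> X]eq_integral do rewrite /= normrM ger0_norm// EFinM.
by rewrite (same (F := fun z => `|f z|%:E))//; apply/measurable_EFinP; exact: measurableT_comp.
Qed.

(** The integral is split into positive and negative parts; the nonnegative weights can be pulled
    out of both, and [same] applies to each. *)
Lemma transfer_Rintegral :
  \int[mu]_x (k x * f (p x)) = \int[nu]_y (l y * f (q y)).
Proof.
rewrite /Rintegral; congr fine; rewrite integralE [RHS]integralE.
congr (_ - _)%E.
- transitivity (\int[mu]_x ((k x)%:E * (Order.max (f (p x)) 0)%:E))%E.
    by apply: eq_integral => x _; rewrite -EFinM maxr_pMr// mulr0 funeposE EFin_max.
  rewrite (same (F := fun z => (Order.max (f z) 0)%:E)).
  - by apply: eq_integral => x _; rewrite -EFinM maxr_pMr// mulr0 funeposE EFin_max.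
  - by apply/measurable_EFinP; apply: measurable_maxr.
  - by move=> z; rewrite lee_fin le_max lexx orbT.
- transitivity (\int[mu]_x ((k x)%:E * (Order.max (- f (p x)) 0)%:E))%E.
    by apply: eq_integral => x _; rewrite -EFinM maxr_pMr// mulr0 mulrN funenegE EFin_max.
  rewrite (same (F := fun z => (Order.max (- f z) 0)%:E)).
  - by apply: eq_integral => x _; rewrite -EFinM maxr_pMr// mulr0 mulrN funenegE EFin_max.
  - by apply/measurable_EFinP; apply: measurable_maxr => //; exact: measurableT_comp.
  - by move=> z; rewrite lee_fin le_max lexx orbT.
Qed.
End transfer.

Section Rfubini.
Context d1 d2 (X : measurableType d1) (Y : measurableType d2) (R : realType).
Variables (m1 : {sigma_finite_measure set X -> \bar R}) (m2 : {sigma_finite_measure set Y -> \bar R}).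
Variable f : X -> Y -> R.
Hypothesis intf : (m1 \x m2)%E.-integrable setT (fun p => (f p.1 p.2)%:E).

Lemma integrable_Rfubini : m1.-integrable setT (fun x => (\int[m2]_y f x y)%:E).
Proof.
have mF := measurable_fubini_F intf.
have : m1.-integrable setT (fubini_F m2 (fun p => (f p.1 p.2)%:E)) by exact: integrable_fubini_F.
apply: le_integrable => //.
  by apply/measurable_EFinP; apply: measurableT_comp => //.
move=> x _; rewrite /Rintegral /fubini_F /=.
by case: (\int[m2]_y _)%E => [r| |] //=; rewrite normr0 leey.
Qed.

Lemma Rfubini : \int[(m1 \x m2)%E]_p f p.1 p.2 = \int[m1]_x \int[m2]_y f x y.
Proof.
have E := integral12_prod_meas1 intf.
rewrite /Rintegral -E; congr fine.
(* The inner extended-real integral may be infinite or undefined on a null set, where [fine]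
   replaces its value; both versions agree almost everywhere. *)
apply: ae_eq_integral => //.
- exact: (measurable_fubini_F intf).
- have /integrableP[] := integrable_Rfubini; done.
- have := integrable_ae measurableT (integrable_fubini_F intf).
  apply: filterS => x /(_ I) fx _; rewrite /Rintegral fineK//.
Qed.
End Rfubini.

(** * Gaussian integrals and rotations *)

Local Notation leb := (@lebesgue_measure).

Lemma enorm_ge0 (R : realType) n (x : 'rV[R]_n) : 0 <= enorm x.
Proof. exact: sqrtr_ge0. Qed.

Lemma dotp_rVpair (R : realType) m (x y : 'rV[R]_m) (t s : R) :
  dotp (rVpair x t) (rVpair y s) = dotp x y + t * s.
Proof.
rewrite /dotp big_ord_recr /=; congr (_ + _); last by rewrite !mxE unlift_none.
apply: eq_bigr => i _.
have -> : widen_ord (leqnSn m) i = lift ord_max i.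
  by apply/val_inj; rewrite /= /bump leqNgt ltn_ord.
by rewrite !mxE liftK.
Qed.

Lemma measurable_dotp (R : realType) d (T : measurableType d) n (f g : T -> 'rV[R]_n) :
  measurable_fun [set: T] f -> measurable_fun [set: T] g ->
  measurable_fun [set: T] (fun x => dotp (f x) (g x)).
Proof.
move=> mf mg; apply: measurable_sum => i; apply: measurable_funM.
  by apply: (measurableT_comp (measurable_rV_coord i)).
by apply: (measurableT_comp (measurable_rV_coord i)).
Qed.

Lemma measurable_enorm (R : realType) d (T : measurableType d) n (f : T -> 'rV[R]_n) :
  measurable_fun [set: T] f -> measurable_fun [set: T] (fun x => enorm (f x)).
Proof.
move=> mf; apply: (@measurableT_comp _ _ _ _ _ _ (@Num.sqrt R)); last exact: measurable_dotp.
by apply: continuous_measurable_fun; exact: sqrt_continuous.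
Qed.

Lemma measurable_expRN (R : realType) d (T : measurableType d) (f : T -> R) :
  measurable_fun [set: T] f -> measurable_fun [set: T] (fun x => expR (- f x)).
Proof.
by move=> mf; apply: measurableT_comp => //; exact: measurable_funN.
Qed.

Lemma ge0_integral_gauss (R : realType) (c : R) : 0 < c ->
  (\int[leb R]_t (expR (- (c ^+ 2 * t ^+ 2)))%:E = (Num.sqrt pi / c)%:E)%E.
Proof.
move=> c0; have := @integralT_gauss R.
rewrite (ge0_integral_affine (c := c) 0)//; last 3 first.
- by rewrite gt_eqF.
- by apply/measurable_EFinP; exact: measurable_gauss_fun.
- by move=> x; rewrite lee_fin gauss_fun_ge0.
rewrite gtr0_norm//.
under eq_integral do rewrite /gauss_fun addr0 exprMn.
set I := (\int[_]_t _)%E => cI.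
have : ((c^-1)%:E * (c%:E * I) = (c^-1)%:E * (Num.sqrt pi)%:E)%E by rewrite cI.
by rewrite muleA -EFinM mulVf ?gt_eqF// mul1e => ->; rewrite -EFinM mulrC.
Qed.

Lemma ge0_integral_gauss_rV (R : realType) n (c : R) : 0 < c ->
  (\int[lebesgue_rV R n]_z (expR (- (c ^+ 2 * dotp z z)))%:E = ((Num.sqrt pi / c) ^+ n)%:E)%E.
Proof.
move=> c0; elim: n => [|n IH].
  rewrite /= integral_dirac//; first by rewrite [X in (X * _)%E]diracE in_setT mul1e /dotp big_ord0 mulr0 oppr0 expR0 expr0.
  apply/measurable_EFinP/measurable_expRN/measurable_funM => //; exact: measurable_dotp.
have mg k : measurable_fun setT (fun z : 'rV[R]_k => (expR (- (c ^+ 2 * dotp z z)))%:E).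
  by apply/measurable_EFinP/measurable_expRN/measurable_funM => //; exact: measurable_dotp.
rewrite ge0_integral_rVS//.
under eq_integral => x _.
  under eq_integral do rewrite dotp_rVpair -expr2 mulrDr opprD expRD EFinM.
  rewrite ge0_integralZl//; first rewrite ge0_integral_gauss//; first over.
  - by apply/measurable_EFinP/measurable_expRN/measurable_funM => //; exact: measurable_funX.
rewrite ge0_integralZr//; first by rewrite IH -EFinM exprSr.
- exact: mg.
- by rewrite lee_fin divr_ge0// ?sqrtr_ge0// ltW.
Qed.

Lemma measurable_comp2 d d1 d2 d3 (W : measurableType d) (T1 : measurableType d1)
    (T2 : measurableType d2) (U : measurableType d3) (H : T1 -> T2 -> U)
    (u : W -> T1) (v : W -> T2) :
  measurable_fun [set: T1 * T2] (fun p => H p.1 p.2) ->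
  measurable_fun [set: W] u -> measurable_fun [set: W] v ->
  measurable_fun [set: W] (fun w => H (u w) (v w)).
Proof.
move=> mH mu mv.
apply: (measurableT_comp (f := fun p : T1 * T2 => H p.1 p.2) (g := fun w => (u w, v w))) => //.
by apply/measurable_fun_pairP; split.
Qed.

Section rotation.
Local Open Scope ereal_scope.
Context d (T : measurableType d) (R : realType) (mu : {sigma_finite_measure set T -> \bar R}).
Variable sh : R -> T -> T -> T.
Hypothesis msh : forall a, measurable_fun [set: T * T] (fun p => sh a p.1 p.2).
Hypothesis ish : forall a y (F : T -> \bar R), measurable_fun [set: T] F ->
  (forall x, 0 <= F x) -> \int[mu]_x F (sh a x y) = \int[mu]_x F x.
Variable G : T -> T -> \bar R.
Hypothesis mG : measurable_fun [set: T * T] (fun p => G p.1 p.2).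
Hypothesis G0 : forall x y, 0 <= G x y.

(** A shear moves one variable by an amount that depends only on the other, so it preserves the
    double integral by Tonelli and the invariance [ish]. The shear [sh] is left abstract to serve
    both for numbers and for row vectors. *)
Lemma ge0_integral_shears a b :
  \int[mu]_x \int[mu]_y G x y =
  \int[mu]_x \int[mu]_y
    G (sh a (sh a x y) (sh b y (sh a x y))) (sh b y (sh a x y)).
Proof.
have shl (H : T -> T -> \bar R) c : measurable_fun [set: T * T] (fun p => H p.1 p.2) ->
    (measurable_fun [set: T * T] (fun p => H (sh c p.1 p.2) p.2)).
  by move=> mH; apply: (measurable_comp2 mH).
have shr (H : T -> T -> \bar R) c : measurable_fun [set: T * T] (fun p => H p.1 p.2) ->
    (measurable_fun [set: T * T] (fun p => H p.1 (sh c p.2 p.1))).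
  move=> mH; apply: (measurable_comp2 mH) => //.
  exact: (measurable_comp2 (msh c)).
have left_ (H : T -> T -> \bar R) c : measurable_fun [set: T * T] (fun p => H p.1 p.2) ->
    (forall x y, 0 <= H x y) -> \int[mu]_x \int[mu]_y H x y = \int[mu]_x \int[mu]_y H (sh c x y) y.
  move=> mH H0; rewrite (tonelli_swap mu mu H mH H0).
  rewrite [RHS](tonelli_swap mu mu (fun x y => H (sh c x y) y) (shl H c mH) (fun x y => H0 _ _)).
  apply: eq_integral => y _; symmetry; apply: (ish c y (F := fun x => H x y)) => //.
  exact: (measurable_comp2 mH (u := id) (v := cst y)).
have right_ (H : T -> T -> \bar R) c : measurable_fun [set: T * T] (fun p => H p.1 p.2) ->
    (forall x y, 0 <= H x y) -> \int[mu]_x \int[mu]_y H x y = \int[mu]_x \int[mu]_y H x (sh c y x).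
  move=> mH H0; apply: eq_integral => x _; symmetry; apply: (ish c x (F := H x)) => //.
  exact: (measurable_comp2 mH (u := cst x) (v := id)).
rewrite (left_ G a mG G0).
rewrite (right_ (fun x y => G (sh a x y) y) b (shl _ _ mG) (fun x y => G0 _ _)).
apply: (left_ (fun x y => G (sh a x (sh b y x)) (sh b y x)) a) => //.
exact: (shr (fun x y => G (sh a x y) y)) (shl _ _ mG).
Qed.
End rotation.

(** The classical decomposition of a rotation by an angle a: the shear coefficients are -tan (a/2),
    sin a, -tan (a/2), with tan (a/2) = s / (1 + c). The half-turn, where 1 + c vanishes, is
    excluded. *)
Lemma scaler_three_shears (R : fieldType) (V : lmodType R) (x y : V) (c s : R) :
  c ^+ 2 + s ^+ 2 = 1 -> 1 + c != 0 ->
  let x1 := (- s / (1 + c)) *: y + x in let y1 := s *: x1 + y in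
  ((- s / (1 + c)) *: y1 + x1 = c *: x - s *: y) /\ y1 = s *: x + c *: y.
Proof.
move=> cs c1 /=; set k := - s / (1 + c).
have [k1 k2] : s * k + 1 = c /\ k * c + k = - s.
  have s2 : s ^+ 2 = (1 - c) * (1 + c) by rewrite -[LHS](addKr (c ^+ 2)) cs; ring.
  split; last by rewrite /k; field.
  have -> : s * k + 1 = 1 - s ^+ 2 / (1 + c) by rewrite /k; field.
  by rewrite s2; field.
have E : s *: (k *: y + x) + y = s *: x + c *: y.
  by rewrite scalerDr scalerA addrAC -{2}[y]scale1r -scalerDl k1 addrC.
rewrite E; split => //.
rewrite scalerDr !scalerA addrACA [X in X + _ = _]addrC.
by rewrite addrACA -scalerDl -[X in _ + (_ + X)]scale1r -scalerDl [k * s]mulrC k1 [k + _]addrC k2 scaleNr addrC.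
Qed.

Lemma three_shears (R : fieldType) (x y c s : R) : c ^+ 2 + s ^+ 2 = 1 -> 1 + c != 0 ->
  let x1 := - s / (1 + c) * y + x in let y1 := s * x1 + y in
  (- s / (1 + c) * y1 + x1 = c * x - s * y) /\ y1 = s * x + c * y.
Proof. exact: (@scaler_three_shears R R^o x y c s). Qed.

Lemma ge0_integral_rotation (R : realType) (c s : R) (G : R -> R -> \bar R) :
  c ^+ 2 + s ^+ 2 = 1 -> c != -1 ->
  measurable_fun [set: measurableTypeR R * measurableTypeR R] (fun p => G p.1 p.2) ->
  (forall x y, 0 <= G x y)%E ->
  (\int[leb R]_x \int[leb R]_y G x y = \int[leb R]_x \int[leb R]_y G (c * x - s * y)%R (s * x + c * y)%R)%E.
Proof.
move=> cs c1 mG G0.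
have c1' : 1 + c != 0 by apply: contra c1 => /eqP c1; apply/eqP; lra.
rewrite [LHS](@ge0_integral_shears _ (measurableTypeR R) R (leb R) (fun a (x y : R) => a * y + x) _ _ G mG G0 (- s / (1 + c)) s).
- apply: eq_integral => x _; apply: eq_integral => y _.
  by have [-> ->] := three_shears x y cs c1'.
- move=> a; apply: measurable_funD => //; apply: measurable_funM => //.
- move=> a y F mF F0; rewrite [RHS](ge0_integral_affine (c := 1) (a * y))// ?oner_eq0//.
  by rewrite normr1 mul1e; apply: eq_integral => x _; rewrite mul1r addrC.
Qed.

Lemma ge0_integral_rotation_rV (R : realType) n (c s : R) (G : 'rV[R]_n -> 'rV[R]_n -> \bar R) :
  c ^+ 2 + s ^+ 2 = 1 -> c != -1 ->
  measurable_fun [set: 'rV[R]_n * 'rV[R]_n] (fun p => G p.1 p.2) ->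
  (forall x y, 0 <= G x y)%E ->
  (\int[lebesgue_rV R n]_x \int[lebesgue_rV R n]_y G x y =
   \int[lebesgue_rV R n]_x \int[lebesgue_rV R n]_y G (c *: x - s *: y)%R (s *: x + c *: y)%R)%E.
Proof.
move=> cs c1 mG G0.
have c1' : 1 + c != 0 by apply: contra c1 => /eqP c1; apply/eqP; lra.
rewrite [LHS](@ge0_integral_shears _ _ R (lebesgue_rV R n) (fun a (x y : 'rV[R]_n) => a *: y + x) _ _ G mG G0 (- s / (1 + c)) s).
- apply: eq_integral => x _; apply: eq_integral => y _.
  by have [-> ->] := scaler_three_shears x y cs c1'.
- by move=> a; apply: measurable_rV_lin.
- move=> a y F mF F0; rewrite [RHS](ge0_integral_rV_affine (c := 1) (a *: y))// ?oner_eq0//.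
  by rewrite normr1 expr1n mul1e; apply: eq_integral => x _; rewrite scale1r addrC.
Qed.

(** Polar form of the vector (a, b). The sign of [a] passes to [c], which keeps the resulting
    rotation away from the half-turn. *)
Lemma unit_vector (R : realType) (a b : R) : 0 <= a ->
  exists c s, [/\ c ^+ 2 + s ^+ 2 = 1, 0 <= c, a = Num.sqrt (a ^+ 2 + b ^+ 2) * c &
    b = Num.sqrt (a ^+ 2 + b ^+ 2) * s].
Proof.
move=> a0; set r := Num.sqrt _.
have r2 : r ^+ 2 = a ^+ 2 + b ^+ 2 by rewrite sqr_sqrtr// addr_ge0 ?sqr_ge0.
have [r0|r0] := eqVneq r 0.
  exists 1, 0; rewrite r0; split; rewrite ?mul0r//; first by rewrite expr1n expr0n addr0.
    by move: r2; rewrite r0 expr0n /= => /esym/eqP; rewrite paddr_eq0 ?sqr_ge0// sqrf_eq0 => /andP[/eqP].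
  by move: r2; rewrite r0 expr0n /= => /esym/eqP; rewrite paddr_eq0 ?sqr_ge0// !sqrf_eq0 => /andP[_ /eqP].
exists (a / r), (b / r); split; rewrite ?divr_ge0// ?sqrtr_ge0//.
- by rewrite !expr_div_n -mulrDl -r2 divff// sqrf_eq0.
- by rewrite mulrCA divff// mulr1.
- by rewrite mulrCA divff// mulr1.
Qed.

(** A Gaussian is rotation invariant, so [dotp w v] is distributed like [enorm v] times one
    coordinate. The constant is the mass of the m - 1 remaining directions, written with a quotient
    so that it also makes sense for m = 0. In the induction only one rotation of a plane is needed,
    mixing the direction of the head of [v] with the last coordinate. *)
Lemma ge0_integral_gauss_dotp (R : realType) m (v : 'rV[R]_m) (s : R) (F : R -> \bar R) :
  0 < s -> measurable_fun [set: R] F -> (forall t, 0 <= F t)%E ->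
  (\int[lebesgue_rV R m]_w ((expR (- (s ^+ 2 * dotp w w)))%:E * F (dotp w v)) =
   ((Num.sqrt pi / s) ^+ m * (s / Num.sqrt pi))%:E *
   \int[leb R]_t ((expR (- (s ^+ 2 * t ^+ 2)))%:E * F (enorm v * t)%R))%E.
Proof.
move=> s0; have pi0 : 0 < Num.sqrt pi :> R by rewrite sqrtr_gt0 pi_gt0.
have mg (T : measurableType _) (f : T -> R) : measurable_fun [set: T] f ->
    measurable_fun [set: T] (fun t => (expR (- (s ^+ 2 * f t)))%:E).
  by move=> mf; apply/measurable_EFinP/measurable_expRN/measurable_funM.
elim: m => [|m IH] in v F *; move=> mF F0.
  rewrite /= integral_dirac//; last first.
    apply: emeasurable_funM; last by apply: measurableT_comp => //; exact: measurable_dotp.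
    by apply: mg; exact: measurable_dotp.
  rewrite [X in (X * _)%E]diracE in_setT mul1e /enorm /dotp !big_ord0 mulr0 oppr0 expR0 expr0 mul1e mul1r.
  rewrite sqrtr0.
  under eq_integral do rewrite mul0r.
  rewrite ge0_integralZr//; last by apply: mg; exact: measurable_funX.
  by rewrite ge0_integral_gauss// muleA -EFinM mulrA divfK ?gt_eqF// divff ?gt_eqF// mul1e.
rewrite ge0_integral_rVS//; last 2 first.
- apply: emeasurable_funM; last by apply: measurableT_comp => //; exact: measurable_dotp.
  by apply: mg; exact: measurable_dotp.
- by move=> x; rewrite mule_ge0.
pose v' := rVhead v; pose b := rVlast v.
have dE (x : 'rV[R]_m) t : dotp (rVpair x t) v = dotp x v' + t * b by rewrite -{1}(rVpairK v) dotp_rVpair.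
have nE : enorm v = Num.sqrt (enorm v' ^+ 2 + b ^+ 2).
  by rewrite enorm_sq {1}/enorm -{1 2}(rVpairK v) dotp_rVpair expr2.
under eq_integral => x _ do under eq_integral => t _ do
  rewrite dotp_rVpair -expr2 mulrDr opprD expRD EFinM dE.
rewrite (tonelli_swap (lebesgue_rV R m) (leb R) (fun x t => (expR (- (s ^+ 2 * dotp x x)))%:E * (expR (- (s ^+ 2 * t ^+ 2)))%:E * F (dotp x v' + t * b)%R)%E); last 2 first.
- apply: emeasurable_funM; last first.
    apply: measurableT_comp => //; apply: measurable_funD; first by apply: measurable_dotp.
    by apply: measurable_funM.
  apply: emeasurable_funM; first by apply: mg; exact: measurable_dotp.
  by apply: mg; exact: measurable_funX.
- by move=> x y; rewrite !mule_ge0.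
have [c [sn [cs c0 aE bE]]] := unit_vector b (enorm_ge0 v').
rewrite -nE in aE bE.
pose C := (Num.sqrt pi / s) ^+ m * (s / Num.sqrt pi).
have C0 : 0 <= C by rewrite mulr_ge0 ?exprn_ge0 ?divr_ge0 ?ltW.
transitivity (\int[leb R]_t \int[leb R]_u (C%:E * ((expR (- (s ^+ 2 * (u ^+ 2 + t ^+ 2))))%:E * F (enorm v * (c * u + sn * t))%R)))%E.
  apply: eq_integral => t _.
  transitivity (\int[lebesgue_rV R m]_x ((expR (- (s ^+ 2 * t ^+ 2)))%:E * ((expR (- (s ^+ 2 * dotp x x)))%:E * F (dotp x v' + t * b)%R)))%E.
    by apply: eq_integral => x _; rewrite muleA [(_%:E * _%:E)%E]muleC.
  have mFt : measurable_fun [set: R] (fun u => F (u + t * b)).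
    by apply: measurableT_comp => //; exact: measurable_funD.
  rewrite ge0_integralZl//; last 2 first.
  - apply: emeasurable_funM; first by apply: mg; exact: measurable_dotp.
    by apply: (measurableT_comp mFt); exact: measurable_dotp.
  - by move=> x _; rewrite mule_ge0.
  rewrite (IH v' (fun u => F (u + t * b)))//.
  have mH : measurable_fun [set: measurableTypeR R]
      (fun x => (expR (- (s ^+ 2 * x ^+ 2)))%:E * F (enorm v' * x + t * b)%R)%E.
    apply: emeasurable_funM; first by apply: mg; exact: measurable_funX.
    by apply: (measurableT_comp mFt); exact: measurable_funM.
  rewrite -ge0_integralZl//; last by move=> x _; rewrite mule_ge0.
  rewrite -ge0_integralZl//; last 2 first.
  - exact: measurable_funeM.
  - by move=> x _; rewrite !mule_ge0.
  apply: eq_integral => u _; rewrite -/C aE bE mulrDr opprD expRD (mulrC (expR _)) (EFinM (expR _)).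
  by rewrite muleCA -[in RHS](muleA (expR _)%:E); congr (_ * (_ * (_ * F _)))%E; ring.
(* The rotated integrand: [c * u + sn * t] becomes the first variable, and the second one occurs
   only in the Gaussian, where it integrates to [Num.sqrt pi / s]. *)
pose G x (y : R) := (C%:E * ((expR (- (s ^+ 2 * (x ^+ 2 + y ^+ 2))))%:E * F (enorm v * x)%R))%E.
have mG : measurable_fun [set: measurableTypeR R * measurableTypeR R] (fun p => G p.1 p.2).
  apply: measurable_funeM; apply: emeasurable_funM.
    by apply: mg; apply: measurable_funD; exact: measurable_funX.
  by apply: measurableT_comp => //; exact: measurable_funM.
have G0 x y : (0 <= G x y)%E by rewrite !mule_ge0.
have GE x y : G x y = (C%:E * ((expR (- (s ^+ 2 * (x ^+ 2 + y ^+ 2))))%:E * F (enorm v * x)%R))%E by [].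
clearbody G.
have cN1 : c != -1 by rewrite gt_eqF// (lt_le_trans _ c0)// ltrN10.
have := @ge0_integral_rotation R c (- sn) G _ cN1 mG G0.
rewrite sqrrN => /(_ cs) rotE.
transitivity (\int[leb R]_x \int[leb R]_y G x y)%E.
  rewrite [RHS]rotE [RHS](tonelli_swap (leb R) (leb R) (fun x y => G (c * x - - sn * y) (- sn * x + c * y))); last 2 first.
  - apply: (measurable_comp2 mG); apply: measurable_funD.
    + exact: measurable_funM.
    + by apply: measurableT_comp => //; exact: measurable_funM.
    + exact: measurable_funM.
    + exact: measurable_funM.
  - by move=> x y; exact: G0.
  apply: eq_integral => t _; apply: eq_integral => u _; rewrite GE !mulNr opprK.
  have -> : (c * u + sn * t) ^+ 2 + (- (sn * u) + c * t) ^+ 2 = u ^+ 2 + t ^+ 2 by rewrite -[RHS]mul1r -cs; ring.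
  by [].
rewrite -ge0_integralZl//; last 3 first.
- apply: emeasurable_funM; first by apply: mg; exact: measurable_funX.
  by apply: measurableT_comp => //; exact: measurable_funM.
- by move=> x _; rewrite mule_ge0.
- by rewrite lee_fin mulr_ge0 ?exprn_ge0 ?divr_ge0 ?ltW.
apply: eq_integral => x _.
transitivity (\int[leb R]_y ((C%:E * ((expR (- (s ^+ 2 * x ^+ 2)))%:E * F (enorm v * x)%R)) * (expR (- (s ^+ 2 * y ^+ 2)))%:E))%E.
  apply: eq_integral => y _; rewrite GE mulrDr opprD expRD (EFinM (expR _)).
  by rewrite -!muleA; congr (_ * (_ * _))%E; rewrite muleC.
rewrite ge0_integralZl//; last 2 first.
- by apply: mg; exact: measurable_funX.
- by rewrite !mule_ge0.
rewrite ge0_integral_gauss// muleC muleA; congr (_ * _)%E.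
by rewrite -EFinM exprS mulrA.
Qed.

(** Half-line integrals are rewritten with a cut-off on the whole line, since the Tonelli and Fubini
    statements used here live on full spaces. *)
Lemma integral_halfline (R : realType) (f : R -> \bar R) :
  (\int[leb R]_(x in `]0%R, +oo[) f x = \int[leb R]_x (if (0 < x)%R then f x else 0))%E.
Proof.
rewrite integral_mkcond; apply: eq_integral => x _.
by rewrite patchE mem_setE in_itv /= andbT.
Qed.

Lemma Rintegral_halfline (R : realType) (f : R -> R) :
  \int[leb R]_(x in `]0%R, +oo[) f x = \int[leb R]_x (if 0 < x then f x else 0).
Proof.
rewrite Rintegral_mkcond; apply: eq_Rintegral => x _.
by rewrite patchE mem_setE in_itv /= andbT.
Qed.

Lemma integrable_halfline (R : realType) (f : R -> R) :
  (leb R).-integrable `]0, +oo[ (EFin \o f) <->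
  (leb R).-integrable setT (fun x => (if 0 < x then f x else 0)%:E).
Proof.
rewrite integrable_mkcond// (_ : _ \_ _ = (fun x => (if 0 < x then f x else 0)%:E))//.
by apply/funext => x; rewrite patchE mem_setE in_itv /= andbT; case: ifP.
Qed.

(** The identity 1/x = x (x^2)^-1 leads to a real power of a nonnegative base; at 0 both sides are 0
    by convention. *)
Lemma measurable_inv (R : realType) : measurable_fun [set: R] (@GRing.inv R).
Proof.
have -> : @GRing.inv R = (fun x => x * (x ^+ 2) `^ (-1)).
  apply/funext => x; rewrite powR_inv1 ?sqr_ge0//.
  have [->|x0] := eqVneq x 0; first by rewrite invr0 mul0r.
  by rewrite expr2 invfM mulrA divff// mul1r.
apply: measurable_funM => //; apply: (measurableT_comp (measurable_powR (-1))) => //.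
Qed.

Lemma is_derive_exprn (R : realType) n (x : R) :
  is_derive x 1 (fun y : R => y ^+ n) (n%:R * x ^+ n.-1).
Proof.
apply: DeriveDef; first exact: exprn_derivable.
by rewrite exp_derive /= ![_ *: _]mulr1.
Qed.

(** The substitution t = 1 / (c s^(j+1)), which exchanges the two ends of the half-line. It holds on
    the compact intervals [1/(k+1), k+1] by the classical theorem for decreasing maps, and monotone
    convergence exhausts the half-line. It is applied with t = 1 / (2 s) and with t = 1 / (4
    s^2). *)
Lemma ge0_integral_subst_invX (R : realType) (c : R) (j : nat) (G : R -> R) :
  0 < c -> (forall t, 0 < t -> 0 <= G t) -> (forall t, 0 < t -> {for t, continuous G}) ->
  (\int[leb R]_(t in `]0%R, +oo[) (G t)%:E =
   \int[leb R]_(s in `]0%R, +oo[) (G (c * s ^+ j.+1)^-1 * (j.+1%:R / (c * s ^+ j.+2)))%:E)%E.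
Proof.
move=> c0 G0 cG.
pose F s : R := (c * s ^+ j.+1)^-1.
have dF (s : R) : 0 < s -> is_derive s 1 F (- (j.+1%:R / (c * s ^+ j.+2))).
  move=> s0; have dg : is_derive s 1 (fun s : R => c * s ^+ j.+1) (c * (j.+1%:R * s ^+ j)).
    by have := is_deriveZ c (is_derive_exprn j.+1 s).
  have s1 : s != 0 by rewrite gt_eqF.
  have c1 : c != 0 by rewrite gt_eqF.
  have sj : c * s ^+ j.+1 != 0 by rewrite mulf_neq0// expf_neq0.
  have := @is_deriveV R (fun s : R => c * s ^+ j.+1) s _ 1 sj dg; set l := (- _ *: _).
  suff -> : l = (- (j.+1%:R / (c * s ^+ j.+2))) by [].
  rewrite /l [_ *: _]mulNr; congr (- _); rewrite !exprS expr0; field.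
  by rewrite s1 c1 /= expf_neq0.
have cP (s : R) : 0 < s -> {for s, continuous (fun s : R => j.+1%:R / (c * s ^+ j.+2))}.
  move=> s0; apply: cvgM; first exact: cvg_cst.
  apply: cvgV; first by rewrite mulf_neq0 ?expf_neq0// gt_eqF.
  by apply: cvgM; [exact: cvg_cst|exact: exprn_continuous].
have cF (s : R) : 0 < s -> {for s, continuous F}.
  move=> s0; apply: differentiable_continuous; apply/derivable1_diffP.
  by have [] := dF s s0.
pose a k : R := k.+1%:R^-1. pose b k : R := k.+1%:R.
have a0 k : 0 < a k by rewrite invr_gt0.
have ab k : a k <= b k.
  by rewrite (@le_trans _ _ 1)// /a /b ?invf_le1// ler1n.
have F0 (s : R) : 0 < s -> 0 < F s by move=> s0; rewrite invr_gt0 mulr_gt0// exprn_gt0.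
have Fdec (x y : R) : 0 < x -> x < y -> F y < F x.
  move=> x0 xy; rewrite ltf_pV2 ?posrE ?mulr_gt0 ?exprn_gt0//; last exact: lt_trans xy.
  by rewrite ltr_pM2l// ltr_pXn2r ?nnegrE// ltW// (lt_trans x0).
have sub k : (\int[leb R]_(t in `[F (b k), F (a k)]) (G t)%:E =
    \int[leb R]_(s in `[a k, b k]) (G (F s) * (j.+1%:R / (c * s ^+ j.+2)))%:E)%E.
  have dFE : {in `]a k, b k[, derive1 F =1 (fun s => - (j.+1%:R / (c * s ^+ j.+2)))}.
    move=> s; rewrite in_itv /= => /andP[as_ _]; rewrite derive1E.
    by have [_ ->] := dF s (lt_trans (a0 k) as_).
  have dFn (s : R) : 0 < s -> \forall t \near s, derive1 F t = - (j.+1%:R / (c * t ^+ j.+2)).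
    move=> s0; have : \forall t \near s, 0 < t by exact: lt_nbhsr.
    by apply: filterS => t t0; rewrite derive1E; have [_ ->] := dF t t0.
  have cD (s : R) : 0 < s -> {for s, continuous (fun s : R => - (j.+1%:R / (c * s ^+ j.+2)))}.
    by move=> s0; apply: cvgN; exact: cP.
  have cF' (s : R) : 0 < s -> {for s, continuous (derive1 F)}.
    move=> s0; have E := nbhs_singleton (dFn s s0); rewrite /prop_for /continuous_at E.
    by apply: cvg_trans (cD s s0); apply: near_eq_cvg; apply: filterS (dFn s s0) => t ->.
  rewrite integration_by_substitution_decreasing//.
  - have cGF (s : R) : 0 < s -> {for s, continuous (G \o F)}.
      by move=> s0; apply: continuous_comp; [exact: cF|exact/cG/F0].
    apply: eq_integral_itv_bounded.
    + apply: open_continuous_measurable_fun; first exact: interval_open.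
      move=> s; rewrite inE /= in_itv /= => /andP[as_ _]; have s0 := lt_trans (a0 k) as_.
      by apply: cvgM; [exact: cGF|apply: cvgN; exact: cF'].
    + apply: open_continuous_measurable_fun; first exact: interval_open.
      move=> s; rewrite inE /= in_itv /= => /andP[as_ _]; have s0 := lt_trans (a0 k) as_.
      apply: cvgM; [exact: cGF|].
      exact: cP.
    + by move=> s sI; rewrite -[j.+1%:R / _]opprK -(dFE s sI).
  - move=> x y; rewrite !in_itv /= => _ /andP[ay _] xy; apply: Fdec => //.
    exact: lt_le_trans ay.
  - move=> s sI; have := sI; rewrite in_itv /= => /andP[as_ _].
    by apply: cF'; exact: lt_trans as_.
  - by apply: cvgP; apply: cvg_at_right_filter; exact: cF'.
  - by apply: cvgP; apply: cvg_at_left_filter; exact: cF'.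
  - split.
    + by move=> s; rewrite in_itv /= => /andP[as_ _]; have [] := dF s (lt_trans (a0 k) as_).
    + by apply: cvg_at_right_filter; exact: cF.
    + by apply: cvg_at_left_filter; exact: cF.
  - apply: continuous_in_subspaceT => t; rewrite inE /= in_itv /= => /andP[tl _].
    by apply: cG; apply: lt_le_trans tl; exact: F0.
have U1 : `]0%R, +oo[%classic = \bigcup_k `[F (b k), F (a k)]%classic.
  apply/seteqP; split => [t /=|t [k _] /=]; rewrite !in_itv /= ?andbT; last first.
    by move=> /andP[h _]; apply: lt_le_trans h; rewrite F0// (lt_le_trans (a0 k)).
  (* One [k] serves both ends: k + 1 exceeds [(c * t)^-1] and [c * t], hence so does its power of
     exponent [j.+1], as k + 1 is at least 1. *)
  move=> t0; pose k := (Num.truncn ((c * t)^-1 + c * t)).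
  have := truncnS_gt ((c * t)^-1 + c * t); rewrite -/k -/(b k) => kb.
  have ct : 0 < c * t by rewrite mulr_gt0.
  have b1 : 1 <= b k by rewrite ler1n.
  have bX : b k <= b k ^+ j.+1 by rewrite exprS ler_peMr ?exprn_ege1// (le_trans ler01).
  exists k => //=; rewrite in_itv /= /F; apply/andP; split.
    rewrite -[leRHS]invrK lef_pV2 ?posrE ?invr_gt0 ?mulr_gt0 ?exprn_gt0 ?(lt_le_trans ltr01 b1)//.
    rewrite -ler_pdivrMl// -invfM; apply: le_trans bX; apply: ltW; apply: le_lt_trans kb.
    by rewrite lerDl ltW.
  rewrite invfM /a exprVn invrK -ler_pdivrMl ?invr_gt0// invrK.
  by apply: le_trans bX; apply: ltW; apply: le_lt_trans kb; rewrite lerDr invr_ge0 ltW.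
have U2 : `]0%R, +oo[%classic = \bigcup_k `[a k, b k]%classic.
  apply/seteqP; split => [s /=|s [k _] /=]; rewrite !in_itv /= ?andbT; last first.
    by move=> /andP[h _]; exact: lt_le_trans h.
  move=> s0; pose k := (Num.truncn (s + s^-1)).
  exists k => //=; rewrite in_itv /=; apply/andP; split.
    rewrite /a -[leRHS]invrK lef_pV2 ?posrE ?invr_gt0//; apply: ltW; apply: le_lt_trans (truncnS_gt _).
    by rewrite lerDr ltW.
  apply: ltW; apply: le_lt_trans (truncnS_gt _).
  by rewrite lerDl invr_ge0 ltW.
have := @ge0_nondecreasing_set_cvg_integral _ (measurableTypeR R) R (fun k => `[F (b k), F (a k)]%classic) (EFin \o G) (leb R).
have := @ge0_nondecreasing_set_cvg_integral _ (measurableTypeR R) R (fun k => `[a k, b k]%classic) (EFin \o (fun s => G (F s) * (j.+1%:R / (c * s ^+ j.+2)))) (leb R).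
rewrite -U1 -U2 => c2 c1.
have mFj : measurable_fun (`]0, +oo[%classic : set (measurableTypeR R)) (EFin \o (fun s => G (F s) * (j.+1%:R / (c * s ^+ j.+2)))).
  apply/measurable_EFinP; apply: open_continuous_measurable_fun; first exact: interval_open.
  move=> s; rewrite inE /= in_itv /= andbT => s0.
  by apply: cvgM; [apply: continuous_comp; [exact: cF|exact/cG/F0]|exact: cP].
have mG : measurable_fun (`]0, +oo[%classic : set (measurableTypeR R)) (EFin \o G).
  apply/measurable_EFinP; apply: open_continuous_measurable_fun; first exact: interval_open.
  by move=> s; rewrite inE /= in_itv /= andbT => s0; exact: cG.
have hE : (fun k => \int[leb R]_(t in `[F (b k), F (a k)]) (EFin \o G) t)%E =
    (fun k => \int[leb R]_(s in `[a k, b k]) (EFin \o (fun s => (G (F s) * (j.+1%:R / (c * s ^+ j.+2)))%R)) s)%E.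
  by apply/funext => k; exact: sub.
rewrite hE in c1.
apply: (cvg_unique _ (c1 _ _ _ _) (c2 _ _ _ _)) => //.
- move=> n m nm; apply/subsetPset => s /=; rewrite !in_itv /= => /andP[h1 h2].
  have bnm : b n <= b m by rewrite ler_nat.
  have anm : a m <= a n by rewrite lef_pV2 ?posrE.
  apply/andP; split; [apply: le_trans h1 | apply: (le_trans h2)].
    have [->//|bne] := eqVneq (b n) (b m).
    by rewrite ltW// Fdec// ?(lt_le_trans (a0 n))// lt_neqAle bne.
  have [->//|ane] := eqVneq (a m) (a n).
  by rewrite ltW// Fdec// lt_neqAle ane.
- move=> k; apply: measurable_funS mG => //.
  move=> s /=; rewrite !in_itv /= => /andP[h1 _]; rewrite andbT; apply: lt_le_trans h1.
  by rewrite F0// (lt_le_trans (a0 k)).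
- move=> k s /=; rewrite !in_itv /= => /andP[h1 _]; rewrite lee_fin G0//; apply: lt_le_trans h1.
  by rewrite F0// (lt_le_trans (a0 k)).
- move=> n m nm; apply/subsetPset => s /=; rewrite !in_itv /= => /andP[h1 h2].
  apply/andP; split; [apply: le_trans h1 | apply: (le_trans h2)].
    by rewrite lef_pV2 ?posrE// ler_nat.
  by rewrite ler_nat.
- move=> k; apply: measurable_funS mFj => //.
  by move=> s /=; rewrite !in_itv /= => /andP[h1 _]; rewrite andbT; apply: lt_le_trans h1.
- move=> k s /=; rewrite !in_itv /= => /andP[h1 _]; have s0 := lt_le_trans (a0 k) h1.
  by rewrite lee_fin mulr_ge0 ?G0 ?F0// divr_ge0// mulr_ge0 ?exprn_ge0// ltW.
Unshelve. all: by end_near. Qed.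
Section measurable_pointwise.
Context d (T : measurableType d) (R : realType).
Implicit Types f g : T -> R.

Lemma measurable_fun_expR f : measurable_fun [set: T] f -> measurable_fun [set: T] (fun x => expR (f x)).
Proof. exact: measurableT_comp. Qed.

Lemma measurable_fun_inv f : measurable_fun [set: T] f -> measurable_fun [set: T] (fun x => (f x)^-1).
Proof. by apply: measurableT_comp; exact: measurable_inv. Qed.

Lemma measurable_fun_opp f : measurable_fun [set: T] f -> measurable_fun [set: T] (fun x => - f x).
Proof. exact: measurableT_comp. Qed.

Lemma measurable_fun_norm f : measurable_fun [set: T] f -> measurable_fun [set: T] (fun x => `|f x|).
Proof. exact: measurableT_comp. Qed.

Lemma measurable_fun_powR f p : measurable_fun [set: T] f -> measurable_fun [set: T] (fun x => f x `^ p).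
Proof. by apply: (measurableT_comp (measurable_powR p)). Qed.

Lemma measurable_fun_sqrt f : measurable_fun [set: T] f -> measurable_fun [set: T] (fun x => Num.sqrt (f x)).
Proof.
by apply: (@measurableT_comp _ _ _ _ _ _ (@Num.sqrt R)); apply: continuous_measurable_fun; exact: sqrt_continuous.
Qed.

(** Cut-offs are written with a condition of the form [0 < f x] (for instance [0 < enorm z - eps] or
    [0 < s - q]) so that this lemma covers them. *)
Lemma measurable_fun_if_gt0 f (g h : T -> R) : measurable_fun [set: T] f ->
  measurable_fun [set: T] g -> measurable_fun [set: T] h ->
  measurable_fun [set: T] (fun x => if 0 < f x then g x else h x).
Proof. by move=> mf mg mh; apply: measurable_fun_ifT => //; exact: measurable_fun_ltr. Qed.
Lemma measurable_fun_scaler n (c : T -> R) (f : T -> 'rV[R]_n) :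
  measurable_fun [set: T] c -> measurable_fun [set: T] f ->
  measurable_fun [set: T] (fun x => c x *: f x).
Proof.
move=> mc mf; rewrite [X in measurable_fun _ X](_ : _ = (fun x => c x *: f x + 0)).
  exact: measurable_rV_lin.
by apply/funext => x; rewrite addr0.
Qed.

Lemma measurable_fun_rVadd n (f g : T -> 'rV[R]_n) :
  measurable_fun [set: T] f -> measurable_fun [set: T] g ->
  measurable_fun [set: T] (fun x => f x + g x).
Proof.
move=> mf mg; rewrite [X in measurable_fun _ X](_ : _ = (fun x => 1 *: f x + g x)).
  exact: measurable_rV_lin.
by apply/funext => x; rewrite scale1r.
Qed.

Lemma measurable_fun_rVopp n (f : T -> 'rV[R]_n) :
  measurable_fun [set: T] f -> measurable_fun [set: T] (fun x => - f x).
Proof.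
move=> mf; rewrite [X in measurable_fun _ X](_ : _ = (fun x => -1 *: f x)).
  exact: measurable_fun_scaler.
by apply/funext => x; rewrite scaleN1r.
Qed.

Lemma measurable_fun_coord n (f : T -> 'rV[R]_n) (i : 'I_n) :
  measurable_fun [set: T] f -> measurable_fun [set: T] (fun x => f x 0 i).
Proof. by move=> mf; apply: (measurableT_comp (measurable_rV_coord i)). Qed.

Lemma measurable_fun_rVpair n (f : T -> 'rV[R]_n) (g : T -> R) :
  measurable_fun [set: T] f -> measurable_fun [set: T] g ->
  measurable_fun [set: T] (fun x => rVpair (f x) (g x)).
Proof. by move=> mf mg; exact: (measurable_comp2 (@measurable_rVpair R n)). Qed.

Lemma measurable_fun_rVhead n (f : T -> 'rV[R]_n.+1) :
  measurable_fun [set: T] f -> measurable_fun [set: T] (fun x => rVhead (f x)).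
Proof. by apply: (measurableT_comp (@measurable_rVhead R n)). Qed.

Lemma measurable_fun_rVlast n (f : T -> 'rV[R]_n.+1) :
  measurable_fun [set: T] f -> measurable_fun [set: T] (fun x => rVlast (f x)).
Proof. exact: measurable_fun_coord. Qed.
End measurable_pointwise.

Ltac meas :=
  repeat first
  [ assumption | exact: measurable_cst | exact: measurable_id
  | exact: normr_measurable | exact: measurable_fst | exact: measurable_snd
  | match goal with
    | |- measurable_fun _ (fun x => EFin (@?f x)) => apply/measurable_EFinP; rewrite /comp
    | |- measurable_fun _ (fun x => mule (@?f x) (@?g x)) => apply: (@emeasurable_funM _ _ _ _ f g)
    | |- measurable_fun _ (fun x => GRing.add (@?f x) (@?g x)) => apply: (@measurable_funD _ _ _ _ f g)
    | mF : measurable_fun _ ?F |- measurable_fun _ (fun x => ?F (@?u x)) => apply: (measurableT_comp mF)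
    | mF : measurable_fun _ (fun p => ?F p.1 p.2) |- measurable_fun _ (fun x => ?F (@?u x) (@?v x)) =>
        apply: (measurable_comp2 mF)
    | |- measurable_fun _ (fun x => GRing.add (@?f x) (@?g x)) => apply: (@measurable_fun_rVadd _ _ _ _ f g)
    | |- measurable_fun _ (fun x => GRing.opp (@?f x)) => apply: (@measurable_fun_rVopp _ _ _ _ f)
    | |- measurable_fun _ (fun x => GRing.scale (@?c x) (@?f x)) => apply: (@measurable_fun_scaler _ _ _ _ c f)
    | |- measurable_fun _ (fun x => rVpair (@?f x) (@?g x)) => apply: (@measurable_fun_rVpair _ _ _ _ f g)
    | |- measurable_fun _ (fun x => rVhead (@?f x)) => apply: (@measurable_fun_rVhead _ _ _ _ f)
    | |- measurable_fun _ (fun x => rVlast (@?f x)) => apply: (@measurable_fun_rVlast _ _ _ _ f)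
    | |- measurable_fun _ (fun x => fun_of_matrix (@?f x) _ ?i) => apply: (@measurable_fun_coord _ _ _ _ f i)
    | |- measurable_fun _ (fun x => GRing.mul (@?f x) (@?g x)) => apply: (@measurable_funM _ _ _ _ f g)
    | |- measurable_fun _ (fun x => GRing.exp (@?f x) ?n) => apply: (@measurable_funX _ _ _ _ f n)
    | |- measurable_fun _ (fun x => GRing.opp (@?f x)) => apply: (@measurable_fun_opp _ _ _ f)
    | |- measurable_fun _ (fun x => GRing.inv (@?f x)) => apply: (@measurable_fun_inv _ _ _ f)
    | |- measurable_fun _ (fun x => expR (@?f x)) => apply: (@measurable_fun_expR _ _ _ f)
    | |- measurable_fun _ (fun x => Num.norm (@?f x)) => apply: (@measurable_fun_norm _ _ _ f)
    | |- measurable_fun _ (fun x => Num.sqrt (@?f x)) => apply: (@measurable_fun_sqrt _ _ _ f)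
    | |- measurable_fun _ (fun x => powR (@?f x) ?n) => apply: (@measurable_fun_powR _ _ _ f n)
    | |- measurable_fun _ (fun x => enorm (@?f x)) => apply: (measurable_enorm (f := f))
    | |- measurable_fun _ (fun x => dotp (@?f x) (@?g x)) => apply: (measurable_dotp (f := f) (g := g))
    | |- measurable_fun _ (fun x => if _ then _ else _) => apply: measurable_fun_if_gt0
    end ].

(** * Gaussian moments on the half-line and the Gamma function *)

Lemma EFin_halfline (R : realType) (f : R -> R) :
  (\int[leb R]_x (if (0 < x)%R then (f x)%:E else 0) = \int[leb R]_x (if 0 < x then f x else 0)%:E)%E.
Proof. by apply: eq_integral => x _; case: ifP. Qed.

(** Half of the Gamma function at (k+1)/2. *)
Definition gauss_moment (R : realType) (k : nat) : R :=
  \int[leb R]_s (if 0 < s then s ^+ k * expR (- s ^+ 2) else 0).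

Lemma exprn_le_expR (R : realType) (k : nat) (x : R) : 0 <= x -> x ^+ k <= k`!%:R * expR x.
Proof.
move=> x0; case: k => [|k].
  by rewrite expr0 mul1r; apply: le_trans (expR_ge1Dx x); rewrite lerDl.
have := expR_ge1Dxn k x0.
rewrite -ler_pdivrMl// mulrC; apply: le_trans; by rewrite lerDr.
Qed.

Lemma exprn_gauss_le (R : realType) (k : nat) (x : R) : 0 <= x ->
  x ^+ k * expR (- x ^+ 2) <= k`!%:R * expR 1 * expR (- (2^-1 * x) ^+ 2).
Proof.
move=> x0; apply: (@le_trans _ _ (k`!%:R * expR x * expR (- x ^+ 2))).
  by rewrite ler_wpM2r ?expR_ge0// exprn_le_expR.
rewrite -!mulrA ler_wpM2l ?ler0n// -!expRD ler_expR exprMn.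
(* The exponents compare because 1 - x + 3/4 x^2 = 3/4 (x - 2/3)^2 + 2/3. *)
by have := sqr_ge0 (x - 2/3); rewrite sqrrB; lra.
Qed.

Lemma ge0_integrable (R : realType) d (T : measurableType d) (mu : {measure set T -> \bar R}) (f : T -> R) :
  measurable_fun [set: T] f -> (forall x, 0 <= f x) ->
  (\int[mu]_x (f x)%:E < +oo)%E -> mu.-integrable setT (fun x => (f x)%:E).
Proof.
move=> mf f0 foo; apply/integrableP; split; first exact/measurable_EFinP.
by under eq_integral do rewrite /= ger0_norm//.
Qed.

Lemma dominated_integrable_by (R : realType) d (T : measurableType d) (mu : {measure set T -> \bar R}) (f g : T -> R) :
  measurable_fun [set: T] f -> mu.-integrable setT (fun x => (g x)%:E) ->
  (forall x, `|f x| <= g x) -> mu.-integrable setT (fun x => (f x)%:E).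
Proof.
move=> mf ig fg; apply: le_integrable ig => //; first exact/measurable_EFinP.
by move=> x _ /=; rewrite lee_fin (le_trans (fg x))// ler_norm.
Qed.

Arguments dominated_integrable_by {R d T mu} f g.
Arguments ge0_integrable {R d T mu} f.

Lemma integrable_gauss (R : realType) (c : R) : 0 < c ->
  (leb R).-integrable setT (fun x => (expR (- (c * x) ^+ 2))%:E).
Proof.
move=> c0; apply: (ge0_integrable (fun x : measurableTypeR R => expR (- (c * x) ^+ 2))); last 1 first.
- under eq_integral do rewrite exprMn.
  by rewrite ge0_integral_gauss// ltry.
- by meas.
- by move=> x; exact: expR_ge0.
Qed.

Lemma integrable_gauss_moment (R : realType) k :
  (leb R).-integrable setT (fun s => (if 0 < s then s ^+ k * expR (- s ^+ 2) else 0)%:E).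
Proof.
apply: (dominated_integrable_by (fun s : measurableTypeR R => if 0 < s then s ^+ k * expR (- s ^+ 2) else 0) (fun s : measurableTypeR R => k`!%:R * expR 1 * expR (- (2^-1 * s) ^+ 2))).
- by meas.
- under eq_fun do rewrite EFinM.
  by apply: integrableZl => //; apply: integrable_gauss.
- move=> s; case: ifPn => [s0|_].
    by rewrite ger0_norm ?mulr_ge0 ?exprn_ge0 ?expR_ge0 ?exprn_gauss_le// ltW.
  by rewrite normr0 !mulr_ge0 ?expR_ge0.
Qed.

Lemma gauss_momentE (R : realType) k :
  (\int[leb R]_s (if 0 < s then s ^+ k * expR (- s ^+ 2) else 0)%:E = (gauss_moment R k)%:E)%E.
Proof. by rewrite /gauss_moment /Rintegral fineK//; exact: integrable_fin_num (integrable_gauss_moment _ _). Qed.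

Lemma gauss_moment_scale (R : realType) k (b : R) : 0 < b ->
  (\int[leb R]_s (if (0 < s)%R then s ^+ k * expR (- (b * s) ^+ 2) else 0)%:E = (gauss_moment R k / b ^+ k.+1)%:E)%E.
Proof.
move=> b0; have := gauss_momentE R k; rewrite (ge0_integral_affine (c := b) 0) ?gt_eqF//; last 2 first.
- by have /integrableP[] := integrable_gauss_moment R k.
- by move=> x; rewrite lee_fin; case: ifPn => // x0; rewrite mulr_ge0 ?exprn_ge0 ?expR_ge0// ltW.
rewrite gtr0_norm//; set I := (\int[_]_s _)%E => E; set J := (\int[_]_s _)%E.
have IJ : I = ((b ^+ k)%:E * J)%E.
  rewrite -ge0_integralZl//.
  - apply: eq_integral => s _; rewrite addr0 pmulr_rgt0// exprMn -EFinM.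
    by case: ifPn => _; rewrite ?mulr0// mulrA.
  - by meas.
  - by move=> s _; rewrite lee_fin; case: ifPn => // s0; rewrite mulr_ge0 ?exprn_ge0 ?expR_ge0// ltW.
  - by rewrite lee_fin exprn_ge0// ltW.
rewrite IJ muleA -EFinM -exprS in E.
rewrite mulrC EFinM -E muleA -EFinM mulVf ?mul1e// expf_neq0// gt_eqF//.
Qed.

Lemma gauss_moment_gt0 (R : realType) k : 0 < gauss_moment R k.
Proof.
rewrite lt_neqAle eq_sym; apply/andP; split; last first.
  apply: Rintegral_ge0 => s _; case: ifPn => // s0.
  by rewrite mulr_ge0 ?exprn_ge0 ?expR_ge0// ltW.
apply/eqP => G0; have := gauss_momentE R k; rewrite G0.
(* On this interval of length 1 the integrand is at least e^-4, which contradicts a vanishing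
   integral. *)
pose D : set (measurableTypeR R) := [set` `]1%R, 2%R]].
have mD : measurable D by exact: measurable_itv.
have : (\int[leb R]_(s in D) (expR (- 4))%:E <= \int[leb R]_s (if 0 < s then s ^+ k * expR (- s ^+ 2) else 0)%:E)%E.
  rewrite [leLHS]integral_mkcond; apply: ge0_le_integral => //.
  - by move=> s _; rewrite patchE; case: ifPn => // _; rewrite lee_fin expR_ge0.
  - by apply/(measurable_restrictT _ _).1.
  - by have /integrableP[] := integrable_gauss_moment R k.
  - move=> s _; rewrite patchE; case: ifPn => [|_]; last first.
      by rewrite lee_fin; case: ifPn => // s0; rewrite mulr_ge0 ?exprn_ge0 ?expR_ge0// ltW.
    rewrite inE /D /= in_itv /= => /andP[s1 s2]; rewrite lee_fin (lt_trans ltr01)//.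
    rewrite -[leLHS]mul1r ler_pM ?expR_ge0// ?exprn_ege1 ?(ltW s1)//.
    rewrite ler_expR lerN2; have -> : (4 : R) = 2 ^+ 2 by rewrite -natrX.
    by rewrite ler_sqr ?nnegrE// ltW// (lt_trans ltr01).
rewrite integral_cst// => h E; move: h; rewrite E.
have D1 : leb R D = 1%:E.
  have := @lebesgue_measure_itv R `]1%R, 2%R]; rewrite /= lte_fin ltr1n -EFinD => ->.
  by congr EFin; lra.
move=> h; have {h} : ((expR (-4))%:E * leb R D <= 0%:E)%E by [].
by rewrite D1 mule1 lee_fin leNgt expR_gt0.
Qed.

Lemma gauss_moment0 (R : realType) : gauss_moment R 0 = Num.sqrt pi / 2.
Proof.
rewrite /gauss_moment; under eq_Rintegral do rewrite expr0 mul1r.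
rewrite -(Rintegral_halfline (fun s : R => expR (- s ^+ 2))) Rintegral_itv_obnd_cbnd; last first.
  apply/integrable_halfline; have := integrable_gauss_moment R 0.
  by under eq_fun do rewrite expr0 mul1r.
by rewrite /Rintegral integral0y_gauss.
Qed.

(** The substitution t = 1 / (2 s) in [gauss_moment]. The factor 2 matches the Gaussian exp (- |y|^2
    / (2 s)^2), where s is the variable of integration. *)
Lemma gauss_moment_inv (R : realType) (p : nat) :
  (\int[leb R]_s (if 0 < s then s ^- p.+2 * expR (- (2 * s) ^- 2) else 0)%:E =
   (2 ^+ p.+1 * gauss_moment R p)%:E)%E.
Proof.
have := gauss_momentE R p.
rewrite -EFin_halfline -(integral_halfline (fun s : R => (s ^+ p * expR (- s ^+ 2))%:E)).
rewrite (ge0_integral_subst_invX (c := 2) 0)//; last 2 first.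
- by move=> t t0; rewrite mulr_ge0 ?exprn_ge0 ?expR_ge0// ltW.
- move=> t _; apply: cvgM; first exact: exprn_continuous.
  apply: (@continuous_comp _ _ _ (fun x : R => - x ^+ 2) expR); last exact: continuous_expR.
  by apply: cvgN; exact: exprn_continuous.
rewrite integral_halfline EFin_halfline => E; rewrite EFinM -E -ge0_integralZl//; last 2 first.
- by meas.
- move=> s _; rewrite lee_fin; case: ifPn => // s0.
  by rewrite !mulr_ge0 ?exprn_ge0 ?expR_ge0// ?invr_ge0 ?mulr_ge0 ?exprn_ge0// ltW.
apply: eq_integral => s _; case: ifPn => s0; rewrite ?mule0// -EFinM; congr EFin.
rewrite expr1 exprVn; set E2 := expR _; set E3 := expR _.
have -> : E2 = E3 by rewrite /E2 /E3 -!exprVn.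
rewrite exprMn !exprS expr0; field.
by rewrite expf_neq0 ?gt_eqF.
Qed.

(** With t = (2 s)^-2 the Gamma integral becomes the one of [gauss_moment_inv], so that the
    substitution lemma already proved for negative powers suffices. *)
Lemma Gamma_gauss_moment (R : realType) (p : nat) :
  Gamma (p.+1%:R / 2 : R) = 2 * gauss_moment R p.
Proof.
rewrite /Gamma /Rintegral (ge0_integral_subst_invX (c := 4) 1)//; last 2 first.
- by move=> t t0; rewrite mulr_ge0 ?expR_ge0 ?powR_ge0.
- move=> t t0; apply: cvgM.
    have : {for t, continuous (fun x : R => x `^ (p.+1%:R / 2 - 1))}; last by [].
    by apply: differentiable_continuous; apply/derivable1_diffP; have [] := is_derive1_powR (p.+1%:R / 2 - 1) t0.
  apply: (@continuous_comp _ _ _ (fun x : R => - x) expR); last exact: continuous_expR.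
  by apply: cvgN; exact: cvg_id.
have -> : 2 * gauss_moment R p = fine ((2 / 2 ^+ p.+1)%:E * (2 ^+ p.+1 * gauss_moment R p)%:E)%E.
  by rewrite -EFinM /= mulrA divfK ?expf_neq0.
rewrite -gauss_moment_inv -ge0_integralZl//; last 2 first.
- by meas.
- move=> s _; rewrite lee_fin; case: ifPn => // s0.
  by rewrite mulr_ge0 ?invr_ge0 ?exprn_ge0 ?expR_ge0 ?(ltW s0).
rewrite integral_halfline; congr fine; apply: eq_integral => s _; case: ifPn => s0; rewrite ?mule0// -EFinM; congr EFin.
have E4 : 4 * s ^+ 2 = (2 * s) ^+ 2 by rewrite exprMn -natrX.
rewrite E4.
have s2 : 0 < 2 * s by rewrite mulr_gt0.
have -> : ((2 * s) ^+ 2)^-1 `^ (p.+1%:R / 2 - 1) = (2 * s) ^+ 2 / (2 * s) ^+ p.+1.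
  rewrite powRD; last by apply/implyP => _; rewrite invr_neq0// expf_neq0// gt_eqF.
  rewrite powRN powRr1 ?invr_ge0 ?sqr_ge0// invrK mulrC; congr (_ * _).
  rewrite -powR_inv1 ?sqr_ge0// -powRrM -[(2 * s) ^+ 2]powR_mulrn ?ltW// -powRrM.
  have -> : 2 * (-1 * (p.+1%:R / 2)) = - p.+1%:R :> R by field.
  by rewrite powRN powR_mulrn// ltW.
set e := expR _; rewrite !exprMn !exprS !expr0; field.
by rewrite ?mulf_neq0 ?expf_neq0 ?gt_eqF.
Qed.

(** * The Riesz and backprojection kernels *)

Lemma measurable_rV_set1 (R : realType) n (a : 'rV[R]_n) : measurable [set a].
Proof.
rewrite (_ : [set a] = \bigcap_(i in [set: 'I_n]) (@rV_coord R n i @^-1` [set a 0 i])).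
  apply: fin_bigcap_measurable => // i _.
  by rewrite -[X in measurable X]setTI; exact: measurable_rV_coord.
apply/seteqP; split => [x /= -> i _ //|x /= H].
by apply/rowP => i; exact: H.
Qed.

Lemma rV0_null (R : realType) (n : nat) : lebesgue_rV R n.+1 [set 0] = 0%E.
Proof.
rewrite /= /lebesgue_step /pushforward.
have le0 : ((lebesgue_rV R n \x leb R) ((fun p => rVpair p.1 (p.2 : R)) @^-1` [set 0%R]) <=
   (lebesgue_rV R n \x leb R) (setT `*` [set 0%R]))%E.
  apply: le_measure; rewrite ?inE.
  - have := @measurable_rVpair R n measurableT [set 0]; rewrite setTI; apply.
    exact: measurable_rV_set1.
  - by apply: measurableX => //; exact: measurable_set1.
  - move=> [x t] /= E; split => //=; rewrite -[LHS](rVpair_last x t) E.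
    by rewrite /rVlast mxE.
apply/eqP; rewrite eq_le measure_ge0 andbT; apply: le_trans le0 _.
rewrite product_measure1E//.
have L0 : leb R [set 0] = 0%E by exact: lebesgue_measure_set1.
by rewrite [X in (_ * X)%E]L0 mule0.
Qed.

(** At the origin the homogeneous kernels have the conventional value 0 while the superposition of
    Gaussians diverges; identities between the two are needed only off this point. The dimension is
    positive, as in dimension 0 the measure is the Dirac mass at the origin. *)
Lemma eq_integral_rV_neq0 (R : realType) (n : nat) (f g : 'rV[R]_n.+1 -> \bar R) :
  measurable_fun [set: 'rV[R]_n.+1] f -> measurable_fun [set: 'rV[R]_n.+1] g ->
  (forall x, 0 <= f x)%E -> (forall x, 0 <= g x)%E ->
  (forall x, x != 0 -> f x = g x) ->
  (\int[lebesgue_rV R n.+1]_x f x = \int[lebesgue_rV R n.+1]_x g x)%E.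
Proof.
move=> mf mg f0 g0 fg; apply: ge0_ae_eq_integral => //.
exists [set 0]; split; [exact: measurable_rV_set1|exact: rV0_null|].
move=> x /= H; apply/eqP; apply: contra_notT H => x0 _; exact: fg.
Qed.

Section gauss_kernel.
Context (R : realType) (n : nat).
(** The heat kernel at time 1/4, of total mass 1. Displacements [(2 * s) *: z] under this fixed
    density realize the heat kernel at time s^2. *)
Definition gauss_kernel (z : 'rV[R]_n) : R := (Num.sqrt pi) ^- n * expR (- dotp z z).

Lemma gauss_kernel_ge0 z : 0 <= gauss_kernel z.
Proof. by rewrite mulr_ge0 ?expR_ge0 ?invr_ge0 ?exprn_ge0 ?sqrtr_ge0. Qed.

Lemma measurable_gauss_kernel d (T : measurableType d) (f : T -> 'rV[R]_n) :
  measurable_fun [set: T] f -> measurable_fun [set: T] (fun x => gauss_kernel (f x)).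
Proof. by move=> mf; rewrite /gauss_kernel; meas. Qed.

Lemma integral_gauss_kernel : (\int[lebesgue_rV R n]_z (gauss_kernel z)%:E = 1)%E.
Proof.
have p0 : (0 : R) < Num.sqrt pi by rewrite sqrtr_gt0 pi_gt0.
under eq_integral do rewrite EFinM.
rewrite ge0_integralZl//.
- have := @ge0_integral_gauss_rV R n 1 ltr01; rewrite divr1.
  move=> E; rewrite (_ : (\int[_]_x _)%E = (Num.sqrt pi ^+ n)%:E); last first.
    by rewrite -E; apply: eq_integral => z _; rewrite expr1n mul1r.
  by rewrite -EFinM mulVf// expf_neq0// gt_eqF.
- by meas.
Qed.
End gauss_kernel.

Lemma dotpZ (R : realType) n (c : R) (z : 'rV[R]_n) : dotp (c *: z) (c *: z) = c ^+ 2 * dotp z z.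
Proof. by rewrite /dotp mulr_sumr; apply: eq_bigr => i _; rewrite !mxE; ring. Qed.

Lemma enorm0_eq0 (R : realType) n (z : 'rV[R]_n) : enorm z = 0 -> z = 0.
Proof.
move=> z0; have : dotp z z = 0 by rewrite -enorm_sq z0 expr0n.
move=> /eqP; rewrite psumr_eq0 => [/allP H|i _]; last by rewrite -expr2 sqr_ge0.
apply/rowP => i; have := H i; rewrite mem_index_enum => /(_ isT).
by rewrite mulf_eq0 orbb mxE => /eqP.
Qed.

Lemma enorm_gt0 (R : realType) n (z : 'rV[R]_n) : z != 0 -> 0 < enorm z.
Proof.
by move=> z0; rewrite lt_neqAle enorm_ge0 andbT eq_sym; apply: contra z0 => /eqP/enorm0_eq0 ->.
Qed.

(* Superposing Gaussians of all widths gives the homogeneous kernels. *)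
Lemma ge0_integral_riesz (R : realType) (n p : nat) (F : 'rV[R]_n.+1 -> \bar R) :
  measurable_fun [set: 'rV[R]_n.+1] F -> (forall x, 0 <= F x)%E ->
  (\int[leb R]_s \int[lebesgue_rV R n.+1]_z
     (((if (0 < s)%R then s ^+ n.+1 / s ^+ p.+2 else 0) * gauss_kernel z)%:E * F ((2 * s) *: z)%R) =
   (2 ^- n.+1 * Num.sqrt pi ^- n.+1 * (2 ^+ p.+1 * gauss_moment R p))%:E *
   \int[lebesgue_rV R n.+1]_y ((enorm y ^- p.+1)%:E * F y))%E.
Proof.
move=> mF F0.
have p0 : (0 : R) < Num.sqrt pi by rewrite sqrtr_gt0 pi_gt0.
pose C := 2 ^- n.+1 * Num.sqrt pi ^- n.+1 : R.
have C0 : 0 <= C by rewrite mulr_ge0 ?invr_ge0 ?exprn_ge0 ?(ltW p0).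
pose k (s : measurableTypeR R) (y : 'rV[R]_n.+1) : R := if 0 < s then s ^- p.+2 * expR (- (dotp y y / (2 * s) ^+ 2)) else 0.
have k0 s y : 0 <= k s y.
  by rewrite /k; case: ifPn => // s0; rewrite mulr_ge0 ?expR_ge0 ?invr_ge0 ?exprn_ge0 ?(ltW s0).
have mk : measurable_fun [set: measurableTypeR R * 'rV[R]_n.+1] (fun q => k q.1 q.2).
  by rewrite /k; meas.
(* Substitution y = 2 s z: the Jacobian absorbs [s ^+ n.+1] and leaves s^-(p+2), while its power of
   2 goes into [C]. *)
transitivity (\int[leb R]_s \int[lebesgue_rV R n.+1]_y ((C * k s y)%:E * F y))%E.
  apply: eq_integral => s _; rewrite /k; case: ifPn => s0; last first.
    by rewrite !integral0_eq// => y _; rewrite ?mulr0 ?mul0r mul0e.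
  have s2 : 2 * s != 0 by rewrite gt_eqF// mulr_gt0.
  rewrite [RHS](ge0_integral_rV_affine (c := 2 * s) 0 s2); last 2 first.
  - by meas.
  - by move=> y; rewrite mule_ge0// lee_fin mulr_ge0// mulr_ge0 ?expR_ge0 ?invr_ge0 ?exprn_ge0 ?(ltW s0).
  rewrite -ge0_integralZl//; last 2 first.
  - by meas.
  - by move=> y _; rewrite mule_ge0// lee_fin mulr_ge0// mulr_ge0 ?expR_ge0 ?invr_ge0 ?exprn_ge0 ?(ltW s0).
  apply: eq_integral => z _; rewrite addr0 muleA -EFinM; congr (_%:E * _)%E.
  have -> : dotp ((2 * s) *: z) ((2 * s) *: z) / (2 * s) ^+ 2 = dotp z z.
    by rewrite dotpZ mulrAC divff ?expf_neq0// mul1r.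
  rewrite gtr0_norm ?mulr_gt0// /gauss_kernel /C exprMn.
  by field; rewrite !expf_neq0// ?gt_eqF.
rewrite (tonelli_swap (leb R) (lebesgue_rV R n.+1) (fun s y => (C * k s y)%:E * F y)%E); last 2 first.
- by meas.
- by move=> s y; rewrite mule_ge0// lee_fin mulr_ge0.
rewrite -ge0_integralZl//; last 3 first.
- by meas.
- by move=> y _; rewrite mule_ge0// lee_fin invr_ge0 exprn_ge0// enorm_ge0.
- by rewrite lee_fin mulr_ge0// mulr_ge0 ?exprn_ge0// ltW// gauss_moment_gt0.
apply: eq_integral_rV_neq0.
- apply: (measurable_integral_l (leb R) (fun s y => (C * k s y)%:E * F y)%E); first by meas.
  by move=> s y; rewrite mule_ge0// lee_fin mulr_ge0.
- by meas.
- by move=> y; apply: integral_ge0 => s _; rewrite mule_ge0// lee_fin mulr_ge0.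
- move=> y; rewrite !mule_ge0 ?lee_fin ?invr_ge0 ?exprn_ge0 ?enorm_ge0//.
  by rewrite mulr_ge0// mulr_ge0 ?exprn_ge0// ltW// gauss_moment_gt0.
move=> y /enorm_gt0 y0.
rewrite ge0_integralZr//; last 2 first.
- by meas.
- by move=> s _; rewrite lee_fin mulr_ge0.
have mky : measurable_fun [set: measurableTypeR R] (fun s => (k s y)%:E) by meas.
have ky0 s : True -> (0 <= (k s y)%:E)%E by rewrite lee_fin.
have -> : (\int[leb R]_s (C * k s y)%:E = C%:E * \int[leb R]_s (k s y)%:E)%E.
  by rewrite -ge0_integralZl// lee_fin.
rewrite -/C (EFinM C) -!muleA; congr (_ * _)%E; rewrite [in RHS]muleA; congr (_ * _)%E.
(* Replacing s by s / |y| in this moment extracts the homogeneous factor |y|^-(p+1). *)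
have := gauss_moment_inv R p.
rewrite (ge0_integral_affine (c := (enorm y)^-1) 0); last 3 first.
- by rewrite invr_neq0// gt_eqF.
- by meas.
- by move=> s; rewrite lee_fin; case: ifPn => // s0; rewrite mulr_ge0 ?invr_ge0 ?exprn_ge0 ?expR_ge0 ?(ltW s0).
rewrite gtr0_norm ?invr_gt0// => E.
rewrite -E [X in ((enorm y)^-1%:E * X)%E](_ : _ = (\int[leb R]_x ((enorm y ^+ p.+2)%:E * (k x y)%:E))%E); last first.
  apply: eq_integral => s _; rewrite addr0 pmulr_rgt0 ?invr_gt0// -EFinM; congr EFin.
  rewrite /k; case: ifPn => s0; last by rewrite mulr0.
  have -> : ((enorm y)^-1 * s) ^- p.+2 = enorm y ^+ p.+2 * s ^- p.+2.
    by rewrite exprMn exprVn invfM invrK.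
  have -> : (2 * ((enorm y)^-1 * s)) ^- 2 = dotp y y / (2 * s) ^+ 2.
    by rewrite mulrCA exprMn exprVn invfM invrK enorm_sq.
  by rewrite mulrA.
rewrite ge0_integralZl// ?lee_fin ?exprn_ge0 ?(ltW y0)//.
rewrite muleA -EFinM muleAC -EFinM exprS mulrA mulVf ?gt_eqF// mul1r divff ?mul1e//.
by rewrite expf_neq0// gt_eqF.
Qed.

Section backprojection_kernel.
Context (R : realType) (k : nat).
Let japanese (t : R) : R := Num.sqrt (1 + 4 * t).

Lemma japanese_gt0 (t : R) : 0 <= t -> 0 < japanese t.
Proof. by move=> t0; rewrite sqrtr_gt0 ltr_wpDr ?ltr01// mulr_ge0. Qed.

Lemma japanese_gauss (j : nat) (t : R) : 0 <= t ->
  (\int[leb R]_s (if (0 < s)%R then s ^+ j * (expR (- (s ^+ 2)) * expR (- ((2 * s) ^+ 2 * t))) else 0)%:E =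
   (gauss_moment R j / japanese t ^+ j.+1)%:E)%E.
Proof.
move=> t0; rewrite -gauss_moment_scale ?japanese_gt0//; apply: eq_integral => s _.
case: ifPn => // _; rewrite -expRD; congr (_ * expR _)%:E.
rewrite [in RHS]exprMn /japanese sqr_sqrtr; last by rewrite addr_ge0// mulr_ge0.
by ring.
Qed.

(** After [japanese_gauss], [ge0_integral_gauss_dotp] with width [2 * s] reduces the integral over w
    to a line and contributes s^-(k+1) s, which cancels the s^k of the weight. A zeroth moment
    remains, that is a multiple of (1 + 4 t^2)^(-1/2), and replacing t by t / (2 |v|) turns it into
    the kernel 1 / |(v, t)|. *)
Lemma ge0_integral_japanese (v : 'rV[R]_k.+1) (F : R -> \bar R) : v != 0 ->
  measurable_fun [set: R] F -> (forall t, 0 <= F t)%E ->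
  (\int[lebesgue_rV R k.+1]_w ((japanese (dotp w w) ^- k.+1)%:E * F (2 * dotp w v)%R) =
   ((gauss_moment R k)^-1 * (Num.sqrt pi / 2) ^+ k.+1 / 2)%:E *
   \int[leb R]_t (((Num.sqrt (dotp v v + t ^+ 2))^-1)%:E * F t))%E.
Proof.
move=> v0 mF F0; have p0 : (0 : R) < Num.sqrt pi by rewrite sqrtr_gt0 pi_gt0.
have G0 := gauss_moment_gt0 R k.
have e0 := enorm_gt0 v0.
pose h (s : R) (t : R) : R := if 0 < s then s ^+ k * (expR (- (s ^+ 2)) * expR (- ((2 * s) ^+ 2 * t))) else 0.
have h0 s t : 0 <= h s t.
  by rewrite /h; case: ifPn => // s0; rewrite !mulr_ge0 ?expR_ge0 ?exprn_ge0 ?(ltW s0).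
have mh d (T : measurableType d) (f g : T -> R) : measurable_fun [set: T] f ->
    measurable_fun [set: T] g -> measurable_fun [set: T] (fun x => h (f x) (g x)).
  by move=> mf mg; rewrite /h; meas.
transitivity (\int[lebesgue_rV R k.+1]_w ((gauss_moment R k)^-1%:E * \int[leb R]_s ((h s (dotp w w))%:E * F (2 * dotp w v)%R)))%E.
  apply: eq_integral => w _.
  have -> : ((japanese (dotp w w) ^- k.+1)%:E = (gauss_moment R k)^-1%:E * (gauss_moment R k / japanese (dotp w w) ^+ k.+1)%:E)%E.
    by rewrite -EFinM mulrA mulVf ?gt_eqF// mul1r.
  rewrite -japanese_gauss ?dotp_ge0// -muleA; congr (_ * _)%E.
  rewrite -ge0_integralZr//.
  - by apply/measurable_EFinP; apply: (mh _ _ (fun s => s) (fun=> dotp w w)); meas.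
  - by move=> s _; rewrite lee_fin (h0 s).
have mhF : measurable_fun [set: measurableTypeR R * 'rV[R]_k.+1]
    (fun p => (h p.1 (dotp p.2 p.2))%:E * F (2 * dotp p.2 v)%R)%E.
  apply: emeasurable_funM.
    by apply/measurable_EFinP; apply: (mh _ _ (fun p : measurableTypeR R * 'rV[R]_k.+1 => p.1) (fun p => dotp p.2 p.2)); meas.
  by meas.
have hF0 (s : R) (w : 'rV[R]_k.+1) : (0 <= (h s (dotp w w))%:E * F (2 * dotp w v)%R)%E by rewrite mule_ge0// lee_fin.
have Ginv0 : (0 <= (gauss_moment R k)^-1%:E)%E by rewrite lee_fin invr_ge0 ltW.
rewrite ge0_integralZl//; last 2 first.
- exact: (measurable_integral_l (leb R) (fun (s : R) (w : 'rV[R]_k.+1) => (h s (dotp w w))%:E * F (2 * dotp w v)%R)%E mhF hF0).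
- by move=> w _; exact: integral_ge0.
rewrite -(tonelli_swap (leb R) (lebesgue_rV R k.+1) (fun (s : R) (w : 'rV[R]_k.+1) => (h s (dotp w w))%:E * F (2 * dotp w v)%R)%E mhF hF0).
pose C : R := (Num.sqrt pi / 2) ^+ k.+1 * (2 / Num.sqrt pi).
have C0 : 0 <= C by rewrite mulr_ge0 ?exprn_ge0 ?divr_ge0 ?(ltW p0).
pose l (s t : R) : R := if 0 < s then expR (- (s ^+ 2)) * expR (- ((2 * s) ^+ 2 * (t ^+ 2))) else 0.
have l0 s t : 0 <= l s t.
  by rewrite /l; case: ifPn => // s0; rewrite mulr_ge0 ?expR_ge0.
have mlF : measurable_fun [set: measurableTypeR R * measurableTypeR R]
    (fun p => (l p.1 p.2)%:E * F (2 * (enorm v * p.2))%R)%E.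
  by rewrite /l; meas.
have lF0 (s t : R) : (0 <= (l s t)%:E * F (2 * (enorm v * t))%R)%E by rewrite mule_ge0// lee_fin.
transitivity ((gauss_moment R k)^-1%:E * \int[leb R]_s (C%:E * \int[leb R]_t ((l s t)%:E * F (2 * (enorm v * t))%R)))%E.
  congr (_ * _)%E; apply: eq_integral => s _.
  rewrite /h /l; case: (boolP (0 < s)) => s0; last first.
    by rewrite !integral0_eq ?mule0// => w _; rewrite mul0e.
  have s2 : 0 < 2 * s by rewrite mulr_gt0.
  transitivity (\int[lebesgue_rV R k.+1]_w ((s ^+ k * expR (- s ^+ 2))%:E *
      ((expR (- ((2 * s) ^+ 2 * dotp w w)))%:E * (F \o *%R 2) (dotp w v))))%E.
    by apply: eq_integral => w _; rewrite mulrA EFinM muleA.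
  have mF2 : measurable_fun [set: R] (F \o *%R 2).
    by apply: measurableT_comp => //; apply: measurable_funM => //; exact: measurable_cst.
  rewrite ge0_integralZl//; last 3 first.
  - by apply: emeasurable_funM; [meas|apply: (measurableT_comp mF2); meas].
  - by move=> w _; rewrite mule_ge0// ?lee_fin ?expR_ge0//=; exact: F0.
  - by rewrite lee_fin mulr_ge0 ?exprn_ge0 ?expR_ge0 ?(ltW s0).
  rewrite ge0_integral_gauss_dotp//; last by move=> t; exact: F0.
  transitivity ((s ^+ k * expR (- s ^+ 2))%:E * ((Num.sqrt pi / (2 * s)) ^+ k.+1 * (2 * s / Num.sqrt pi))%:E * \int[leb R]_t ((expR (- ((2 * s) ^+ 2 * t ^+ 2)))%:E * F (2 * (enorm v * t))%R))%E.
    by rewrite muleA.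
  rewrite -EFinM (_ : s ^+ k * _ * _ = C * expR (- s ^+ 2)); last first.
    have -> : Num.sqrt pi / (2 * s) = Num.sqrt pi / 2 * s^-1 by field; rewrite gt_eqF.
    rewrite /C exprMn exprVn (exprS s k); set A := _ ^+ k.+1.
    by field; rewrite ?expf_neq0 ?gt_eqF.
  rewrite EFinM -muleA; congr (_ * _)%E.
  rewrite -ge0_integralZl//; last 2 first.
  - by meas.
  - by move=> w _; rewrite mule_ge0// lee_fin expR_ge0.
  - by apply: eq_integral => t _; rewrite muleA EFinM.
rewrite ge0_integralZl//; last 2 first.
- exact: (measurable_integral_r (leb R) (fun s t => (l s t)%:E * F (2 * (enorm v * t))%R)%E mlF lF0).
- by move=> s _; exact: integral_ge0.
rewrite (tonelli_swap (leb R) (leb R) (fun s t => (l s t)%:E * F (2 * (enorm v * t))%R)%E mlF lF0).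
transitivity ((gauss_moment R k)^-1%:E * (C%:E * \int[leb R]_t ((gauss_moment R 0 / japanese (t ^+ 2))%:E * F (2 * (enorm v * t))%R)))%E.
  congr (_ * (_ * _))%E; apply: eq_integral => t _.
  rewrite ge0_integralZr//; last 2 first.
  - by rewrite /l; meas.
  - by move=> s _; rewrite lee_fin.
  congr (_ * _)%E; rewrite -[X in _ / X]expr1 -japanese_gauss ?sqr_ge0//.
  by apply: eq_integral => s _; rewrite /l; case: ifPn => // _; rewrite expr0 mul1r.
rewrite [in RHS](ge0_integral_affine (c := 2 * enorm v) 0); last 3 first.
- by rewrite gt_eqF// mulr_gt0.
- by meas.
- by move=> t; rewrite mule_ge0// lee_fin invr_ge0 sqrtr_ge0.
rewrite gtr0_norm ?mulr_gt0//.
have mj : measurable_fun [set: measurableTypeR R] (fun t => (gauss_moment R 0 / japanese (t ^+ 2))%:E * F (2 * (enorm v * t))%R)%E.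
  by rewrite /japanese; meas.
have -> : (\int[leb R]_x (((Num.sqrt (dotp v v + (2 * enorm v * x + 0) ^+ 2))^-1)%:E *
             F (2 * enorm v * x + 0)%R) = ((enorm v * gauss_moment R 0)^-1)%:E * \int[leb R]_t ((gauss_moment R 0 / japanese (t ^+ 2))%:E * F (2 * (enorm v * t))%R))%E.
  rewrite -ge0_integralZl//; last 2 first.
  - by move=> t _; rewrite mule_ge0// lee_fin divr_ge0 ?(ltW (gauss_moment_gt0 _ _)) ?sqrtr_ge0.
  - by rewrite lee_fin invr_ge0 mulr_ge0 ?(ltW e0) ?(ltW (gauss_moment_gt0 _ _)).
  apply: eq_integral => t _; rewrite addr0 mulrA muleA -EFinM; congr (_%:E * _)%E.
  rewrite -enorm_sq (_ : _ + _ = enorm v ^+ 2 * (1 + 4 * t ^+ 2)); last by ring.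
  rewrite sqrtrM ?sqr_ge0// sqrtr_sqr gtr0_norm// /japanese.
  field; rewrite !gt_eqF ?(gauss_moment_gt0 _ _)//.
  by rewrite sqrtr_gt0 ltr_wpDr ?ltr01// mulr_ge0 ?sqr_ge0.
rewrite !muleA -!EFinM; congr (_%:E * _)%E.
rewrite gauss_moment0 /C.
by field; rewrite !gt_eqF.
Qed.

(** For fixed v, [ge0_integral_japanese] integrates over the slopes w; the result is the integral of
    F against |y|^-1 in dimension k + 2. This is [ge0_integral_riesz] with p = 0, hence the weight
    s^(k+2) / s^2. The point v = 0 is discarded as a null set. *)
Lemma ge0_integral_backprojection (F : 'rV[R]_k.+2 -> \bar R) :
  measurable_fun [set: 'rV[R]_k.+2] F -> (forall t, 0 <= F t)%E ->
  (\int[lebesgue_rV R k.+1]_w \int[lebesgue_rV R k.+1]_v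
      ((japanese (dotp w w) ^- k.+1)%:E * F (rVpair v (2 * dotp w v))) =
   (pi ^+ k.+1 / gauss_moment R k)%:E *
   \int[leb R]_s \int[lebesgue_rV R k.+2]_z
     (((if (0 < s)%R then s ^+ k.+2 / s ^+ 2 else 0) * gauss_kernel z)%:E * F ((2 * s) *: z)%R))%E.
Proof.
move=> mF F0; have p0 : (0 : R) < Num.sqrt pi by rewrite sqrtr_gt0 pi_gt0.
have G0 := gauss_moment_gt0 R k.
have j0 w : 0 <= japanese (dotp w w) ^- k.+1.
  by rewrite invr_ge0 exprn_ge0// sqrtr_ge0.
have mjF : measurable_fun [set: 'rV[R]_k.+1 * 'rV[R]_k.+1]
   (fun p => (japanese (dotp p.1 p.1) ^- k.+1)%:E * F (rVpair p.2 (2 * dotp p.1 p.2)))%E.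
  by rewrite /japanese; meas.
have jF0 w v : (0 <= (japanese (dotp w w) ^- k.+1)%:E * F (rVpair v (2 * dotp w v)))%E.
  by rewrite mule_ge0// lee_fin.
rewrite (tonelli_swap (lebesgue_rV R k.+1) (lebesgue_rV R k.+1) (fun w v => (japanese (dotp w w) ^- k.+1)%:E * F (rVpair v (2 * dotp w v)))%E mjF jF0).
rewrite (@ge0_integral_riesz R k.+1 0 F)//.
pose C : R := (gauss_moment R k)^-1 * (Num.sqrt pi / 2) ^+ k.+1 / 2.
have C0 : 0 <= C by rewrite divr_ge0// mulr_ge0 ?invr_ge0 ?(ltW G0)// exprn_ge0// divr_ge0// ltW.
have meF : measurable_fun [set: 'rV[R]_k.+2] (fun y => (enorm y ^- 1)%:E * F y)%E by meas.
have eF0 y : (0 <= (enorm y ^- 1)%:E * F y)%E.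
  by rewrite mule_ge0// lee_fin invr_ge0 exprn_ge0// enorm_ge0.
have meFp : measurable_fun [set: 'rV[R]_k.+1 * measurableTypeR R] (fun p => ((enorm (rVpair p.1 p.2)) ^- 1)%:E * F (rVpair p.1 p.2))%E.
  exact: (measurableT_comp meF (@measurable_rVpair R k.+1)).
rewrite [in RHS]ge0_integral_rVS//.
rewrite (_ : _ * _ = (pi ^+ k.+1 / gauss_moment R k * (2 ^- k.+2 * Num.sqrt pi ^- k.+2 * (2 ^+ 1 * gauss_moment R 0)))%:E *
 \int[lebesgue_rV R k.+1]_x \int[leb R]_t ((enorm (rVpair x t) ^- 1)%:E * F (rVpair x t)))%E; last first.
  by rewrite muleA -EFinM.
rewrite (_ : pi ^+ k.+1 / gauss_moment R k * _ = C); last first.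
  rewrite /C gauss_moment0 -{1}(sqr_sqrtr (@pi_ge0 R)) -exprM mulnC expr_div_n exprM (exprSr (Num.sqrt pi) k.+1).
  rewrite (exprSr 2 k.+1).
  by field; rewrite ?expf_neq0 ?gt_eqF.
have mI : measurable_fun [set: 'rV[R]_k.+1] (fun x => \int[leb R]_t ((enorm (rVpair x t) ^- 1)%:E * F (rVpair x t)))%E.
  exact: (measurable_integral_r (leb R) (fun (x : 'rV[R]_k.+1) (t : R) => (enorm (rVpair x t) ^- 1)%:E * F (rVpair x t))%E meFp (fun _ _ => eF0 _)).
rewrite -ge0_integralZl//; last by move=> x _; exact: integral_ge0.
apply: eq_integral_rV_neq0.
- exact: (measurable_integral_l (lebesgue_rV R k.+1) (fun w v => (japanese (dotp w w) ^- k.+1)%:E * F (rVpair v (2 * dotp w v)))%E mjF jF0).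
- by meas.
- by move=> x; exact: integral_ge0.
- by move=> x; rewrite mule_ge0// ?lee_fin//; exact: integral_ge0.
move=> v v0.
have mFv : measurable_fun [set: R] (fun t => F (rVpair v t)).
  by apply: (measurableT_comp mF); exact: measurable_rVpair_r.
have Fv0 t : (0 <= F (rVpair v t))%E by exact: F0.
rewrite (ge0_integral_japanese v0 mFv Fv0).
rewrite -/C; congr (_ * _)%E; apply: eq_integral => t _.
by rewrite expr1 /enorm dotp_rVpair -expr2.
Qed.
End backprojection_kernel.

(** * Smoothness of the unfolded function *)

Lemma norm_coord_le (R : realType) n (h : 'rV[R]_n) i : `|h 0 i| <= `|h|.
Proof.
rewrite [in leRHS]/Num.norm/= mx_normrE.
exact: (le_bigmax 0 (fun ij => `|h ij.1 ij.2|) (ord0, i)).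
Qed.

Lemma norm_rV_le (R : realType) n (h : 'rV[R]_n) (c : R) : 0 <= c -> (forall i, `|h 0 i| <= c) -> `|h| <= c.
Proof.
move=> c0 H; rewrite [X in X <= _]mx_normrE; apply: bigmax_le => // -[a j] _ /=.
by rewrite (ord1 a).
Qed.

Lemma continuous_rV (R : realType) n (T : topologicalType) (c : T -> 'rV[R]_n) (t : T) :
  (forall i, {for t, continuous (fun s => c s 0 i)}) -> {for t, continuous c}.
Proof.
move=> H; apply/cvgrPdist_lt => eps eps0.
have : \forall s \near t, forall i : 'I_n, `|c s 0 i - c t 0 i| <= eps / 2.
  apply: (@filter_forall _ _ (fun i s => `|c s 0 i - c t 0 i| <= eps / 2) (nbhs t) _) => i.
  by move/cvgrPdist_le : (H i) => /(_ (eps / 2) ltac:(by rewrite divr_gt0)); apply: filterS => s; rewrite distrC.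
apply: filterS => s Hs; rewrite distrC; apply: le_lt_trans (_ : eps / 2 < _); last by lra.
apply: norm_rV_le; first by rewrite ltW// divr_gt0.
by move=> i; rewrite !mxE.
Qed.

Lemma derive_line_quotient (R : realType) n (f : 'rV[R]_n -> R) (x v : 'rV[R]_n) (s : R) :
  (fun h : R => h^-1 *: (((fun t : R => f (x + t *: v)) \o shift s) (h *: 1) - f (x + s *: v))) =
  (fun h : R => h^-1 *: ((f \o shift (x + s *: v)) (h *: v) - f (x + s *: v))).
Proof.
apply/funext => h /=; congr (_ *: (f _ - _)).
by rewrite [h *: 1]mulr1 scalerDl addrCA.
Qed.

Lemma is_derive_line (R : realType) n (f : 'rV[R]_n -> R) (x v : 'rV[R]_n) (s : R) :
  derivable f (x + s *: v) v ->
  is_derive s 1 (fun t : R => f (x + t *: v)) ('D_v f (x + s *: v)).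
Proof.
move=> d; have Q := derive_line_quotient f x v s.
by split; [rewrite /derivable Q|rewrite /derive Q].
Qed.

Lemma is_derive_line0 (R : realType) n (f : 'rV[R]_n -> R) (x v : 'rV[R]_n) (l : R) :
  is_derive (0 : R) 1 (fun t : R => f (x + t *: v)) l -> is_derive x v f l.
Proof.
move=> [d dE]; have Q := derive_line_quotient f x v 0.
rewrite scale0r addr0 in Q.
by split; [move: d; rewrite /derivable scale0r addr0 Q|move: dE; rewrite /derive scale0r addr0 Q].
Qed.

Lemma MVT_line (R : realType) n (f : 'rV[R]_n -> R) (x v : 'rV[R]_n) (c : R) :
  (forall s : R, `|s| <= `|c| -> derivable f (x + s *: v) v) ->
  exists2 s : R, `|s| <= `|c| & f (x + c *: v) - f x = c * 'D_v f (x + s *: v).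
Proof.
move=> d; pose u t := f (x + t *: v); pose du t := 'D_v f (x + t *: v).
have du_ s : `|s| <= `|c| -> is_derive (s : R) 1 u (du s) by move=> /d; exact: is_derive_line.
have u0 : u 0 = f x by rewrite /u scale0r addr0.
have main a b : a <= b -> (forall s, a <= s <= b -> `|s| <= `|c|) ->
    exists2 s, s \in `[a, b] & u b - u a = du s * (b - a).
  move=> ab H; apply: MVT_segment => //.
    by move=> s; rewrite in_itv => /andP[/ltW as_ /ltW sb]; apply: du_; apply: H; rewrite as_.
  apply: derivable_within_continuous => s; rewrite in_itv => /H/du_ []; done.
have [c0|c0] := leP 0 c.
  have [s] := main 0 c c0 (fun s => ltac:(by move=> /andP[s0 sc]; rewrite !ger0_norm)).
  rewrite in_itv /= => /andP[s0 sc] E; exists s; first by rewrite !ger0_norm.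
  by rewrite -/(u c) -u0 E subr0 mulrC.
have [s] := main c 0 (ltW c0) (fun s => ltac:(by move=> /andP[cs s0]; rewrite !ler0_norm ?lerN2 ?(ltW c0))).
rewrite in_itv /= => /andP[cs s0] E; exists s; first by rewrite !ler0_norm ?lerN2 ?(ltW c0).
by rewrite -/(u c) -u0 -opprB E sub0r mulrN opprK mulrC.
Qed.

(* Moving one coordinate at a time reduces to the one-dimensional mean value theorem. *)
Lemma MVT_coordinates (R : realType) n (f : 'rV[R]_n -> R) (x h : 'rV[R]_n) :
  (forall y i, `|y - x| <= `|h| -> derivable f y (delta_mx 0 i)) ->
  exists xi : 'I_n -> 'rV[R]_n, (forall i, `|xi i - x| <= `|h|) /\
    f (x + h) - f x = \sum_i h 0 i * partial i f (xi i).
Proof.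
move=> d.
pose p (k : nat) : 'rV[R]_n := x + \row_i (if (i < k)%N then h 0 i else 0).
have pS (i : 'I_n) : p i.+1 = p i + h 0 i *: delta_mx 0 i.
  apply/rowP => j; rewrite !mxE eqxx/= ltnS leq_eqVlt.
  have [->|ji] := eqVneq j i; first by rewrite eqxx ltnn/= mulr1 addr0.
  by rewrite -val_eqE /= in ji; rewrite (negPf ji) /= mulr0 addr0.
have bnd (i : 'I_n) (s : R) : `|s| <= `|h 0 i| -> `|p i + s *: delta_mx 0 i - x| <= `|h|.
  move=> si; rewrite (_ : _ - x = \row_j (if (j < i)%N then h 0 j else if j == i then s else 0)).
    apply: norm_rV_le => // j; rewrite mxE; case: ifP => _; first exact: norm_coord_le.
    case: ifP => _; last by rewrite normr0.
    exact: le_trans si (norm_coord_le _ _).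
  apply/rowP => j; rewrite !mxE eqxx/=; have [->|_] := eqVneq j i.
    by rewrite ltnn mulr1; ring.
  by rewrite mulr0 addr0 addrC addrA addNr add0r.
have step (i : 'I_n) : exists y, `|y - x| <= `|h| /\ f (p i.+1) - f (p i) = h 0 i * partial i f y.
  have [s s1 s2] := @MVT_line R n f (p i) (delta_mx 0 i) (h 0 i) (fun s hs => d _ _ (bnd _ _ hs)).
  by exists (p i + s *: delta_mx 0 i); split; [exact: bnd|rewrite pS].
have [xi xiP] := choice step; exists xi; split => [i|]; first exact: (xiP i).1.
have -> : x + h = p n by congr (_ + _); apply/rowP => i; rewrite !mxE ltn_ord.
have {1}-> : x = p 0%N by rewrite -[LHS]addr0; congr (_ + _); apply/rowP => i; rewrite !mxE.
rewrite -(telescope_sumr (fun k => f (p k)))// big_mkord; apply: eq_bigr => i _.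
exact: (xiP i).2.
Qed.

(** Smoothness is expressed through coordinate derivatives, so the chain rule is obtained from
    [MVT_coordinates]: the difference quotient is a sum of coordinate quotients times partial
    derivatives at intermediate points, which tend to [c t]. *)
Lemma is_derive_curve (R : realType) n (f : 'rV[R]_n -> R) (c : R -> 'rV[R]_n) (t : R) (dc : 'rV[R]_n) :
  (\forall y \near c t, forall i, derivable f y (delta_mx 0 i)) ->
  (forall i, {for c t, continuous (partial i f)}) ->
  (forall i, is_derive t 1 (fun s => c s 0 i) (dc 0 i)) ->
  is_derive t 1 (fun s => f (c s)) (\sum_i dc 0 i * partial i f (c t)).
Proof.
move=> /nbhs_normP[e /= e0 de] cf dcP.
have cc : {for t, continuous c}.
  apply: continuous_rV => i; apply: differentiable_continuous; apply/derivable1_diffP.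
  by case: (dcP i).
have : \forall h \near (0 : R)^', exists xi : 'I_n -> 'rV[R]_n, (forall i, `|xi i - c t| <= `|c (t + h) - c t|) /\
    f (c (t + h)) - f (c t) = \sum_i (c (t + h) - c t) 0 i * partial i f (xi i).
  have : \forall h \near (0 : R), `|c (t + h) - c t| < e.
    have : {for 0, continuous (fun h : R => c (t + h))}.
      apply: continuous_comp; last by rewrite /= addr0.
      by apply: cvgD; [exact: cvg_cst|exact: cvg_id].
    by move/cvgrPdist_lt => /(_ e e0); apply: filterS => h; rewrite addr0 distrC.
  move=> H; apply: cvg_within; move: H; apply: filterS => h he.
  have [|xi [xi1 xi2]] := @MVT_coordinates R n f (c t) (c (t + h) - c t).
    by move=> y i yb; apply: de; rewrite /ball_/= distrC (le_lt_trans yb).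
  by exists xi; split => //; rewrite -xi2 [c t + _]addrC subrK.
move=> /= nx.
pose A h := [set xi : 'I_n -> 'rV[R]_n | (forall i, `|xi i - c t| <= `|c (t + h) - c t|) /\
    f (c (t + h)) - f (c t) = \sum_i (c (t + h) - c t) 0 i * partial i f (xi i)].
(* A choice of intermediate points for each [h]; the default [c t] is taken only when none exist,
   which does not happen near 0. *)
pose X h := xget (fun=> c t) (A h).
have nX : \forall h \near (0 : R)^', (forall i, `|X h i - c t| <= `|c (t + h) - c t|) /\
    f (c (t + h)) - f (c t) = \sum_i (c (t + h) - c t) 0 i * partial i f (X h i).
  apply: filterS nx => h nx; exact: (@xgetPex _ (fun=> c t) (A h) nx).
have cX i : X h i @[h --> (0 : R)^'] --> c t.
  apply/cvgrPdist_lt => eps eps0.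
  have : \forall h \near (0 : R)^', `|c (t + h) - c t| < eps.
    apply: cvg_within.
    have : {for 0, continuous (fun h : R => c (t + h))}.
      apply: continuous_comp; last by rewrite /= addr0.
      by apply: cvgD; [exact: cvg_cst|exact: cvg_id].
    by move/cvgrPdist_lt => /(_ eps eps0); apply: filterS => h; rewrite addr0 distrC.
  apply: filterS2 nX => h [H _] H2; rewrite distrC; exact: le_lt_trans (H i) H2.
have dq i : h^-1 * (c (t + h) - c t) 0 i @[h --> (0 : R)^'] --> dc 0 i.
  have [dd <-] := dcP i; move: dd; rewrite /derive /derivable => dd.
  apply: cvg_trans dd; apply: near_eq_cvg; near=> h.
  by rewrite !mxE /= [h%:A]mulr1 (addrC h t).
have : h^-1 *: (((fun s => f (c s)) \o shift t) (h *: 1) - f (c t)) @[h --> (0 : R)^'] -->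
    \sum_i dc 0 i * partial i f (c t).
  apply: (@cvg_trans _ ((fun h : R => \sum_i (h^-1 * (c (t + h) - c t) 0 i) * partial i f (X h i)) @ (0 : R)^')).
    apply: near_eq_cvg; apply: filterS nX => h [_ /= E].
    rewrite [h%:A]mulr1 (addrC h t) E scaler_sumr; apply: eq_bigr => i _.
    by rewrite -mulrA.
  apply: cvg_big => [|i _]; first exact: add_continuous.
  apply: cvgM; first exact: dq.
  by apply: continuous_cvg; [exact: cf|exact: cX].
move=> H; split; first by apply/cvg_ex; eexists; exact: H.
by apply: cvg_lim.
Unshelve. all: by end_near.
Qed.
Lemma iter_partial_rcons (R : realType) n (s : seq 'I_n) i (f : 'rV[R]_n -> R) :
  iter_partial (rcons s i) f = iter_partial s (partial i f).
Proof. by rewrite /iter_partial foldr_rcons. Qed.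

(** * Closure of smooth functions under algebraic operations *)

Section smooth_on.
Context (R : realType) (n : nat) (U : set 'rV[R]_n).
Hypothesis oU : open U.
Implicit Types f g : 'rV[R]_n -> R.

(** Smoothness of finite order, by recursion on the order: the product and inverse rules mix
    derivatives of different orders and are proved by induction on [k]. [smooth_on], indexed by
    lists of directions, is recovered from all [k]. *)
Fixpoint Ck k f : Prop :=
  (forall x, U x -> {for x, continuous f}) /\
  if k is k'.+1 then
    forall i, (forall x, U x -> derivable f x (delta_mx 0 i)) /\ Ck k' (partial i f)
  else True.

Lemma Ck_continuous k f x : Ck k f -> U x -> {for x, continuous f}.
Proof. by case: k => [|k] [+ _]; apply. Qed.

Lemma smooth_on_partial f i : smooth_on U f -> smooth_on U (partial i f).
Proof. by move=> sf s x Ux; rewrite -iter_partial_rcons; exact: sf. Qed.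

Lemma smooth_onP f : smooth_on U f <-> forall k, Ck k f.
Proof.
split=> [+ k|].
  elim: k f => [|k IH] f sf /=; first by split=> // x Ux; exact: (sf [::] x Ux).1.
  split=> [x Ux|i]; first exact: (sf [::] x Ux).1.
  by split=> [x Ux|]; [exact: (sf [::] x Ux).2|apply: IH; exact: smooth_on_partial].
move=> H s; elim/last_ind: s f H => [|s i IH] f H x Ux.
  by split; [exact: Ck_continuous (H 0%N) Ux|move=> i; exact: (((H 1%N).2 i).1 x Ux)].
by rewrite iter_partial_rcons; apply: IH => // k; exact: ((H k.+1).2 i).2.
Qed.

Lemma Ck_ext k f g : (forall x, U x -> f x = g x) -> Ck k f -> Ck k g.
Proof.
have ext f' g' x : (forall x, U x -> f' x = g' x) -> U x -> {near x, f' =1 g'}.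
  by move=> fg Ux; apply: filterS fg _; exact: open_nbhs_nbhs.
elim: k f g => [|k IH] f g fg [cf df]; split => //.
- move=> x Ux; rewrite /prop_for /continuous_at -(fg x Ux); apply: cvg_trans (cf x Ux).
  exact: (near_eq_cvg (ext f g x fg Ux)).
- move=> x Ux; rewrite /prop_for /continuous_at -(fg x Ux); apply: cvg_trans (cf x Ux).
  exact: (near_eq_cvg (ext f g x fg Ux)).
- move=> i; split=> [x Ux|].
    by apply: near_eq_derivable (ext _ _ _ fg Ux) _; exact: (df i).1.
  apply: IH (df i).2 => x Ux; rewrite /partial.
  by apply: near_eq_derive; exact: ext.
Qed.

Lemma CkW k f : Ck k.+1 f -> Ck k f.
Proof.
elim: k f => [|k IH] f /= [cf df]; split => // i; split; first exact: (df i).1.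
exact: IH (df i).2.
Qed.

Lemma CkD k f g : Ck k f -> Ck k g -> Ck k (fun x => f x + g x).
Proof.
elim: k f g => [|k IH] f g [cf df] [cg dg].
  by split=> // x Ux; apply: (@continuousD _ _ _ f g); [exact: cf|exact: cg].
split=> [x Ux|i]; first by apply: (@continuousD _ _ _ f g); [exact: cf|exact: cg].
split=> [x Ux|]; first by apply: derivableD; [exact: (df i).1|exact: (dg i).1].
apply: Ck_ext (IH _ _ (df i).2 (dg i).2) => x Ux.
by rewrite /partial deriveD//; [exact: (df i).1|exact: (dg i).1].
Qed.

Lemma CkM k f g : Ck k f -> Ck k g -> Ck k (fun x => f x * g x).
Proof.
elim: k f g => [|k IH] f g Cf Cg; have [cf df] := Cf; have [cg dg] := Cg.
  by split=> // x Ux; apply: (@continuousM _ _ f g); [exact: cf|exact: cg].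
split=> [x Ux|i]; first by apply: (@continuousM _ _ f g); [exact: cf|exact: cg].
split=> [x Ux|]; first by apply: derivableM; [exact: (df i).1|exact: (dg i).1].
apply: (@Ck_ext _ (fun x => f x * partial i g x + partial i f x * g x)).
  move=> x Ux; rewrite /partial deriveM//; [|exact: (df i).1|exact: (dg i).1].
  by congr (_ + _); rewrite [RHS]mulrC.
by apply: CkD; apply: IH; [exact: CkW|exact: (dg i).2|exact: (df i).2|exact: CkW].
Qed.

Lemma Ck_cst k (c : R) : Ck k (fun=> c).
Proof.
elim: k c => [|k IH] c; first by split=> // x _; exact: cst_continuous.
split=> [x _|i]; first exact: cst_continuous.
split=> [x _|]; first exact: derivable_cst.
by apply: Ck_ext (IH 0) => x _; rewrite /partial derive_cst.
Qed.

Lemma is_derive_coord (x : 'rV[R]_n) i j :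
  is_derive x (delta_mx 0 i) (fun y : 'rV[R]_n => y 0 j) ((j == i)%:R).
Proof.
have : is_derive (0:R) 1 (fun t : R => x 0 j + t * (j == i)%:R) ((j == i)%:R).
  rewrite -[X in is_derive _ _ _ X]mul1r -[X in is_derive _ _ _ X]add0r.
  apply: is_deriveD; rewrite -[X in is_derive _ _ _ X]addr0.
  by apply: is_derive_eq; rewrite /= scaler0 add0r [RHS]addr0 [LHS]mulrC.
move=> d; apply: is_derive_line0.
by rewrite (_ : (fun t : R => _) = (fun t : R => x 0 j + t * (j == i)%:R))//; apply/funext => t; rewrite !mxE eqxx.
Qed.

Lemma Ck_coord k j : Ck k (fun x => x 0 j).
Proof.
case: k => [|k]; first by split=> // x _; exact: coord_continuous.
split=> [x _|i]; first exact: coord_continuous.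
split=> [x _|]; first by case: (is_derive_coord x i j).
apply: Ck_ext (Ck_cst k ((j == i)%:R)) => x _.
by rewrite /partial; case: (is_derive_coord x i j).
Qed.

(** The derivative of 1/f contains 1/f again, but at one order less, where the induction hypothesis
    applies. *)
Lemma Ck_inv k f : (forall x, U x -> f x != 0) -> Ck k f -> Ck k (fun x => (f x)^-1).
Proof.
move=> f0; elim: k => [|k IH] Cf; have [cf df] := Cf.
  by split=> // x Ux; apply: (@continuousV _ _ f); [exact: f0|exact: cf].
split=> [x Ux|i]; first by apply: (@continuousV _ _ f); [exact: f0|exact: cf].
split=> [x Ux|]; first by apply: derivableV; [exact: f0|exact: (df i).1].
have Cv := IH (CkW Cf).
apply: Ck_ext (CkM (CkM (CkM (Ck_cst k (-1)) Cv) Cv) (df i).2) => x Ux.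
rewrite /partial deriveV//; [|exact: f0|exact: (df i).1].
by rewrite mulN1r mulNr -invfM -expr2.
Qed.
End smooth_on.

Lemma continuous_sum (R : realType) (T : topologicalType) n (F : 'I_n -> T -> R) (x : T) :
  (forall i, {for x, continuous (F i)}) -> {for x, continuous (fun y => \sum_i F i y)}.
Proof. by move=> H; apply: cvg_big => [|i _]; [exact: add_continuous|exact: H]. Qed.

Lemma is_derive_affine (R : realType) (a c t : R) : is_derive t 1 (fun t : R => a + t * c) c.
Proof. by apply: is_derive_eq; rewrite scaler0 !add0r mul1r [LHS]mulr1. Qed.

Section paraboloid.
Context (R : realType) (m : nat).
Implicit Types (x y : 'rV[R]_m.+1) (theta : 'rV[R]_m.+1 -> R).
Let U := upper_half_space R m.

(* The change of variables [x = (y', y_n^2 + |y'|^2)]. *)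
Definition height2 x : R := rVlast x - dotp (rVhead x) (rVhead x).
Definition unfold_paraboloid x : 'rV[R]_m.+1 := rVpair (rVhead x) (Num.sqrt (height2 x)).
(** Extended by 0 to the points below the paraboloid, which are not images of the half-space, so as
    to be a function on the whole space. *)
Definition paraboloid_pullback theta x : R :=
  if 0 < height2 x then theta (unfold_paraboloid x) else 0.

(** The derivative in x_i expressed on the side of y. From y_n = sqrt (x_n - |x'|^2), the derivative
    of y_n is -x_i / y_n in a horizontal direction and 1 / (2 y_n) in the last one. *)
Definition paraboloid_partial (i : 'I_m.+1) theta : 'rV[R]_m.+1 -> R :=
  if unlift ord_max i is Some j
  then fun y => partial i theta y + -1 * (y 0 i * (y 0 ord_max)^-1 * partial ord_max theta y)
  else fun y => 2^-1 * (y 0 ord_max)^-1 * partial ord_max theta y.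

(** Compact support in the half-space in quantitative form, stable under [paraboloid_partial] with
    the same bounds. For positive [d] it keeps the support away from y_n = 0, where the square root
    is singular. *)
Definition tame (d M : R) theta :=
  smooth_on U theta /\ forall y, U y -> theta y != 0 -> d <= rVlast y /\ `|y| <= M.

Lemma open_upper_half_space : open U.
Proof.
rewrite (_ : U = (fun x : 'rV[R]_m.+1 => x 0 ord_max) @^-1` [set t | 0 < t])//.
apply: open_comp; last exact: open_gt.
by move=> x _; exact: coord_continuous.
Qed.

Lemma continuous_height2 : continuous height2.
Proof.
move=> x; apply: (@continuousB _ _ _ (fun x => rVlast x) (fun x => dotp (rVhead x) (rVhead x))).
  exact: coord_continuous.
have cj j : {for x, continuous (fun y : 'rV[R]_m.+1 => rVhead y 0 j)}.
  rewrite (_ : (fun _ => _) = (fun y : 'rV[R]_m.+1 => y 0 (lift ord_max j))); first exact: coord_continuous.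
  by apply/funext => y; rewrite mxE.
by apply: continuous_sum => i; exact: (@continuousM _ _ (fun y : 'rV[R]_m.+1 => rVhead y 0 i) (fun y : 'rV[R]_m.+1 => rVhead y 0 i) x (cj i) (cj i)).
Qed.

Lemma near_height2_gt0 x : 0 < height2 x -> \forall y \near x, 0 < height2 y.
Proof. by move=> x0; apply: (cvgr_gt _ (@continuous_height2 x)). Qed.

Lemma continuous_unfold_paraboloid : continuous unfold_paraboloid.
Proof.
move=> x; apply: continuous_rV => i; rewrite /unfold_paraboloid.
case: (unliftP ord_max i) => [j ->|->].
  rewrite (_ : (fun _ => _) = (fun y : 'rV[R]_m.+1 => y 0 (lift ord_max j))); first exact: coord_continuous.
  by apply/funext => y; rewrite mxE liftK mxE.
rewrite (_ : (fun _ => _) = (fun y => Num.sqrt (height2 y))); last first.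
  by apply/funext => y; rewrite mxE unlift_none.
apply: continuous_comp; first exact: continuous_height2.
exact: sqrt_continuous.
Qed.

(** Points close to [x] either lie below the paraboloid or lift to a height less than [d], where
    [theta] vanishes. This is why the extension by 0 is smooth across the paraboloid. *)
Lemma paraboloid_pullback_near0 d M theta x : 0 < d -> tame d M theta -> height2 x <= 0 ->
  \forall y \near x, paraboloid_pullback theta y = 0.
Proof.
move=> d0 [_ H] x0.
have : \forall y \near x, height2 y < d ^+ 2.
  by apply: (cvgr_lt _ (@continuous_height2 x)); rewrite (le_lt_trans x0)// exprn_gt0.
apply: filterS => y yd; rewrite /paraboloid_pullback; case: ifPn => // y0.
apply/eqP/negPn/negP => /(H (unfold_paraboloid y)) [|+ _].
  by rewrite /U/upper_half_space/= rVpair_last sqrtr_gt0.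
rewrite rVpair_last leNgt => /negP; apply.
by rewrite -(@ltr_pXn2r _ 2) ?nnegrE ?sqrtr_ge0 ?(ltW d0)// sqr_sqrtr// ltW.
Qed.

Lemma unfold_paraboloid_upper x : 0 < height2 x -> U (unfold_paraboloid x).
Proof. by move=> x0; rewrite /U/upper_half_space/= rVpair_last sqrtr_gt0. Qed.

Lemma is_derive_unfold_paraboloid x (i k : 'I_m.+1) : 0 < height2 x ->
  is_derive (0 : R) 1 (fun t : R => unfold_paraboloid (x + t *: delta_mx 0 i) 0 k)
   ((if unlift ord_max k is Some _ then (k == i)%:R else
     (if unlift ord_max i is Some _ then - x 0 i else 2^-1) / Num.sqrt (height2 x))).
Proof.
move=> x0; rewrite /unfold_paraboloid; case: (unliftP ord_max k) => [j ->|->].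
  rewrite [X in is_derive _ _ X _](_ : _ = (fun t : R => x 0 (lift ord_max j) + t * (lift ord_max j == i)%:R)).
    exact: is_derive_affine.
  by apply/funext => t; rewrite mxE liftK !mxE eqxx.
rewrite [X in is_derive _ _ X _](_ : _ = (fun t : R => Num.sqrt (height2 x + (if unlift ord_max i is Some _ then - (2 * x 0 i * t + t ^+ 2) else t)))); last first.
  apply/funext => t; rewrite mxE unlift_none /height2 /rVlast !mxE eqxx/=; congr Num.sqrt.
  case: (unliftP ord_max i) => [j ij|->]; last first.
    rewrite eqxx mulr1 addrAC (_ : rVhead _ = rVhead x)//; apply/rowP => l.
    by rewrite !mxE [lift _ _ == _]eq_sym (negPf (neq_lift _ _)) andbF mulr0 addr0.
  rewrite ij (negPf (neq_lift _ _)) mulr0 addr0 -addrA; congr (_ + _).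
  rewrite /dotp (bigD1 j)//= [in RHS](bigD1 j)//= !mxE !eqxx/=.
  rewrite [X in _ + X](eq_bigr (fun l => rVhead x 0 l * rVhead x 0 l)); last first.
    move=> l lj; rewrite !mxE eqxx/=.
    by rewrite (inj_eq (@lift_inj _ _)) (negPf lj) mulr0 addr0.
  by ring.
pose g (t : R) := height2 x + (if unlift ord_max i is Some _ then - (2 * x 0 i * t + t ^+ 2) else t).
have g0 : is_derive (0 : R) 1 g (if unlift ord_max i is Some _ then - (2 * x 0 i) else 1).
  rewrite /g; case: (unlift _ _) => [j|]; apply: is_derive_eq.
    by have A (a : R) : a *: (1 : R) = a by [exact: mulr1]; rewrite !A; ring.
  by rewrite add0r mul1r.
have gx : g 0 = height2 x.
  by rewrite /g; case: unlift => [?|]; rewrite ?mulr0 ?expr0n/= ?addr0 ?oppr0 ?addr0.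
have h0 : is_derive (g 0) 1 (@Num.sqrt R) (2 * Num.sqrt (height2 x))^-1.
  by rewrite gx; exact: is_derive1_sqrt.
have := is_derive1_comp h0 g0; rewrite /comp => H; apply: is_derive_eq H _.
case: unlift => [?|]; field; rewrite ?gt_eqF ?sqrtr_gt0//.
Qed.

Lemma paraboloid_partialE theta x i :
  paraboloid_partial i theta (unfold_paraboloid x) =
  \sum_k (\row_k if unlift ord_max k is Some _ then (k == i)%:R else
     (if unlift ord_max i is Some _ then - x 0 i else 2^-1) / Num.sqrt (height2 x)) 0 k * partial k theta (unfold_paraboloid x).
Proof.
rewrite big_ord_recr/= [in RHS]mxE unlift_none /paraboloid_partial.
have last_ : unfold_paraboloid x 0 ord_max = Num.sqrt (height2 x) by rewrite mxE unlift_none.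
have dcw (i' : 'I_m.+1) (c : R) (l : 'I_m) : (\row_k (if unlift ord_max k is Some _ then (k == i')%:R else c)) 0
    (widen_ord (leqnSn m) l) = (lift ord_max l == i')%:R.
  have -> : widen_ord (leqnSn m) l = lift ord_max l.
    by apply/val_inj; rewrite /= /bump leqNgt ltn_ord.
  by rewrite mxE liftK.
case: (unliftP ord_max i) => [j ij|->].
  rewrite (bigD1 j)//= big1 ?addr0; last first.
    move=> l lj; rewrite dcw ij (inj_eq (@lift_inj _ _)) (negPf lj) mul0r//.
  rewrite dcw ij eqxx mul1r last_ mxE liftK mxE.
  have -> : widen_ord (leqnSn m) j = lift ord_max j.
    by apply/val_inj; rewrite /= /bump leqNgt ltn_ord.
  by ring.
rewrite big1 ?add0r; last by move=> l _; rewrite dcw eq_sym (negPf (neq_lift _ _)) mul0r.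
by rewrite last_.
Qed.

Lemma is_derive_paraboloid_pullback d M theta x i : 0 < d -> tame d M theta ->
  is_derive x (delta_mx 0 i) (paraboloid_pullback theta)
    (paraboloid_pullback (paraboloid_partial i theta) x).
Proof.
move=> d0 Ht; have [x0|x0] := ltP 0 (height2 x); last first.
  rewrite {2}/paraboloid_pullback ltNge x0/=.
  have : \forall y \near x, cst 0 y = paraboloid_pullback theta y.
    by apply: filterS (paraboloid_pullback_near0 d0 Ht x0) => y ->.
  move=> N; have N' := @near_eq_derive _ _ _ _ _ _ (delta_mx 0 i) N.
  split; first by apply: near_eq_derivable N _; exact: derivable_cst.
  by rewrite -N' derive_cst.
rewrite {2}/paraboloid_pullback x0.
have [st _] := Ht; have Ux := unfold_paraboloid_upper x0.
apply: is_derive_line0.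
pose c (t : R) := unfold_paraboloid (x + t *: delta_mx 0 i).
have c0 : c 0 = unfold_paraboloid x by rewrite /c scale0r addr0.
pose dc : 'rV[R]_m.+1 := \row_k (if unlift ord_max k is Some _ then (k == i)%:R else
     (if unlift ord_max i is Some _ then - x 0 i else 2^-1) / Num.sqrt (height2 x)).
have : is_derive (0 : R) 1 (fun t => theta (c t)) (\sum_k dc 0 k * partial k theta (c 0)).
  apply: is_derive_curve.
  - rewrite c0; have := open_nbhs_nbhs (conj open_upper_half_space Ux : open_nbhs _ _).
    by apply: filterS => y Uy k; exact: (st [::] y Uy).2.
  - by move=> k; rewrite c0; exact: (st [:: k] _ Ux).1.
  - by move=> k; rewrite mxE; exact: is_derive_unfold_paraboloid.
rewrite c0 => H.
have : \forall t \near (0 : R), theta (c t) = paraboloid_pullback theta (x + t *: delta_mx 0 i).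
  have : {for 0, continuous (fun t : R => x + t *: delta_mx 0 i : 'rV[R]_m.+1)}.
    apply: (@continuousD _ _ _ (fun=> x) (fun t : R => t *: delta_mx 0 i : 'rV[R]_m.+1)).
      exact: cst_continuous.
    by move=> ?; exact: scalel_continuous.
  move=> /(_ [set y | 0 < height2 y]); rewrite /= scale0r addr0 => /(_ (near_height2_gt0 x0)) A.
  have A' : \forall t \near (0 : R), 0 < height2 (x + t *: delta_mx 0 i) := A.
  by apply: filterS A' => t; rewrite /paraboloid_pullback => /= ->.
move=> N; have N' := @near_eq_derive R R R _ _ 0 1 N.
case: H => dH H.
rewrite paraboloid_partialE -/dc.
by split; [exact: near_eq_derivable N dH|rewrite -N'].
Qed.

Lemma continuous_paraboloid_pullback d M theta : 0 < d -> tame d M theta ->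
  continuous (paraboloid_pullback theta).
Proof.
move=> d0 Ht x; have [x0|x0] := ltP 0 (height2 x); last first.
  have N := paraboloid_pullback_near0 d0 Ht x0.
  rewrite /continuous_at {2}/paraboloid_pullback ltNge x0/=.
  have N' : \forall y \near x, cst 0 y = paraboloid_pullback theta y.
    by apply: filterS N => y ->.
  have C := @cst_continuous 'rV[R]_m.+1 R 0 x.
  exact: cvg_trans (near_eq_cvg N') C.
have : {for x, continuous (theta \o unfold_paraboloid)}.
  apply: continuous_comp; first exact: continuous_unfold_paraboloid.
  by have [st _] := Ht; exact: (st [::] _ (unfold_paraboloid_upper x0)).1.
rewrite /prop_for /continuous_at {2}/paraboloid_pullback x0; apply: cvg_trans.
have N : \forall y \near x, (theta \o unfold_paraboloid) y = paraboloid_pullback theta y.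
  by apply: filterS (near_height2_gt0 x0) => y; rewrite /paraboloid_pullback/= => ->.
exact: near_eq_cvg N.
Qed.

Lemma partial_eq0 theta i (y : 'rV[R]_m.+1) : (\forall z \near y, theta z = 0) -> partial i theta y = 0.
Proof.
move=> N; rewrite /partial -(@near_eq_derive _ _ _ (cst 0)) ?derive_cst//.
by apply: filterS N => z ->.
Qed.

Lemma tame_paraboloid_partial d M theta i : 0 < d -> tame d M theta -> tame d M (paraboloid_partial i theta).
Proof.
move=> d0 [st H]; have oU := open_upper_half_space.
have sp k := smooth_on_partial k st.
have nz y : U y -> y 0 ord_max != 0 by move=> Uy; rewrite gt_eqF.
split.
  apply/(smooth_onP _ _) => k; rewrite /paraboloid_partial.
  have Cp l : Ck U k (partial l theta) by move/smooth_onP : (sp l); exact.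
  have Ci : Ck U k (fun y => (y 0 ord_max)^-1) by apply: Ck_inv => //; exact: Ck_coord.
  case: (unlift _ _) => [j|].
    apply: CkD => //; apply: CkM => //; first exact: Ck_cst.
    by apply: CkM => //; apply: CkM => //; exact: Ck_coord.
  by apply: CkM => //; apply: CkM => //; exact: Ck_cst.
move=> y Uy; have [//|nH] := pselect (d <= rVlast y /\ `|y| <= M).
have z0 : \forall z \near y, theta z = 0.
  (* Whichever inequality fails at [y] fails strictly, hence also near [y]; so [theta] vanishes near
     [y], and its derivatives vanish at [y]. *)
  have : \forall z \near y, U z /\ ~ (d <= rVlast z /\ `|z| <= M).
    have oUy : \forall z \near y, U z by exact: open_nbhs_nbhs (conj oU Uy : open_nbhs _ _).
    have [yd|yd] := ltP (rVlast y) d.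
      have : \forall z \near y, rVlast z < d by apply: (cvgr_lt _ (@coord_continuous R 1 m.+1 ord0 ord_max y)).
      by apply: filterS2 oUy => z Uz; rewrite ltNge => /negP zd; split => // -[].
    have yM : M < `|y| by rewrite ltNge; apply/negP => yM; apply: nH.
    have : \forall z \near y, M < `|z| by apply: (cvgr_gt _ (@norm_continuous R _ y)).
    by apply: filterS2 oUy => z Uz; rewrite ltNge => /negP zd; split => // -[].
  apply: filterS => z [Uz nz_]; apply/eqP/negPn/negP => /(H z Uz); exact: nz_.
have p0 k : partial k theta y = 0 by exact: partial_eq0.
by rewrite /paraboloid_partial; case: unlift => [j|]; rewrite !p0 ?mulr0 ?addr0 eqxx.
Qed.

(** Iterated derivatives of a pullback are again pullbacks of tame functions, so continuity and
    derivability of all orders reduce to order 0 and 1. *)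
Lemma iter_partial_paraboloid_pullback d M theta s : 0 < d -> tame d M theta ->
  exists2 eta, tame d M eta &
  iter_partial s (paraboloid_pullback theta) = paraboloid_pullback eta.
Proof.
move=> d0; elim/last_ind: s theta => [|s i IH] theta Ht; first by exists theta.
have Ht' := tame_paraboloid_partial i d0 Ht; have [eta H1 H2] := IH _ Ht'.
exists eta => //; rewrite iter_partial_rcons -H2; congr iter_partial; apply/funext => x.
by case: (is_derive_paraboloid_pullback x i d0 Ht).
Qed.

Lemma smooth_paraboloid_pullback d M theta : 0 < d -> tame d M theta ->
  smooth_on setT (paraboloid_pullback theta).
Proof.
move=> d0 Ht s x _; have [eta He ->] := iter_partial_paraboloid_pullback s d0 Ht.
split; first exact: continuous_paraboloid_pullback d0 He x.
by move=> i; case: (is_derive_paraboloid_pullback x i d0 He).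
Qed.
End paraboloid.

(** * Differentiation under the integral sign and integration by parts *)

Lemma is_derive_integral (R : realType) d (Y : measurableType d) (mu : {measure set Y -> \bar R})
    (f df : R -> Y -> R) (G : Y -> R) (a : R) :
  (forall x, `|x - a| < 1 -> mu.-integrable setT (fun y => (f x y)%:E)) ->
  (forall x y, `|x - a| < 1 -> is_derive x 1 (f^~ y) (df x y)) ->
  mu.-integrable setT (fun y => (G y)%:E) ->
  (forall x y, `|x - a| < 1 -> `|df x y| <= G y) ->
  is_derive a 1 (fun x => \int[mu]_y f x y) (\int[mu]_y df a y).
Proof.
move=> intf derf intG dfG.
have near1 x : [set` `]a - 1, a + 1[] x -> `|x - a| < 1.
  by rewrite /= in_itv/= => /andP[? ?]; rewrite ltr_norml; apply/andP; split; lra.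
have a0 : `|a - a| < 1 by rewrite subrr normr0.
have aI : [set` `]a - 1, a + 1[] a by rewrite /= in_itv/=; apply/andP; split; lra.
have G0 y : 0 <= G y by apply: le_trans (dfG a y a0).
have E x y : `|x - a| < 1 -> partial1of2 f x y = df x y.
  by move=> xa; rewrite /partial1of2 derive1E; case: (derf x y xa).
have H1 x : [set` `]a - 1, a + 1[] x -> mu.-integrable setT (EFin \o f x) by move=> /near1; exact: intf.
have H2 x y : [set` `]a - 1, a + 1[] x -> setT y -> derivable (f^~ y) x 1.
  by move=> /near1 xa _; case: (derf x y xa).
have H3 x y : [set` `]a - 1, a + 1[] x -> setT y -> `|partial1of2 f x y| <= G y.
  by move=> /near1 xa _; rewrite E//; exact: dfG.
split; first exact: (derivable_under_integral measurableT aI H1 H2 G0 intG H3).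
rewrite -derive1E (differentiation_under_integral measurableT aI H1 H2 G0 intG H3).
by apply: eq_Rintegral => y _; exact: E.
Qed.

Section rV_invariance.
Context (R : realType) (n : nat).

Lemma integrable_rV_affine (c : R) (a : 'rV[R]_n) (f : 'rV[R]_n -> R) : c != 0 ->
  measurable_fun [set: 'rV[R]_n] f ->
  (lebesgue_rV R n).-integrable setT (fun x => (f x)%:E) ->
  (lebesgue_rV R n).-integrable setT (fun x => (f (c *: x + a))%:E).
Proof.
move=> c0 mf intf.
have := @transfer_integrable _ _ _ 'rV[R]_n 'rV[R]_n 'rV[R]_n R (lebesgue_rV R n) (lebesgue_rV R n)
  (fun=> `|c| ^+ n) (fun=> 1) (fun x => c *: x + a) id.
have mcl : measurable_fun [set: 'rV[R]_n] (fun x : 'rV[R]_n => c *: x + a) by meas.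
move=> /(_ (measurable_cst _) mcl).
move=> /(_ (fun=> exprn_ge0 _ (normr_ge0 _)) (fun=> ler01)).
have same (F : 'rV[R]_n -> \bar R) : measurable_fun [set: 'rV[R]_n] F -> (forall z, 0 <= F z)%E ->
  (\int[lebesgue_rV R n]_x ((`|c| ^+ n)%:E * F (c *: x + a)%R) = \int[lebesgue_rV R n]_y (1%:E * F (id y)))%E.
  move=> mF F0; under [RHS]eq_integral do rewrite mul1e.
  rewrite [RHS](ge0_integral_rV_affine a c0)// ge0_integralZl// ?lee_fin ?exprn_ge0//.
  by meas.
move=> /(_ same f mf).
rewrite (_ : (fun y => _) = (fun x => (f x)%:E)); last by apply/funext => y; rewrite mul1r.
move=> /(_ intf) H.
have -> : (fun x => (f (c *: x + a))%:E) = (fun x => ((`|c| ^+ n)^-1)%:E * (`|c| ^+ n * f (c *: x + a))%:E)%E.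
  by apply/funext => x; rewrite -EFinM mulKf// expf_neq0// normr_eq0.
exact: integrableZl.
Qed.

Lemma Rintegral_rV_affine (c : R) (a : 'rV[R]_n) (f : 'rV[R]_n -> R) : c != 0 ->
  measurable_fun [set: 'rV[R]_n] f ->
  (lebesgue_rV R n).-integrable setT (fun x => (f x)%:E) ->
  \int[lebesgue_rV R n]_x f x = `|c| ^+ n * \int[lebesgue_rV R n]_x f (c *: x + a).
Proof.
move=> c0 mf intf.
have same (F : 'rV[R]_n -> \bar R) : measurable_fun [set: 'rV[R]_n] F -> (forall z, 0 <= F z)%E ->
  (\int[lebesgue_rV R n]_x ((`|c| ^+ n)%:E * F (c *: x + a)%R) = \int[lebesgue_rV R n]_y (1%:E * F (id y)))%E.
  move=> mF F0; under [RHS]eq_integral do rewrite mul1e.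
  rewrite [RHS](ge0_integral_rV_affine a c0)// ge0_integralZl// ?lee_fin ?exprn_ge0//.
  by meas.
have := @transfer_Rintegral _ _ _ 'rV[R]_n 'rV[R]_n 'rV[R]_n R (lebesgue_rV R n) (lebesgue_rV R n)
  (fun=> `|c| ^+ n) (fun=> 1) (fun x => c *: x + a) id
  (fun=> exprn_ge0 _ (normr_ge0 _)) (fun=> ler01) same f mf.
under [X in _ = X -> _]eq_Rintegral do rewrite mul1r.
by move=> <-; rewrite RintegralZl//; exact: integrable_rV_affine.
Qed.

(* By translation invariance, the integral of [F (x + t e_i)] does not depend on [t]. *)
Lemma Rintegral_partial (F dF : 'rV[R]_n -> R) (G : 'rV[R]_n -> R) (i : 'I_n) :
  measurable_fun [set: 'rV[R]_n] F ->
  (lebesgue_rV R n).-integrable setT (fun x => (F x)%:E) ->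
  (lebesgue_rV R n).-integrable setT (fun x => (G x)%:E) ->
  (forall x, is_derive x (delta_mx 0 i) F (dF x)) ->
  (forall x (t : R), `|t| < 1 -> `|dF (x + t *: delta_mx 0 i)| <= G x) ->
  \int[lebesgue_rV R n]_x dF x = 0.
Proof.
move=> mF intF intG Fd dFG; have ne0 : (1 : R) != 0 by rewrite oner_neq0.
pose e : 'rV[R]_n := delta_mx 0 i.
have : is_derive (0 : R) 1 (fun t : R => \int[lebesgue_rV R n]_x F (x + t *: e))
    (\int[lebesgue_rV R n]_x dF (x + 0 *: e)).
  apply: (@is_derive_integral R _ 'rV[R]_n (lebesgue_rV R n) (fun (t : R) (x : 'rV[R]_n) => F (x + t *: e)) (fun (t : R) (x : 'rV[R]_n) => dF (x + t *: e)) G 0) => //.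
  - move=> t _; have := integrable_rV_affine (t *: e) ne0 mF intF.
    by under eq_fun do rewrite scale1r.
  - move=> t x _; have [d <-] := Fd (x + t *: e); exact: is_derive_line.
  - by move=> t x; rewrite subr0; exact: dFG.
have -> : (fun t : R => \int[lebesgue_rV R n]_x F (x + t *: e)) = cst (\int[lebesgue_rV R n]_x F x).
  apply/funext => t; rewrite [RHS](Rintegral_rV_affine (t *: e) ne0)// normr1 expr1n mul1r.
  by apply: eq_Rintegral => x _; rewrite scale1r.
case=> _; rewrite derive_cst => /esym.
by under eq_Rintegral do rewrite scale0r addr0.
Qed.
End rV_invariance.

(** * The heat semigroup *)

Section test_function.
Context (R : realType) (n : nat).
Implicit Types eta : 'rV[R]_n -> R.

Definition test_function eta :=
  smooth_on setT eta /\ exists M, forall x, M < `|x| -> eta x = 0.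

Lemma test_continuous eta : test_function eta -> continuous eta.
Proof. by move=> [s _] x; exact: (s [::] x I).1. Qed.

Lemma test_measurable eta : test_function eta -> measurable_fun [set: 'rV[R]_n] eta.
Proof. by move=> /test_continuous; exact: continuous_measurable_rV. Qed.

Lemma test_derivable eta x i : test_function eta -> derivable eta x (delta_mx 0 i).
Proof. by move=> [s _]; exact: (s [::] x I).2. Qed.

Lemma test_partial eta i : test_function eta -> test_function (partial i eta).
Proof.
move=> [s [M HM]]; split; first exact: smooth_on_partial.
exists M => x Mx; rewrite /partial -(@near_eq_derive _ _ _ (cst 0)) ?derive_cst//.
have : \forall z \near x, M < `|z| by apply: (cvgr_gt _ (@norm_continuous R _ x)).
by apply: filterS => z /HM ->.
Qed.

Lemma test_neg_laplacian eta : test_function eta -> test_function (neg_laplacian eta).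
Proof.
move=> te; have tp i : test_function (partial i (partial i eta)) by do 2 apply: test_partial.
split.
  have oT : open [set: 'rV[R]_n] by exact: openT.
  apply/(smooth_onP _) => k.
  have Cs : Ck setT k (laplacian eta).
    rewrite /laplacian; elim: (index_enum _) => [|i s IH].
      by apply: (Ck_ext oT) (Ck_cst oT k 0) => x _; rewrite big_nil.
    apply: (Ck_ext oT (f := fun x => partial i (partial i eta) x + \sum_(j <- s) partial j (partial j eta) x)).
      by move=> x _; rewrite big_cons.
    by apply: CkD => //; move/smooth_onP : (tp i).1; exact.
  apply: (Ck_ext oT) (CkM oT (Ck_cst oT k (-1)) Cs) => x _.
  by rewrite mulN1r.
have : exists M, forall x i, M < `|x| -> partial i (partial i eta) x = 0.
  have [M HM] := choice (fun i => (tp i).2).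
  exists (\sum_i `|M i|) => x i Mx; apply: HM; apply: le_lt_trans Mx.
  rewrite (bigD1 i)//=; apply: le_trans (ler_norm _) _; rewrite lerDl; exact: sumr_ge0.
move=> [M HM]; exists M => x Mx; rewrite /neg_laplacian /laplacian big1 ?oppr0// => i _; exact: HM.
Qed.

Lemma dotp_le_norm (x : 'rV[R]_n) : dotp x x <= n%:R * `|x| ^+ 2.
Proof.
rewrite /dotp (_ : n%:R * _ = \sum_(i < n) `|x| ^+ 2); last first.
  by rewrite sumr_const card_ord mulr_natl.
apply: ler_sum => i _; rewrite -expr2 -[x 0 i ^+ 2]real_normK ?num_real//.
by rewrite lerXn2r ?nnegrE// norm_coord_le.
Qed.

(** On the ball that contains the support enlarged by 1 the Gaussian has a positive lower bound.
    Gaussians can therefore serve as dominating functions for test functions. *)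
Lemma test_gauss_le eta : test_function eta -> exists2 K, 0 <= K &
  forall x h, `|h| <= 1 -> `|eta (x + h)| <= K * gauss_kernel x.
Proof.
move=> te; have [s [M HM]] := te.
have [B HB] : exists B, forall x, `|eta x| <= B.
  have cA : compact [set x : 'rV[R]_n | `|x| <= M].
    apply: bounded_closed_compact.
      by exists M; split; [exact: num_real|move=> y My x /= xM; rewrite (le_trans xM)// ltW].
    rewrite (_ : [set _ | _] = (fun x => `|x|) @^-1` [set t : R | t <= M])//.
    by apply: preimage_closed => [x _|]; [exact: norm_continuous|exact: closed_le].
  have cI : compact ((fun x => `|eta x|) @` [set x : 'rV[R]_n | `|x| <= M]).
    apply: continuous_compact => //; apply: continuous_subspaceT => x.
    apply: (@continuous_comp _ _ _ eta (fun t : R => `|t|)); first exact: test_continuous.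
    exact: norm_continuous.
  have [B [_ HB]] := compact_bounded cI.
  exists (`|B| + 1) => x; have [xM|xM] := leP `|x| M.
    have := HB (`|B| + 1) _ `|eta x| _; rewrite /= normr_id; apply.
      by rewrite (le_lt_trans (ler_norm B))// ltrDl.
    by exists x.
  by rewrite HM// normr0 addr_ge0.
have B0 : 0 <= B by apply: le_trans (normr_ge0 _) (HB 0).
(* A lower bound of [gauss_kernel] for [|x|] at most [|M| + 1]: the norm is the sup norm, and
   [dotp x x] is at most n times its square. *)
pose c := (Num.sqrt pi) ^- n * expR (- (n%:R * (`|M| + 1) ^+ 2)) : R.
have c0 : 0 < c by rewrite mulr_gt0 ?expR_gt0// invr_gt0 exprn_gt0// sqrtr_gt0 pi_gt0.
exists (B / c) => [|x h h1]; first by rewrite divr_ge0// ltW.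
have [xM|xM] := leP `|x| (`|M| + 1); last first.
  have -> : eta (x + h) = 0.
    apply: HM; have : `|x| <= `|x + h| + `|h| by rewrite -{1}[x](addrK h) ler_normB.
    by have := ler_norm M; lra.
  by rewrite normr0 mulr_ge0 ?gauss_kernel_ge0// divr_ge0// ltW.
apply: le_trans (HB _) _; rewrite -mulrA ler_peMr// mulrC ler_pdivlMr// mul1r.
rewrite /c /gauss_kernel ler_wpM2l ?invr_ge0 ?exprn_ge0 ?sqrtr_ge0//.
rewrite ler_expR lerN2 (le_trans (dotp_le_norm x))// ler_wpM2l//.
by rewrite lerXn2r ?nnegrE// addr_ge0.
Qed.

Lemma test_gauss_le0 eta : test_function eta -> exists2 K, 0 <= K &
  forall x, `|eta x| <= K * gauss_kernel x.
Proof.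
move=> /test_gauss_le[K K0 HK]; exists K => // x.
by have := HK x 0; rewrite addr0 normr0; apply.
Qed.

Lemma gauss_kernel_le (z : 'rV[R]_n) : gauss_kernel z <= Num.sqrt pi ^- n.
Proof.
rewrite /gauss_kernel ler_piMr ?invr_ge0 ?exprn_ge0 ?sqrtr_ge0//.
by rewrite -[leRHS]expR0 ler_expR oppr_le0 dotp_ge0.
Qed.

Lemma test_bounded eta : test_function eta -> exists2 B, 0 <= B & forall x, `|eta x| <= B.
Proof.
move=> /test_gauss_le0[K K0 HK]; exists (K * Num.sqrt pi ^- n).
  by rewrite mulr_ge0// invr_ge0 exprn_ge0// sqrtr_ge0.
by move=> x; rewrite (le_trans (HK x))// ler_wpM2l// gauss_kernel_le.
Qed.

Lemma integrable_gauss_kernel : (lebesgue_rV R n).-integrable setT (fun z => (gauss_kernel z)%:E).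
Proof.
apply: ge0_integrable.
- by apply: measurable_gauss_kernel; exact: measurable_id.
- exact: gauss_kernel_ge0.
- by rewrite integral_gauss_kernel ltry.
Qed.

(* A Gaussian of larger width absorbs a linear exponential. *)
Definition wide_gauss (z : 'rV[R]_n) : R := expR (- ((1/2) ^+ 2 * dotp z z)).

Lemma integrable_wide_gauss : (lebesgue_rV R n).-integrable setT (fun z => (wide_gauss z)%:E).
Proof.
apply: (ge0_integrable wide_gauss).
- by rewrite /wide_gauss; meas.
- by move=> z; exact: expR_ge0.
- by rewrite /wide_gauss ge0_integral_gauss_rV ?ltry.
Qed.

Lemma norm_coord_enorm (z : 'rV[R]_n) i : `|z 0 i| <= enorm z.
Proof.
rewrite -(@ler_pXn2r _ 2) ?nnegrE ?enorm_ge0// real_normK ?num_real// enorm_sq.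
by rewrite /dotp (bigD1 i)//= -expr2 lerDl sumr_ge0// => j _; rewrite -expr2 sqr_ge0.
Qed.

(** A bound uniform in the shift, as domination requires when integrands containing [gauss_kernel]
    are differentiated in the direction i. *)
Lemma gauss_kernel_coord_le (z : 'rV[R]_n) (i : 'I_n) (t : R) : `|t| <= 1 ->
  (2 + `|z 0 i|) * gauss_kernel (z + t *: delta_mx 0 i) <=
  (2 * expR 3 * Num.sqrt pi ^- n) * wide_gauss z.
Proof.
move=> t1; rewrite /gauss_kernel mulrCA -mulrA [in leRHS]mulrCA [in leRHS]mulrA [in leRHS]mulrAC.
rewrite -mulrA [leRHS]mulrC.
rewrite [leRHS](_ : _ = Num.sqrt pi ^- n * (2 * expR 3 * wide_gauss z)); last by ring.
rewrite ler_wpM2l ?invr_ge0 ?exprn_ge0 ?sqrtr_ge0//.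
pose a := `|z 0 i|.
have a0 : 0 <= a by exact: normr_ge0.
have E : dotp (z + t *: delta_mx 0 i) (z + t *: delta_mx 0 i) = dotp z z + 2 * t * z 0 i + t ^+ 2.
  rewrite /dotp (bigD1 i)//= [in RHS](bigD1 i)//= !mxE !eqxx/=.
  rewrite [X in _ + X](eq_bigr (fun j => z 0 j * z 0 j)); last first.
    by move=> j ji; rewrite !mxE (negPf ji) andbF mulr0 addr0.
  by ring.
have az : a ^+ 2 <= dotp z z.
  by rewrite -enorm_sq lerXn2r ?nnegrE ?enorm_ge0// norm_coord_enorm.
have ta : - (2 * t * z 0 i) <= 2 * a.
  have : `|t * z 0 i| <= a by rewrite normrM ler_piMl.
  by rewrite ler_norml => /andP[]; lra.
have h2 : 2 + a <= 2 * expR a.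
  by have := expR_ge1Dx a; lra.
apply: (@le_trans _ _ (2 * expR a * expR (- (dotp z z) + 2 * a))).
  apply: ler_pM => //.
  by rewrite ler_expR E; have := sqr_ge0 t; lra.
rewrite -!mulrA ler_wpM2l// /wide_gauss -!expRD ler_expR.
(* What remains is 3 a <= 3 + 3/4 [dotp z z]. Since [dotp z z] is at least a^2, it follows from 3/4
   (a - 2)^2 >= 0; this is the origin of [expR 3]. *)
have := sqr_ge0 (a - 2); rewrite sqrrB; lra.
Qed.
End test_function.

Lemma integrable_sum_EFin (R : realType) d (Y : measurableType d) (mu : {measure set Y -> \bar R})
    (I : Type) (r : seq I) (f : I -> Y -> R) :
  (forall i, mu.-integrable setT (fun y => (f i y)%:E)) ->
  mu.-integrable setT (fun y => (\sum_(i <- r) f i y)%:E).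
Proof.
move=> intf; elim: r => [|i r IH].
  by under eq_fun do rewrite big_nil; exact: integrable0.
by under eq_fun do rewrite big_cons EFinD; exact: integrableD.
Qed.

Lemma Rintegral_sum (R : realType) d (Y : measurableType d) (mu : {measure set Y -> \bar R})
    (I : Type) (r : seq I) (f : I -> Y -> R) :
  (forall i, mu.-integrable setT (fun y => (f i y)%:E)) ->
  \int[mu]_y (\sum_(i <- r) f i y) = \sum_(i <- r) \int[mu]_y f i y.
Proof.
move=> intf; elim: r => [|i r IH].
  by under eq_Rintegral do rewrite big_nil; rewrite Rintegral_cst// mul0r big_nil.
under eq_Rintegral do rewrite big_cons.
have H := integrable_sum_EFin r intf.
by rewrite (RintegralD measurableT (intf i) H) IH big_cons.
Qed.

Section heat.
Context (R : realType) (n : nat).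
Implicit Types (eta : 'rV[R]_n -> R) (x z : 'rV[R]_n) (s : R).

(* The heat semigroup at time [s ^ 2]. *)
Definition heat s eta x : R :=
  \int[lebesgue_rV R n]_z (gauss_kernel z * eta (x + (2 * s) *: z)).

Lemma Rintegral_gauss_kernel : \int[lebesgue_rV R n]_z gauss_kernel z = 1.
Proof. by rewrite /Rintegral integral_gauss_kernel. Qed.

Lemma measurable_heat_integrand (w : 'rV[R]_n -> R) eta s x :
  measurable_fun [set: 'rV[R]_n] w -> measurable_fun [set: 'rV[R]_n] eta ->
  measurable_fun [set: 'rV[R]_n] (fun z => w z * eta (x + (2 * s) *: z)).
Proof. by move=> mw me; meas. Qed.

Lemma integrable_bounded_weight (w g : 'rV[R]_n -> R) eta s x B :
  measurable_fun [set: 'rV[R]_n] w -> measurable_fun [set: 'rV[R]_n] eta ->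
  (forall z, `|eta z| <= B) ->
  (lebesgue_rV R n).-integrable setT (fun z => (g z)%:E) ->
  (forall z, `|w z| <= g z) ->
  (lebesgue_rV R n).-integrable setT (fun z => (w z * eta (x + (2 * s) *: z))%:E).
Proof.
move=> mw me HB ig wg.
apply: (dominated_integrable_by (fun z => w z * eta (x + (2 * s) *: z)) (fun z => B * g z)).
- exact: measurable_heat_integrand.
- by under eq_fun do rewrite EFinM; exact: integrableZl.
- by move=> z; rewrite normrM mulrC ler_pM.
Qed.

Lemma integrable_heat eta s x B :
  measurable_fun [set: 'rV[R]_n] eta -> (forall z, `|eta z| <= B) ->
  (lebesgue_rV R n).-integrable setT (fun z => (gauss_kernel z * eta (x + (2 * s) *: z))%:E).
Proof.
move=> me HB; apply: (integrable_bounded_weight (g := @gauss_kernel R n)) HB _ _ => //.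
- by apply: measurable_gauss_kernel; exact: measurable_id.
- exact: integrable_gauss_kernel.
- by move=> z; rewrite ger0_norm// gauss_kernel_ge0.
Qed.

Lemma heat0 eta x : heat 0 eta x = eta x.
Proof.
rewrite /heat; under eq_Rintegral do rewrite mulr0 scale0r addr0.
by rewrite RintegralZr ?Rintegral_gauss_kernel ?mul1r//; exact: integrable_gauss_kernel.
Qed.

Lemma heat_le_bound eta s x B :
  measurable_fun [set: 'rV[R]_n] eta -> (forall z, `|eta z| <= B) -> `|heat s eta x| <= B.
Proof.
move=> me HB; have iG := integrable_gauss_kernel R n.
apply: le_trans (le_normr_Rintegral measurableT (integrable_heat s x me HB)) _.
have -> : B = \int[lebesgue_rV R n]_z (B * gauss_kernel z).
  by rewrite RintegralZl// Rintegral_gauss_kernel mulr1.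
have H : (lebesgue_rV R n).-integrable setT (fun z => (B * gauss_kernel z)%:E).
  by under eq_fun do rewrite EFinM; exact: integrableZl.
apply: le_Rintegral => //.
- by have := integrable_norm (integrable_heat s x me HB).
- move=> z _; rewrite (normrM (gauss_kernel z)) mulrC (ger0_norm (gauss_kernel_ge0 z)).
  by rewrite ler_wpM2r ?gauss_kernel_ge0.
Qed.

Lemma integrable_shift eta s x : s != 0 -> measurable_fun [set: 'rV[R]_n] eta ->
  (lebesgue_rV R n).-integrable setT (fun z => (eta z)%:E) ->
  (lebesgue_rV R n).-integrable setT (fun z => (eta (x + s *: z))%:E).
Proof.
move=> s0 me ie; have := integrable_rV_affine x s0 me ie.
by under eq_fun do rewrite addrC.
Qed.

(** The weight is estimated by its bound, and the substitution y = x + 2 s z in the integral of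
    [|eta|] produces (2 s)^-n. *)
Lemma weighted_decay (w : 'rV[R]_n -> R) eta s x W : 0 < s ->
  measurable_fun [set: 'rV[R]_n] w -> measurable_fun [set: 'rV[R]_n] eta ->
  (lebesgue_rV R n).-integrable setT (fun z => (eta z)%:E) ->
  (forall z, `|w z| <= W) ->
  `|\int[lebesgue_rV R n]_z (w z * eta (x + (2 * s) *: z))| <=
    W * (\int[lebesgue_rV R n]_z `|eta z|) / (2 * s) ^+ n.
Proof.
move=> s0 mw me ie HW; have s20 : 2 * s != 0 by rewrite gt_eqF// mulr_gt0.
have ies := integrable_shift x s20 me ie.
have iW : (lebesgue_rV R n).-integrable setT (fun z => (W * `|eta (x + (2 * s) *: z)|)%:E).
  by under eq_fun do rewrite EFinM; apply: integrableZl => //; exact: (integrable_norm ies).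
have iw : (lebesgue_rV R n).-integrable setT (fun z => (w z * eta (x + (2 * s) *: z))%:E).
  apply: (dominated_integrable_by (fun z => w z * eta (x + (2 * s) *: z)) _ _ iW).
    exact: measurable_heat_integrand.
  by move=> z; rewrite normrM ler_wpM2r.
apply: le_trans (le_normr_Rintegral measurableT iw) _.
rewrite (Rintegral_rV_affine x s20); last 2 first.
- by meas.
- exact: (integrable_norm ie).
rewrite gtr0_norm ?mulr_gt0// mulrCA mulrAC divff ?expf_neq0// mul1r -RintegralZl//; last first.
  by under eq_fun do rewrite addrC; exact: (integrable_norm ies).
apply: le_Rintegral => //.
- exact: (integrable_norm iw).
- by under eq_fun do rewrite addrC.
- by move=> z _; rewrite addrC normrM ler_wpM2r.
Qed.

Lemma test_integrable eta : test_function eta ->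
  (lebesgue_rV R n).-integrable setT (fun z => (eta z)%:E).
Proof.
move=> te; have [K K0 HK] := test_gauss_le0 te.
apply: (dominated_integrable_by eta (fun z => K * gauss_kernel z)) => //.
- exact: test_measurable.
- by under eq_fun do rewrite EFinM; apply: integrableZl => //; exact: integrable_gauss_kernel.
Qed.

Lemma heat_decay eta : measurable_fun [set: 'rV[R]_n] eta ->
  (lebesgue_rV R n).-integrable setT (fun z => (eta z)%:E) -> exists2 C, 0 <= C &
  forall s x, 0 < s -> `|heat s eta x| <= C / s ^+ n.
Proof.
move=> me ie; pose C := Num.sqrt pi ^- n * (\int[lebesgue_rV R n]_z `|eta z|) / 2 ^+ n.
exists C.
  rewrite divr_ge0 ?exprn_ge0// mulr_ge0 ?invr_ge0 ?exprn_ge0 ?sqrtr_ge0//.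
  exact: Rintegral_ge0.
move=> s x s0; rewrite (_ : C / s ^+ n = Num.sqrt pi ^- n * (\int[lebesgue_rV R n]_z `|eta z|) / (2 * s) ^+ n).
  2: by rewrite /C exprMn invfM mulrA.
rewrite /heat.
apply: weighted_decay => //.
- by apply: measurable_gauss_kernel; exact: measurable_id.
- by move=> z; rewrite ger0_norm ?gauss_kernel_ge0// gauss_kernel_le.
Qed.

Lemma is_derive_gauss_kernel z i :
  is_derive z (delta_mx 0 i) (@gauss_kernel R n) (- (2 * z 0 i) * gauss_kernel z).
Proof.
apply: is_derive_line0; rewrite /gauss_kernel.
have E (t : R) : dotp (z + t *: delta_mx 0 i) (z + t *: delta_mx 0 i) = dotp z z + 2 * z 0 i * t + t ^+ 2.
  rewrite /dotp (bigD1 i)//= [in RHS](bigD1 i)//= !mxE !eqxx/=.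
  rewrite [X in _ + X](eq_bigr (fun j => z 0 j * z 0 j)); last first.
    by move=> j ji; rewrite !mxE (negPf ji) andbF mulr0 addr0.
  by ring.
rewrite (_ : (fun t : R => _) = (fun t : R => Num.sqrt pi ^- n * expR (- (dotp z z + 2 * z 0 i * t + t ^+ 2)))); last first.
  by apply/funext => t; rewrite E.
apply: is_derive_eq; have A (a : R) : a *: (1 : R) = a by exact: mulr1.
have A' (a b : R) : a *: (b : R) = a * b by [].
by rewrite ?A ?A' ?mulr0 ?addr0 ?expr0n/= ?addr0; ring.
Qed.

Lemma is_derive_test_affine eta s x z i : test_function eta ->
  is_derive z (delta_mx 0 i) (fun z => eta (x + (2 * s) *: z)) (2 * s * partial i eta (x + (2 * s) *: z)).
Proof.
move=> te; apply: is_derive_line0.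
pose g (t : R) : R := 0 + t * (2 * s).
have := @is_derive1_comp R (fun u : R => eta ((x + (2 * s) *: z) + u *: delta_mx 0 i)) g 0 _ _
  (is_derive_line (@test_derivable _ _ _ _ i te)) (is_derive_affine 0 (2 * s) 0).
rewrite /g mul0r addr0 scale0r addr0 [X in is_derive _ _ _ X]mulrC => H.
rewrite (_ : (fun t : R => _) = ((fun u : R => eta ((x + (2 * s) *: z) + u *: delta_mx 0 i)) \o (fun t : R => 0 + t * (2 * s))))//.
by apply/funext => t /=; rewrite scalerDr scalerA add0r addrA (mulrC t).
Qed.

Lemma gauss_coord_wide z i : `|2 * z 0 i * gauss_kernel z| <= 2 * (2 * expR 3 * Num.sqrt pi ^- n * wide_gauss z).
Proof.
have := @gauss_kernel_coord_le R n z i 0; rewrite normr0 scale0r addr0 => /(_ ler01) H.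
rewrite -mulrA normrM ger0_norm// ler_wpM2l// normrM (ger0_norm (gauss_kernel_ge0 z)).
apply: le_trans _ H; rewrite ler_wpM2r ?gauss_kernel_ge0//; lra.
Qed.

Lemma integrable_wide_gaussZ (c : R) : (lebesgue_rV R n).-integrable setT (fun z => (c * wide_gauss z)%:E).
Proof. by under eq_fun do rewrite EFinM; apply: integrableZl => //; exact: integrable_wide_gauss. Qed.

Lemma measurable_gauss_coord i : measurable_fun [set: 'rV[R]_n] (fun z : 'rV[R]_n => 2 * z 0 i * gauss_kernel z).
Proof. by rewrite /gauss_kernel; meas. Qed.

Lemma integrable_gauss_coord eta s x i : test_function eta ->
  (lebesgue_rV R n).-integrable setT (fun z => (2 * z 0 i * gauss_kernel z * eta (x + (2 * s) *: z))%:E).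
Proof.
move=> te; have [B _ HB] := test_bounded te.
apply: (integrable_bounded_weight (w := fun z : 'rV[R]_n => 2 * z 0 i * gauss_kernel z)
   (g := fun z => 2 * (2 * expR 3 * Num.sqrt pi ^- n * wide_gauss z))) HB _ _.
- exact: measurable_gauss_coord.
- exact: test_measurable.
- by under eq_fun do rewrite mulrA; exact: integrable_wide_gaussZ.
- by move=> z; exact: gauss_coord_wide.
Qed.

(** Gaussian integration by parts: -2 z_i times the Gaussian is its derivative, and the derivative
    of the whole integrand of [heat] in the direction i integrates to 0. It trades a factor 2 z_i
    for a derivative of [eta] and a factor 2 s. *)
Lemma heat_parts eta s x i : test_function eta ->
  \int[lebesgue_rV R n]_z (2 * z 0 i * gauss_kernel z * eta (x + (2 * s) *: z)) =
  2 * s * heat s (partial i eta) x.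
Proof.
move=> te; have tpe := test_partial i te.
have [B B0 HB] := test_bounded te; have [B' B0' HB'] := test_bounded tpe.
have me := test_measurable te; have mpe := test_measurable tpe.
pose F z := gauss_kernel z * eta (x + (2 * s) *: z).
pose dF (z : 'rV[R]_n) := 2 * s * (gauss_kernel z * partial i eta (x + (2 * s) *: z)) -
  2 * z 0 i * gauss_kernel z * eta (x + (2 * s) *: z).
have i1 : (lebesgue_rV R n).-integrable setT (fun z => (gauss_kernel z * partial i eta (x + (2 * s) *: z))%:E).
  exact: integrable_heat HB'.
have i1' : (lebesgue_rV R n).-integrable setT (fun z => (2 * s * (gauss_kernel z * partial i eta (x + (2 * s) *: z)))%:E).
  by under eq_fun do rewrite EFinM; exact: integrableZl.
have i2 := integrable_gauss_coord s x i te.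
suff : \int[lebesgue_rV R n]_z dF z = 0.
  rewrite RintegralB// => /eqP; rewrite subr_eq0 => /eqP <-.
  by rewrite RintegralZl.
(* [B] and [B'] bound [eta] and its derivative; the remaining factor is the bound of
   [gauss_kernel_coord_le], which covers all shifts at once. *)
pose G z := (2 * `|s| * B' + 2 * B) * (2 * expR 3 * Num.sqrt pi ^- n * wide_gauss z).
apply: (@Rintegral_partial R n F dF G i).
- by apply: measurable_heat_integrand => //; apply: measurable_gauss_kernel; exact: measurable_id.
- exact: integrable_heat HB.
- by under eq_fun do rewrite /G mulrA; exact: integrable_wide_gaussZ.
- move=> z; have d1 := is_derive_gauss_kernel z i; have d2 := @is_derive_test_affine eta s x z i te.
  have := is_deriveM d1 d2; rewrite /F/= => H; apply: is_derive_eq H _.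
  by rewrite /dF; have A' (a b : R) : a *: (b : R) = a * b by []; rewrite !A'; ring.
move=> z t t1; rewrite /G; set z' := z + t *: _.
apply: (@le_trans _ _ ((2 * `|s| * B' + 2 * B) * ((2 + `|z 0 i|) * gauss_kernel z'))); last first.
  by rewrite ler_wpM2l ?addr_ge0 ?mulr_ge0// gauss_kernel_coord_le// ltW.
have g0 := gauss_kernel_ge0 z'.
have z'i : `|z' 0 i| <= 2 + `|z 0 i|.
  rewrite !mxE !eqxx mulr1 (le_trans (ler_normD _ _))// addrC lerD2r; lra.
rewrite /dF; move: (gauss_kernel z') g0 => g g0.
apply: le_trans (ler_normB _ _) _; rewrite [leRHS]mulrDl; apply: lerD.
  rewrite !normrM (ger0_norm g0) (ger0_norm (ler0n _ 2)).
  rewrite -!mulrA ler_wpM2l// ler_wpM2l// [leLHS]mulrC; apply: ler_pM => //.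
  by rewrite ler_peMl//; have := normr_ge0 (z 0 i); lra.
rewrite -!mulrA !normrM (ger0_norm g0) (ger0_norm (ler0n _ 2)).
rewrite ler_wpM2l// mulrA [leLHS]mulrC; apply: ler_pM => //; first by rewrite mulr_ge0.
by rewrite ler_wpM2r.
Qed.

(** Differentiation in s produces the sum of 2 z_i times the i-th derivative of [eta]; applying
    [heat_parts] to each of these derivatives converts 2 z_i into 2 s times a second derivative. *)
Lemma is_derive_heat eta s x : test_function eta ->
  is_derive s 1 (fun s => heat s eta x) (- (2 * s) * heat s (neg_laplacian eta) x).
Proof.
move=> te; have me := test_measurable te.
have [B0 HB0 HB] : exists2 B, 0 <= B & forall i z, `|partial i eta z| <= B.
  have [B HB] := choice (fun i => let: ex_intro2 B B0 H := test_bounded (test_partial i te) in ex_intro (fun B => forall z, `|partial i eta z| <= B) B H).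
  exists (\sum_i `|B i|); first exact: sumr_ge0.
  move=> i z; rewrite (le_trans (HB i z))// (bigD1 i)//=.
  by apply: le_trans (ler_norm _) _; rewrite lerDl; exact: sumr_ge0.
pose f (s : R) z := gauss_kernel z * eta (x + (2 * s) *: z).
pose df (s : R) (z : 'rV[R]_n) := \sum_i 2 * z 0 i * gauss_kernel z * partial i eta (x + (2 * s) *: z).
pose G z := \sum_(i < n) (2 * (2 * expR 3 * Num.sqrt pi ^- n * wide_gauss z) * B0) : R.
have [B _ HB1] := test_bounded te.
have : is_derive s 1 (fun s => \int[lebesgue_rV R n]_z f s z) (\int[lebesgue_rV R n]_z df s z).
  apply: (@is_derive_integral R _ 'rV[R]_n (lebesgue_rV R n) f df G s).
  - by move=> t _; exact: integrable_heat HB1.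
  - move=> t z _; rewrite /f /df.
    have dc k : is_derive t 1 (fun t : R => (x + (2 * t) *: z) 0 k) ((2 *: z) 0 k).
      rewrite (_ : (fun t : R => _) = (fun t : R => x 0 k + t * (2 * z 0 k))); last first.
        by apply/funext => u; rewrite !mxE; ring.
      by rewrite mxE; exact: is_derive_affine.
    have := @is_derive_curve R n eta (fun t : R => x + (2 * t) *: z) t (2 *: z) _ _ dc.
    have N : \forall y \near x + (2 * t) *: z, forall i, derivable eta y (delta_mx 0 i).
      by apply: filterE => y i; exact: test_derivable.
    move=> /(_ N (fun i => @test_continuous _ _ _ (test_partial i te) _)) H.
    have H' := is_deriveZ (gauss_kernel z) H; apply: is_derive_eq H' _.
    rewrite scaler_sumr; apply: eq_bigr => i _; rewrite mxE.
    by have A' (a b : R) : a *: (b : R) = a * b by []; rewrite !A'; ring.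
  - rewrite /G; under eq_fun do rewrite sumr_const card_ord -mulr_natl.
    rewrite (_ : (fun z => _) = (fun z : 'rV[R]_n => (n%:R * (2 * (2 * expR 3 * Num.sqrt pi ^- n) * B0) * wide_gauss z)%:E)).
      exact: integrable_wide_gaussZ.
    by apply/funext => z; congr EFin; ring.
  - move=> t z _; apply: le_trans (ler_norm_sum _ _ _) _; apply: ler_sum => i _.
    by rewrite normrM; apply: ler_pM => //; exact: gauss_coord_wide.
move=> H; apply: is_derive_eq H _.
have E1 : \int[lebesgue_rV R n]_z df s z = \sum_i (2 * s * heat s (partial i (partial i eta)) x).
  rewrite /df Rintegral_sum//; last by move=> i; apply: integrable_gauss_coord; exact: test_partial.
  by apply: eq_bigr => i _; rewrite heat_parts//; exact: test_partial.
rewrite E1 -mulr_sumr mulNr -mulrN; congr (_ * _).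
rewrite /heat /neg_laplacian /laplacian.
rewrite -Rintegral_sum//; last first.
  move=> i; have [B2 _ HB2] := test_bounded (test_partial i (test_partial i te)).
  by apply: integrable_heat HB2; apply: test_measurable; do 2 apply: test_partial.
rewrite -[RHS]mulN1r -RintegralZl//.
  by apply: eq_Rintegral => z _; rewrite mulN1r mulrN opprK mulr_sumr.
have tl := test_neg_laplacian te; have [B2 _ HB2] := test_bounded tl.
by apply: integrable_heat HB2; exact: test_measurable.
Qed.
End heat.

(** The fundamental theorem on [0, n+1], followed by dominated convergence with [|f|] as the
    bound. *)
Lemma FTC_halfline (R : realType) (F f : R -> R) :
  (forall x : R, is_derive x 1 F (f x)) -> continuous f ->
  (leb R).-integrable setT (fun x => (if 0 < x then f x else 0)%:E) ->
  F x @[x --> +oo] --> 0 ->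
  \int[leb R]_x (if 0 < x then f x else 0) = - F 0.
Proof.
move=> dF cf intf F0; rewrite -(Rintegral_halfline f) /Rintegral.
have mf : measurable_fun [set: measurableTypeR R] f by exact: continuous_measurable_fun.
have intf' : (leb R).-integrable [set` `]0, +oo[] (EFin \o f) by apply/integrable_halfline.
pose D : set R := [set` `]0, +oo[].
have mD : measurable (D : set (measurableTypeR R)) by exact: measurable_itv.
pose u (n : nat) : R -> \bar R := (EFin \o f) \_ [set` `]-oo, n.+1%:R]].
have mE n : measurable ([set` `]-oo, n.+1%:R]] : set (measurableTypeR R)) by exact: measurable_itv.
have cvu : (\int[leb R]_(x in D) u n x)%E @[n --> \oo] --> (\int[leb R]_(x in D) (EFin \o f) x)%E.
  apply: (@dominated_cvg _ _ _ (leb R) D mD u (EFin \o f) (fun x => `|f x|%:E)) => //.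
  - move=> n; apply/(measurable_restrict _ (mE n) mD); apply: measurable_funTS.
    exact/measurable_EFinP.
  - move=> x _; apply: cvg_near_cst.
    have [N xN] : exists N, x <= N%:R.
      by exists (Num.truncn x).+1; rewrite ltW// truncnS_gt.
    near=> n; rewrite /u patchE mem_set//= in_itv/= (le_trans xN)// ler_nat.
    by rewrite (@leq_trans n)//; near: n; exact: nbhs_infty_ge.
  - exact: (integrable_norm intf').
  - move=> n x _; rewrite /u patchE; case: ifP => _//=.
    by rewrite normr0 lee_fin.
have uE n : (\int[leb R]_(x in D) u n x = (F n.+1%:R - F 0)%:E)%E.
  rewrite /u -integral_mkcondr (_ : D `&` _ = [set` `]0, n.+1%:R]]); last first.
    apply/seteqP; split=> x /=; rewrite /D/= !in_itv/= ?andbT.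
      by move=> [-> ->].
    by move=> /andP[-> ->].
  rewrite integral_itv_obnd_cbnd; last by apply: measurable_funTS; exact/measurable_EFinP.
  rewrite (@continuous_FTC2 _ f F)//.
  - exact: continuous_subspaceT.
  - have cF x : {for x, continuous F}.
      by apply: differentiable_continuous; apply/derivable1_diffP; case: (dF x).
    split.
    + by move=> x _; case: (dF x).
    + by apply: cvg_at_right_filter; exact: cF.
    + by apply: cvg_at_left_filter; exact: cF.
  - by move=> x _; rewrite derive1E; case: (dF x).
have cF : (F n.+1%:R - F 0)%:E @[n --> \oo] --> (- F 0)%:E.
  apply: cvg_EFin; first exact: nearW.
  rewrite -[X in _ --> X]add0r; apply: cvgB; last exact: cvg_cst.
  have H : n.+1%:R @[n --> \oo] --> (+oo : set_system R).
    have := cvg_comp _ _ (cvg_addnr 1) (@cvgr_idn R).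
    by rewrite (_ : _ \o _ = (fun n => n.+1%:R))//; apply/funext => n /=; rewrite addn1.
  exact: (cvg_comp _ _ H F0).
have -> : (\int[leb R]_(x in D) (EFin \o f) x = (- F 0)%:E)%E.
  have cvu' : (\int[leb R]_(x in D) u n x)%E @[n --> \oo] --> (- F 0)%:E by rewrite (funext uE).
  exact: (@cvg_unique _ (@ereal_hausdorff R) _ _ _ _ cvu cvu').
by [].
Unshelve. all: by end_near.
Qed.

Section heat_moment.
Context (R : realType) (n : nat).
Implicit Types (eta : 'rV[R]_n -> R) (x : 'rV[R]_n) (s : R).

Lemma gauss_coord_bound (z : 'rV[R]_n) i : `|2 * z 0 i * gauss_kernel z| <= 2 * (2 * expR 3 * Num.sqrt pi ^- n).
Proof.
have w1 : wide_gauss z <= 1.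
  by rewrite /wide_gauss -[leRHS]expR0 ler_expR oppr_le0 mulr_ge0 ?sqr_ge0 ?dotp_ge0.
apply: le_trans (gauss_coord_wide z i) _; rewrite ler_wpM2l// ler_piMr//.
Qed.

(** Moving the derivative onto the Gaussian gains one power of s over [heat_decay]. This extra power
    makes the moment of order n - 1 of [neg_laplacian eta] converge, which the integration by parts
    in s needs. *)
Lemma heat_partial_decay eta i : test_function eta -> exists2 C, 0 <= C &
  forall s x, 0 < s -> `|heat s (partial i eta) x| <= C / s ^+ n.+1.
Proof.
move=> te; pose W : R := 2 * (2 * expR 3 * Num.sqrt pi ^- n).
have W0 : 0 <= W by rewrite !mulr_ge0 ?expR_ge0// invr_ge0 exprn_ge0// sqrtr_ge0.
pose J := \int[lebesgue_rV R n]_z `|eta z|.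
have J0 : 0 <= J by exact: Rintegral_ge0.
exists (W * J / 2 ^+ n.+1); first by rewrite divr_ge0 ?exprn_ge0// mulr_ge0.
move=> s x s0; have s20 : 0 < 2 * s by rewrite mulr_gt0.
have := heat_parts s x i te => E.
have -> : heat s (partial i eta) x = (2 * s)^-1 * (2 * s * heat s (partial i eta) x).
  by rewrite mulKf// gt_eqF.
rewrite -E normrM (gtr0_norm (x := (2 * s)^-1)) ?invr_gt0//.
rewrite (_ : W * J / 2 ^+ n.+1 / s ^+ n.+1 = (2 * s)^-1 * (W * J / (2 * s) ^+ n)); last first.
  by rewrite [in RHS]mulrCA -invfM -exprS exprMn invfM mulrA.
rewrite ler_wpM2l ?invr_ge0 ?(ltW s20)//.
apply: weighted_decay => //.
- exact: measurable_gauss_coord.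
- exact: test_measurable.
- exact: test_integrable.
- by move=> z; exact: gauss_coord_bound.
Qed.

Lemma continuous_heat eta x : test_function eta -> continuous (fun s : R => heat s eta x).
Proof.
move=> te s; apply: differentiable_continuous; apply/derivable1_diffP.
by case: (is_derive_heat s x te).
Qed.

Definition oneDsqr_inv (s : R) : R := (1 + s ^+ 2)^-1.

Lemma oneDsqr_inv_ge0 s : 0 <= oneDsqr_inv s.
Proof. by rewrite invr_ge0 addr_ge0// sqr_ge0. Qed.

Lemma integral_halfline_oneDsqr_inv :
  (\int[leb R]_s (if (0 < s)%R then oneDsqr_inv s else 0)%:E = (pi / 2)%:E)%E.
Proof.
have := integral0y_oneDsqr R; rewrite -integral_itv_obnd_cbnd; last first.
  apply: measurable_funTS; apply/measurable_EFinP; rewrite /oneDsqr; apply: measurable_fun_inv.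
  by apply: measurable_funD => //; apply: measurable_funX.
rewrite (integral_halfline (fun s : R => ((oneDsqr s)^-1)%:E)) => <-.
by apply: eq_integral => s _; case: ifPn.
Qed.

Lemma integrable_oneDsqr_inv :
  (leb R).-integrable setT (fun s => (if 0 < s then oneDsqr_inv s else 0)%:E).
Proof.
apply: (ge0_integrable (fun s : measurableTypeR R => if 0 < s then oneDsqr_inv s else 0)).
- by rewrite /oneDsqr_inv; meas.
- by move=> s; case: ifP => // _; exact: oneDsqr_inv_ge0.
- by rewrite integral_halfline_oneDsqr_inv ltry.
Qed.

(** Boundedness is used for s at most 1 and decay beyond; [k.+2 <= l] leaves at least s^-2 at
    infinity. The function 1 / (1 + s^2) then dominates all moments in s. *)
Lemma decay_le_oneDsqr_inv (h : R -> R) (B C : R) k l : (k.+2 <= l)%N -> 0 <= B -> 0 <= C ->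
  (forall s, 0 < s -> `|h s| <= B) -> (forall s, 0 < s -> `|h s| <= C / s ^+ l) ->
  forall s, 0 < s -> `|s ^+ k * h s| <= 2 * (B + C) * oneDsqr_inv s.
Proof.
move=> kl B0 C0 hB hC s s0; have d0 : 0 < 1 + s ^+ 2 by rewrite ltr_pwDl// sqr_ge0.
rewrite /oneDsqr_inv ler_pdivlMr// normrM ger0_norm ?exprn_ge0 ?(ltW s0)//.
have [s1|s1] := leP s 1.
  apply: (@le_trans _ _ (1 * B * 2)); last by lra.
  apply: ler_pM => //; first by rewrite mulr_ge0// exprn_ge0// ltW.
  - by rewrite ltW.
  - by apply: ler_pM => //; [rewrite exprn_ge0// ltW|rewrite exprn_ile1// ltW|exact: hB].
  - by have : s ^+ 2 <= 1 by [rewrite exprn_ile1// ltW]; lra.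
apply: (@le_trans _ _ (s ^- 2 * C * (2 * s ^+ 2))); last first.
  rewrite (_ : s ^- 2 * C * _ = 2 * C); first by lra.
  by field; rewrite gt_eqF.
apply: ler_pM => //; first by rewrite mulr_ge0// exprn_ge0// ltW.
- by rewrite ltW.
- apply: le_trans (ler_wpM2l _ (hC s s0)) _; first by rewrite exprn_ge0// ltW.
  rewrite mulrCA [leLHS]mulrC ler_wpM2r//.
  rewrite [X in _ / X](_ : _ = s ^+ k * (s ^+ 2 * s ^+ (l - k.+2))); last first.
    by rewrite mulrA -!exprD addn2 subnKC.
  rewrite invfM mulrA mulfV ?expf_neq0 ?gt_eqF// mul1r invfM ler_piMr ?invr_ge0 ?exprn_ge0 ?(ltW s0)//.
  by rewrite invf_le1 ?exprn_gt0// exprn_ege1// ltW.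
- by have : 1 <= s ^+ 2 by [rewrite exprn_ege1// ltW]; lra.
Qed.
End heat_moment.

(** * Moments of the heat semigroup *)

Lemma cvg_pinfty0 (R : realType) (F : R -> R) (C : R) : 0 <= C ->
  (forall s, 1 < s -> `|F s| <= C / s) -> F s @[s --> +oo] --> 0.
Proof.
move=> C0 FC; apply/cvgrPdist_lt => e e0.
near=> s; have s1 : 1 < s by near: s; exact: nbhs_pinfty_gt.
have sC : C / e < s by near: s; apply: nbhs_pinfty_gt; exact: num_real.
rewrite sub0r normrN; apply: le_lt_trans (FC s s1) _.
by rewrite ltr_pdivrMr// mulrC -ltr_pdivrMr.
Unshelve. all: by end_near.
Qed.

(** For k = 0 this is the indicator of the positive half-line, used as a cut-off. *)
Definition halfline_pow (R : realType) (k : nat) (s : R) : R := if 0 < s then s ^+ k else 0.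

Lemma halfline_pow_ge0 (R : realType) k (s : R) : 0 <= halfline_pow k s.
Proof. by rewrite /halfline_pow; case: ifPn => // s0; rewrite exprn_ge0// ltW. Qed.

Lemma measurable_halfline_pow (R : realType) k : measurable_fun [set: measurableTypeR R] (@halfline_pow R k).
Proof. by rewrite /halfline_pow; meas. Qed.

Lemma is_derive_gauss (R : realType) (s : R) :
  is_derive s 1 (fun s : R => expR (- s ^+ 2)) (- 2 * (s * expR (- s ^+ 2))).
Proof.
have d1 : is_derive s 1 (fun s : R => - s ^+ 2) (- (2%:R * s ^+ 1)).
  exact: (is_deriveN (is_derive_exprn 2 s)).
have := is_derive1_comp (f := expR) (is_derive_expR _) d1; rewrite /comp => H.
by apply: is_derive_eq H _; rewrite expr1; ring.
Qed.

Lemma continuous_gauss (R : realType) : continuous (fun s : R => expR (- s ^+ 2)).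
Proof.
move=> s; apply: differentiable_continuous; apply/derivable1_diffP.
by case: (is_derive_gauss s).
Qed.

(** Integration by parts on s^(k+1) e^(-s^2). The factor is the one that appears in
    [heat_moment_neg_laplacian], so it disappears after normalization by [gauss_moment]. *)
Lemma gauss_moment_recursion (R : realType) k : gauss_moment R k.+2 = k.+1%:R / 2 * gauss_moment R k.
Proof.
pose F (s : R) := s ^+ k.+1 * expR (- s ^+ 2).
pose f (s : R) := k.+1%:R * (s ^+ k * expR (- s ^+ 2)) - 2 * (s ^+ k.+2 * expR (- s ^+ 2)).
have dF (s : R) : is_derive s 1 F (f s).
  have := is_deriveM (is_derive_exprn k.+1 s) (is_derive_gauss s).
  rewrite /F => H; apply: is_derive_eq H _.
  by rewrite /GRing.scale/= /f !exprS; ring.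
have cf : continuous f.
  have ce := @continuous_gauss R.
  by move=> s; apply: cvgB; (apply: cvgM; first exact: cvg_cst);
    (apply: cvgM; [exact: exprn_continuous|exact: ce]).
have E : (fun s : R => if 0 < s then f s else 0) = (fun s => k.+1%:R * (if 0 < s then s ^+ k * expR (- s ^+ 2) else 0) - 2 * (if 0 < s then s ^+ k.+2 * expR (- s ^+ 2) else 0)).
  by apply/funext => s; case: ifPn => // _; rewrite !mulr0 subrr.
have i1 j (c : R) : (leb R).-integrable setT (fun s => (c * (if 0 < s then s ^+ j * expR (- s ^+ 2) else 0))%:E).
  by under eq_fun do rewrite EFinM; apply: integrableZl => //; exact: integrable_gauss_moment.
have := @FTC_halfline R F f dF cf.
rewrite {2}/F expr0n mul0r oppr0 E => H.
have : \int[leb R]_s (k.+1%:R * (if 0 < s then s ^+ k * expR (- s ^+ 2) else 0) - 2 * (if 0 < s then s ^+ k.+2 * expR (- s ^+ 2) else 0)) = 0.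
  have E' : (fun x : R => (if 0 < x then f x else 0)%:E) = (fun s => (k.+1%:R * (if 0 < s then s ^+ k * expR (- s ^+ 2) else 0))%:E - (2 * (if 0 < s then s ^+ k.+2 * expR (- s ^+ 2) else 0))%:E)%E.
    by apply/funext => s; rewrite -EFinB -(congr1 (fun g => g s) E).
  apply: H; first by rewrite E'; apply: integrableB.
  apply: (@cvg_pinfty0 _ _ ((k.+2)`!%:R * expR 1)) => [|s s1]; first by rewrite mulr_ge0 ?expR_ge0.
  have s0 : 0 < s by apply: lt_trans s1.
  rewrite ler_pdivlMr// ger0_norm; last by rewrite /F mulr_ge0 ?expR_ge0 ?exprn_ge0// ltW.
  rewrite /F mulrC mulrA -exprS; apply: le_trans (exprn_gauss_le _ (ltW s0)) _.
  rewrite ler_piMr ?mulr_ge0 ?expR_ge0//.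
  by rewrite -[leRHS]expR0 ler_expR oppr_le0 sqr_ge0.
have Z j (c : R) : \int[leb R]_s (c * (if 0 < s then s ^+ j * expR (- s ^+ 2) else 0)) = c * gauss_moment R j.
  by rewrite RintegralZl//; exact: integrable_gauss_moment.
have -> : \int[leb R]_s (k.+1%:R * (if 0 < s then s ^+ k * expR (- s ^+ 2) else 0) - 2 * (if 0 < s then s ^+ k.+2 * expR (- s ^+ 2) else 0)) =
    k.+1%:R * gauss_moment R k - 2 * gauss_moment R k.+2.
  by rewrite -!Z; exact: (RintegralB measurableT (i1 k k.+1%:R) (i1 k.+2 2)).
move=> /eqP; rewrite subr_eq0 => /eqP E2.
by rewrite mulrAC E2; field.
Qed.

Lemma gauss_moment1 (R : realType) : gauss_moment R 1 = 2^-1.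
Proof.
pose F (s : R) := expR (- s ^+ 2); pose f (s : R) := - 2 * (s ^+ 1 * expR (- s ^+ 2)).
have dF (s : R) : is_derive s 1 F (f s).
  by rewrite /f expr1; exact: is_derive_gauss.
have cf : continuous f.
  have ce := @continuous_gauss R.
  move=> s; apply: cvgM; first exact: cvg_cst.
  by apply: cvgM; [exact: exprn_continuous|exact: ce].
have E : (fun s : R => if 0 < s then f s else 0) = (fun s => - 2 * (if 0 < s then s ^+ 1 * expR (- s ^+ 2) else 0)).
  by apply/funext => s; case: ifPn => // _; rewrite !mulr0.
have := @FTC_halfline R F f dF cf; rewrite {2}/F expr0n/= oppr0 expR0 E.
rewrite RintegralZl//; last exact: integrable_gauss_moment.
rewrite -/(gauss_moment R 1) => H; have : - 2 * gauss_moment R 1 = - 1; last by lra.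
apply: H.
  rewrite (_ : (fun s => _) = (fun s => (- 2)%:E * (if 0 < s then s ^+ 1 * expR (- s ^+ 2) else 0)%:E)%E).
    by apply: integrableZl => //; exact: integrable_gauss_moment.
  by apply/funext => s; rewrite -EFinM -(congr1 (fun g => g s) E).
apply: (@cvg_pinfty0 _ _ ((1)`!%:R * expR 1)) => [|s s1]; first by rewrite mulr_ge0 ?expR_ge0.
have s0 : 0 < s by apply: lt_trans s1.
rewrite ler_pdivlMr// ger0_norm ?expR_ge0// mulrC -{1}[s]expr1.
apply: le_trans (exprn_gauss_le _ (ltW s0)) _; rewrite ler_piMr ?mulr_ge0 ?expR_ge0//.
by rewrite -[leRHS]expR0 ler_expR oppr_le0 sqr_ge0.
Qed.

Section heat_moment.
Context (R : realType) (n : nat).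
Implicit Types (eta : 'rV[R]_n -> R) (x : 'rV[R]_n) (s : R).

Definition heat_moment k eta x : R := \int[leb R]_s (halfline_pow k s * heat s eta x).

Lemma integrable_halfline_decay (h : R -> R) (B C : R) k l :
  measurable_fun [set: measurableTypeR R] h -> (k.+2 <= l)%N -> 0 <= B -> 0 <= C ->
  (forall s, 0 < s -> `|h s| <= B) -> (forall s, 0 < s -> `|h s| <= C / s ^+ l) ->
  (leb R).-integrable setT (fun s => (halfline_pow k s * h s)%:E).
Proof.
move=> mh kl B0 C0 hB hC.
apply: (dominated_integrable_by (fun s : measurableTypeR R => halfline_pow k s * h s)
  (fun s => 2 * (B + C) * (if 0 < s then oneDsqr_inv s else 0))).
- by apply: measurable_funM => //; exact: measurable_halfline_pow.
- by under eq_fun do rewrite EFinM; apply: integrableZl => //; exact: integrable_oneDsqr_inv.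
- move=> s; rewrite /halfline_pow; case: ifPn => s0; last by rewrite mul0r normr0 mulr0.
  exact: (decay_le_oneDsqr_inv kl B0 C0 hB hC).
Qed.

(** By Tonelli the absolute integrand leads to [heat] of [|eta|], which need not be smooth. This is
    why [heat_decay] and [heat_le_bound] are stated for measurable functions rather than for test
    functions. *)
Lemma integrable_heat_prod eta x B k : (k.+2 <= n)%N -> 0 <= B ->
  measurable_fun [set: 'rV[R]_n] eta ->
  (lebesgue_rV R n).-integrable setT (fun z => (eta z)%:E) ->
  (forall z, `|eta z| <= B) ->
  (leb R \x lebesgue_rV R n)%E.-integrable setT
    (fun p => (halfline_pow k p.1 * (gauss_kernel p.2 * eta (x + (2 * p.1) *: p.2)))%:E).
Proof.
move=> kn B0 me ie HB.
pose aeta z := `|eta z|.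
have mae : measurable_fun [set: 'rV[R]_n] aeta by rewrite /aeta; meas.
have iae : (lebesgue_rV R n).-integrable setT (fun z => (aeta z)%:E) by exact: (integrable_norm ie).
have HaB z : `|aeta z| <= B by rewrite normr_id.
have [C C0 HC] := heat_decay mae iae.
have mw := @measurable_halfline_pow R k.
have mp : measurable_fun [set: measurableTypeR R * 'rV[R]_n] (fun p => halfline_pow k p.1 * (gauss_kernel p.2 * eta (x + (2 * p.1) *: p.2))).
  by rewrite /gauss_kernel; meas.
apply/integrableP; split; first exact/measurable_EFinP.
have mp' : measurable_fun [set: measurableTypeR R * 'rV[R]_n] (fun p => (`|halfline_pow k p.1 * (gauss_kernel p.2 * eta (x + (2 * p.1) *: p.2))|%:E)).
  by apply/measurable_EFinP; exact: measurableT_comp.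
rewrite (tonelli_prod (leb R) (lebesgue_rV R n) (fun s z => `|halfline_pow k s * (gauss_kernel z * eta (x + (2 * s) *: z))|%:E) mp')//.
apply: (@le_lt_trans _ _ (\int[leb R]_s ((2 * (B + C)) * (if 0 < s then oneDsqr_inv s else 0))%:E)%E); last first.
  have : (leb R).-integrable setT (fun s => ((2 * (B + C)) * (if 0 < s then oneDsqr_inv s else 0))%:E).
    by under eq_fun do rewrite EFinM; apply: integrableZl => //; exact: integrable_oneDsqr_inv.
  move=> /integrableP[_]; apply: le_lt_trans; apply: ge0_le_integral => //.
  - by move=> s _; rewrite lee_fin mulr_ge0// ?mulr_ge0 ?addr_ge0//; case: ifP => _ //; exact: oneDsqr_inv_ge0.
  - by rewrite /oneDsqr_inv; meas.
  - by apply: measurableT_comp => //; rewrite /oneDsqr_inv; meas.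
  - by move=> s _; rewrite lee_fin ler_norm.
apply: ge0_le_integral => //.
- by move=> s _; exact: integral_ge0.
- exact: (measurable_integral_r (lebesgue_rV R n) (fun s z => `|halfline_pow k s * (gauss_kernel z * eta (x + (2 * s) *: z))|%:E) mp').
- by rewrite /oneDsqr_inv; meas.
move=> s _; have ih := integrable_heat s x mae HaB.
have -> : (\int[lebesgue_rV R n]_z `|halfline_pow k s * (gauss_kernel z * eta (x + (2 * s) *: z))|%:E = (halfline_pow k s * heat s aeta x)%:E)%E.
  rewrite EFinM /heat /Rintegral fineK ?(integrable_fin_num _ ih)//.
  rewrite -ge0_integralZl//.
  - apply: eq_integral => z _; rewrite -EFinM normrM (ger0_norm (halfline_pow_ge0 k s)).
    by rewrite (normrM (gauss_kernel z)) (ger0_norm (gauss_kernel_ge0 z)).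
  - by have /integrableP[] := ih.
  - by move=> z _; rewrite lee_fin; apply: mulr_ge0; [exact: gauss_kernel_ge0|exact: normr_ge0].
  - by rewrite lee_fin halfline_pow_ge0.
rewrite lee_fin; apply: le_trans (ler_norm _) _.
rewrite /halfline_pow; case: ifPn => s0; last by rewrite mul0r normr0 mulr0.
apply: (decay_le_oneDsqr_inv kn B0 C0 (h := fun s => heat s aeta x)) => //.
  by move=> t _; exact: heat_le_bound.
by move=> t; exact: HC.
Qed.

Lemma integrable_heat_moment eta x k : (k.+2 <= n)%N -> test_function eta ->
  (leb R).-integrable setT (fun s => (halfline_pow k s * heat s eta x)%:E).
Proof.
move=> kn te; have [B B0 HB] := test_bounded te; have me := test_measurable te.
have [C C0 HC] := heat_decay me (test_integrable te).
apply: (@integrable_halfline_decay _ B C k n) => //.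
- by apply: continuous_measurable_fun; exact: continuous_heat.
- by move=> s _; exact: heat_le_bound.
- by move=> s; exact: HC.
Qed.

Lemma is_derive_heat_line eta s x i : test_function eta ->
  is_derive x (delta_mx 0 i) (heat s eta) (heat s (partial i eta) x).
Proof.
move=> te; have tp := test_partial i te; have [B B0 HB] := test_bounded tp.
have [B1 _ HB1] := test_bounded te.
apply: is_derive_line0; rewrite /heat.
have := @is_derive_integral R _ 'rV[R]_n (lebesgue_rV R n)
  (fun (t : R) (z : 'rV[R]_n) => gauss_kernel z * eta (x + t *: delta_mx 0 i + (2 * s) *: z))
  (fun (t : R) (z : 'rV[R]_n) => gauss_kernel z * partial i eta (x + t *: delta_mx 0 i + (2 * s) *: z))
  (fun z => B * gauss_kernel z) 0.
rewrite (_ : \int[_]_z _ = \int[lebesgue_rV R n]_z (gauss_kernel z * partial i eta (x + (2 * s) *: z))); last first.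
  by apply: eq_Rintegral => z _; rewrite scale0r addr0.
apply.
- by move=> t _; apply: integrable_heat HB1; exact: test_measurable.
- move=> t z _; rewrite (_ : (fun t : R => _) = (fun t : R => gauss_kernel z *: (eta (x + (2 * s) *: z + t *: delta_mx 0 i) : R))); last first.
    by apply/funext => u; rewrite addrAC.
  rewrite addrAC; apply: is_deriveZ; apply: is_derive_line; exact: test_derivable.
- by under eq_fun do rewrite EFinM; apply: integrableZl => //; exact: integrable_gauss_kernel.
- move=> t z _; rewrite (normrM (gauss_kernel z)) (ger0_norm (gauss_kernel_ge0 z)) mulrC.
  by rewrite ler_wpM2r ?gauss_kernel_ge0.
Qed.

Lemma is_derive_heat_moment eta k x i : (k.+2 <= n)%N -> test_function eta ->
  is_derive x (delta_mx 0 i) (heat_moment k eta) (heat_moment k (partial i eta) x).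
Proof.
move=> kn te; have tp := test_partial i te; have [B B0 HB] := test_bounded tp.
have [C C0 HC] := heat_decay (test_measurable tp) (test_integrable tp).
apply: is_derive_line0; rewrite /heat_moment.
have H : is_derive (0 : R) 1 (fun t : R => \int[leb R]_s (halfline_pow k s * heat s eta (x + t *: delta_mx 0 i)))
    (\int[leb R]_s (halfline_pow k s * heat s (partial i eta) (x + 0 *: delta_mx 0 i))); last first.
  by apply: is_derive_eq H _; apply: eq_Rintegral => s _; rewrite scale0r addr0.
apply: (@is_derive_integral R _ (measurableTypeR R) (leb R)
  (fun (t : R) (s : R) => halfline_pow k s * heat s eta (x + t *: delta_mx 0 i))
  (fun (t : R) (s : R) => halfline_pow k s * heat s (partial i eta) (x + t *: delta_mx 0 i))
  (fun s => 2 * (B + C) * (if 0 < s then oneDsqr_inv s else 0)) 0).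
- by move=> t _; exact: integrable_heat_moment.
- move=> t s _; apply: is_deriveZ; have [d <-] := is_derive_heat_line s (x + t *: delta_mx 0 i) i te.
  exact: is_derive_line.
- by under eq_fun do rewrite EFinM; apply: integrableZl => //; exact: integrable_oneDsqr_inv.
- move=> t s _; rewrite /halfline_pow; case: ifPn => s0; last by rewrite mul0r normr0 mulr0.
  apply: (decay_le_oneDsqr_inv kn B0 C0 (h := fun s => heat s (partial i eta) (x + t *: delta_mx 0 i))) => //.
    by move=> r _; apply: heat_le_bound => //; exact: test_measurable.
  by move=> r; exact: HC.
Qed.
End heat_moment.

Section mean_heat.
Context (R : realType) (n : nat).
Implicit Types (eta : 'rV[R]_n -> R) (x : 'rV[R]_n) (s : R).

Lemma heat_neg_laplacian eta s x : test_function eta ->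
  heat s (neg_laplacian eta) x = - \sum_i heat s (partial i (partial i eta)) x.
Proof.
move=> te; rewrite /heat.
have ig i : (lebesgue_rV R n).-integrable setT (fun z => (gauss_kernel z * partial i (partial i eta) (x + (2 * s) *: z))%:E).
  have t2 : test_function (partial i (partial i eta)) by do 2 apply: test_partial.
  have [B _ HB] := test_bounded t2.
  by apply: integrable_heat HB; exact: test_measurable.
rewrite -(Rintegral_sum _ ig) -[RHS]mulN1r -RintegralZl//; last exact: integrable_sum_EFin.
by apply: eq_Rintegral => z _; rewrite /neg_laplacian /laplacian mulN1r mulrN mulr_sumr.
Qed.

Lemma heat_neg_laplacian_decay eta : test_function eta -> exists2 C, 0 <= C &
  forall s x, 0 < s -> `|heat s (neg_laplacian eta) x| <= C / s ^+ n.+1.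
Proof.
move=> te.
have H i : exists C, 0 <= C /\ forall s x, 0 < s -> `|heat s (partial i (partial i eta)) x| <= C / s ^+ n.+1.
  by have [C C0 HC] := heat_partial_decay i (test_partial i te); exists C.
have [C HC] := choice H; exists (\sum_i C i); first by apply: sumr_ge0 => i _; exact: (HC i).1.
move=> s x s0; rewrite heat_neg_laplacian// normrN mulr_suml.
by apply: le_trans (ler_norm_sum _ _ _) _; apply: ler_sum => i _; exact: (HC i).2.
Qed.

Lemma integrable_heat_moment_neg_laplacian eta x k : (k.+1 <= n)%N -> test_function eta ->
  (leb R).-integrable setT (fun s => (halfline_pow k s * heat s (neg_laplacian eta) x)%:E).
Proof.
move=> kn te; have tl := test_neg_laplacian te.
have [B B0 HB] := test_bounded tl; have [C C0 HC] := heat_neg_laplacian_decay te.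
apply: (@integrable_halfline_decay _ _ B C k n.+1) => //.
- by apply: continuous_measurable_fun; exact: continuous_heat.
- by move=> s _; apply: heat_le_bound => //; exact: test_measurable.
- by move=> s; exact: HC.
Qed.

(** Both boundary terms vanish: at 0 because of the factor s^(k+1), at infinity because s^(k+1)
    times the decay s^-n is at most 1/s for s > 1. *)
Lemma heat_moment_neg_laplacian eta x k : (k.+3 <= n)%N -> test_function eta ->
  heat_moment k.+2 (neg_laplacian eta) x = k.+1%:R / 2 * heat_moment k eta x.
Proof.
move=> kn te; have tl := test_neg_laplacian te.
pose F s := s ^+ k.+1 * heat s eta x.
pose f s := k.+1%:R * (s ^+ k * heat s eta x) - 2 * (s ^+ k.+2 * heat s (neg_laplacian eta) x).
have dF s : is_derive s 1 F (f s).
  have := is_deriveM (is_derive_exprn k.+1 s) (is_derive_heat s x te).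
  rewrite /F => H; apply: is_derive_eq H _.
  by rewrite /GRing.scale/= /f !exprS; ring.
have cf : continuous f.
  by move=> s; apply: cvgB; (apply: cvgM; first exact: cvg_cst);
    (apply: cvgM; [exact: exprn_continuous|exact: continuous_heat]).
have i1 (c : R) : (leb R).-integrable setT (fun s => (c * (halfline_pow k s * heat s eta x))%:E).
  by under eq_fun do rewrite EFinM; apply: integrableZl => //; apply: integrable_heat_moment => //; exact: ltnW.
have i2 (c : R) : (leb R).-integrable setT (fun s => (c * (halfline_pow k.+2 s * heat s (neg_laplacian eta) x))%:E).
  by under eq_fun do rewrite EFinM; apply: integrableZl => //; exact: integrable_heat_moment_neg_laplacian.
have E (s : R) : (if 0 < s then f s else 0) = k.+1%:R * (halfline_pow k s * heat s eta x) - 2 * (halfline_pow k.+2 s * heat s (neg_laplacian eta) x).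
  by rewrite /halfline_pow; case: ifPn => // _; rewrite !mul0r !mulr0 subrr.
have : \int[leb R]_s (if 0 < s then f s else 0) = - F 0.
  apply: FTC_halfline => //.
    by under eq_fun do rewrite E EFinB; apply: integrableB.
  have [C C0 HC] := heat_decay (test_measurable te) (test_integrable te).
  apply: (cvg_pinfty0 C0) => s s1; have s0 : 0 < s by apply: lt_trans s1.
  rewrite /F normrM ger0_norm ?exprn_ge0 ?(ltW s0)//.
  apply: (@le_trans _ _ (s ^+ k.+1 * (C / s ^+ n))).
    by rewrite ler_wpM2l ?exprn_ge0 ?(ltW s0)//; exact: HC.
  rewrite mulrCA ler_wpM2l// ler_pdivrMr ?exprn_gt0// mulrC ler_pdivlMr// -exprSr.
  by rewrite ler_weXn2l ?(ltW s1)// ltnW.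
rewrite /F expr0n mul0r oppr0.
have -> : \int[leb R]_s (if 0 < s then f s else 0) = k.+1%:R * heat_moment k eta x - 2 * heat_moment k.+2 (neg_laplacian eta) x.
  rewrite /heat_moment -RintegralZl//; last by (apply: integrable_heat_moment => //; exact: ltnW).
  rewrite -RintegralZl//; last exact: integrable_heat_moment_neg_laplacian.
  rewrite -(RintegralB measurableT (i1 _) (i2 _)).
  by apply: eq_Rintegral => s _; exact: E.
move=> /eqP; rewrite subr_eq0 => /eqP E2.
by rewrite mulrAC E2; field.
Qed.

(** The terminal case: no power of s is left in the primitive, so the boundary term at s = 0 is
    [heat 0 eta x], that is [eta x]. *)
Lemma heat_moment1_neg_laplacian eta x : (2 <= n)%N -> test_function eta ->
  heat_moment 1 (neg_laplacian eta) x = 2^-1 * eta x.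
Proof.
move=> n2 te; have tl := test_neg_laplacian te.
pose F s := heat s eta x.
pose f s := - 2 * (s ^+ 1 * heat s (neg_laplacian eta) x).
have dF s : is_derive s 1 F (f s).
  have := is_derive_heat s x te => H; apply: is_derive_eq H _.
  by rewrite /f expr1; ring.
have cf : continuous f.
  by move=> s; apply: cvgM; [exact: cvg_cst|apply: cvgM; [exact: exprn_continuous|exact: continuous_heat]].
have i2 : (leb R).-integrable setT (fun s => (halfline_pow 1 s * heat s (neg_laplacian eta) x)%:E).
  exact: integrable_heat_moment_neg_laplacian.
have E (s : R) : (if 0 < s then f s else 0) = - 2 * (halfline_pow 1 s * heat s (neg_laplacian eta) x).
  by rewrite /halfline_pow; case: ifPn => // _; rewrite !mul0r !mulr0.
have : \int[leb R]_s (if 0 < s then f s else 0) = - F 0.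
  apply: FTC_halfline => //.
    by under eq_fun do rewrite E EFinM; apply: integrableZl.
  have [C C0 HC] := heat_decay (test_measurable te) (test_integrable te).
  apply: (cvg_pinfty0 C0) => s s1; have s0 : 0 < s by apply: lt_trans s1.
  apply: le_trans (HC s x s0) _; rewrite ler_wpM2l// lef_pV2 ?posrE ?exprn_gt0//.
  by rewrite -[leLHS]expr1 ler_weXn2l ?(ltW s1)// ltnW.
rewrite /F heat0.
have -> : \int[leb R]_s (if 0 < s then f s else 0) = - 2 * heat_moment 1 (neg_laplacian eta) x.
  rewrite /heat_moment -RintegralZl//.
  by apply: eq_Rintegral => s _; exact: E.
by lra.
Qed.

(* Normalized so that it represents (- Delta)^(- (k + 1) / 2) eta. *)
Definition mean_heat k eta x : R := heat_moment k eta x / gauss_moment R k.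

Lemma mean_heat_neg_laplacian eta k : (k.+3 <= n)%N -> test_function eta ->
  mean_heat k.+2 (neg_laplacian eta) = mean_heat k eta.
Proof.
move=> kn te; apply/funext => x; rewrite /mean_heat heat_moment_neg_laplacian// gauss_moment_recursion.
by field; rewrite addrC natr1 ?pnatr_eq0 gt_eqF// gauss_moment_gt0.
Qed.

Lemma mean_heat1_neg_laplacian eta : (2 <= n)%N -> test_function eta ->
  mean_heat 1 (neg_laplacian eta) = eta.
Proof.
move=> n2 te; apply/funext => x; rewrite /mean_heat heat_moment1_neg_laplacian// gauss_moment1.
by field.
Qed.

Lemma is_derive_mean_heat eta k x i : (k.+2 <= n)%N -> test_function eta ->
  is_derive x (delta_mx 0 i) (mean_heat k eta) (mean_heat k (partial i eta) x).
Proof.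
move=> kn te; have := is_deriveZ (gauss_moment R k)^-1 (is_derive_heat_moment x i kn te).
rewrite (_ : _ \*: _ = mean_heat k eta).
  by move=> H; apply: is_derive_eq H _; rewrite /mean_heat mulrC.
by apply/funext => y; rewrite /mean_heat mulrC.
Qed.

Lemma partial_mean_heat eta k i : (k.+2 <= n)%N -> test_function eta ->
  partial i (mean_heat k eta) = mean_heat k (partial i eta).
Proof. by move=> kn te; apply/funext => x; case: (is_derive_mean_heat x i kn te). Qed.

Lemma laplacian_exists_mean_heat eta k : (k.+2 <= n)%N -> test_function eta ->
  laplacian_exists (mean_heat k eta).
Proof.
move=> kn te x i; split; first by case: (is_derive_mean_heat x i kn te).
by rewrite partial_mean_heat//; case: (is_derive_mean_heat x i kn (test_partial i te)).
Qed.

Lemma neg_laplacian_mean_heat eta k : (k.+2 <= n)%N -> test_function eta ->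
  neg_laplacian (mean_heat k eta) = mean_heat k (neg_laplacian eta).
Proof.
move=> kn te; apply/funext => x; rewrite /neg_laplacian /laplacian.
under eq_bigr => i _ do rewrite (partial_mean_heat i kn te) (partial_mean_heat i kn (test_partial i te)).
rewrite -/(laplacian eta) -/(neg_laplacian eta) /mean_heat -mulr_suml -mulNr; congr (_ / _).
rewrite /heat_moment.
have ig i : (leb R).-integrable setT (fun s => (halfline_pow k s * heat s (partial i (partial i eta)) x)%:E).
  by apply: integrable_heat_moment => //; do 2 apply: test_partial.
rewrite -(Rintegral_sum _ ig) -[LHS]mulN1r -RintegralZl//; last exact: integrable_sum_EFin.
by apply: eq_Rintegral => s _; rewrite heat_neg_laplacian// mulN1r mulrN mulr_sumr.
Qed.

Lemma test_iter_neg_laplacian eta j : test_function eta ->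
  test_function (iter j (@neg_laplacian R n) eta).
Proof. by move=> te; elim: j => //= j IH; exact: test_neg_laplacian. Qed.

Lemma iter_neg_laplacian_mean_heat eta k j : (k.+2 <= n)%N -> test_function eta ->
  iter j (@neg_laplacian R n) (mean_heat k eta) = mean_heat k (iter j (@neg_laplacian R n) eta).
Proof.
move=> kn te; elim: j => //= j ->; apply: neg_laplacian_mean_heat => //.
exact: test_iter_neg_laplacian.
Qed.

Lemma mean_heat_iter_neg_laplacian eta k j : (k + j.*2 + 2 <= n)%N -> test_function eta ->
  mean_heat (k + j.*2) (iter j (@neg_laplacian R n) eta) = mean_heat k eta.
Proof.
move=> + te; elim: j => [|j IH] kn /=; first by rewrite addn0.
rewrite doubleS !addnS mean_heat_neg_laplacian.
- by apply: IH; move: kn; rewrite doubleS !addnS => /ltnW/ltnW.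
- by move: kn; rewrite doubleS !addnS addn0 => /ltnW.
- exact: test_iter_neg_laplacian.
Qed.
End mean_heat.

(** * Hyperplane integrals and hemispheres *)

Section plane_integrals.
Context (R : realType) (k : nat).
Implicit Types (eta : 'rV[R]_k.+2 -> R) (x : 'rV[R]_k.+2).
Let japanese (w : 'rV[R]_k.+1) : R := Num.sqrt (1 + 4 * dotp w w) ^- k.+1.

(** The integral over the hyperplane through [x] with normal (-2w, 1), taken against [dv]; its
    surface measure would be sqrt (1 + 4 |w|^2) dv. *)
Definition plane_integral eta x (w : 'rV[R]_k.+1) : R :=
  \int[lebesgue_rV R k.+1]_v eta (x + rVpair v (2 * dotp w v)).

Let X := ('rV[R]_k.+1 * 'rV[R]_k.+1)%type.
Let Y := (measurableTypeR R * 'rV[R]_k.+2)%type.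
Let mu : {measure set _ -> \bar R} := (lebesgue_rV R k.+1 \x lebesgue_rV R k.+1)%E.
Let nu : {measure set _ -> \bar R} := (leb R \x lebesgue_rV R k.+2)%E.
Let kx (p : X) : R := japanese p.1.
Let c : R := pi ^+ k.+1 / gauss_moment R k.
Let ly (q : Y) : R := c * (halfline_pow k q.1 * gauss_kernel q.2).
Let px (p : X) : 'rV[R]_k.+2 := rVpair p.2 (2 * dotp p.1 p.2).
Let qy (q : Y) : 'rV[R]_k.+2 := (2 * q.1) *: q.2.

Let c0 : 0 <= c.
Proof. by rewrite divr_ge0 ?exprn_ge0 ?pi_ge0// ltW// gauss_moment_gt0. Qed.

Let mkx : measurable_fun [set: X] kx.
Proof. by rewrite /kx /japanese; meas. Qed.

Let mly : measurable_fun [set: Y] ly.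
Proof. by rewrite /ly /halfline_pow /gauss_kernel; meas. Qed.

Let mpx : measurable_fun [set: X] px.
Proof. by rewrite /px; meas. Qed.

Let kx0 p : 0 <= kx p.
Proof. by rewrite invr_ge0 exprn_ge0// sqrtr_ge0. Qed.

Let ly0 q : 0 <= ly q.
Proof. by rewrite mulr_ge0// mulr_ge0 ?halfline_pow_ge0 ?gauss_kernel_ge0. Qed.

(** [ge0_integral_backprojection] restated over product spaces, the form from which it can be
    transferred to signed functions. *)
Let same (F : 'rV[R]_k.+2 -> \bar R) : measurable_fun [set: 'rV[R]_k.+2] F -> (forall z, 0 <= F z)%E ->
  (\int[mu]_p ((kx p)%:E * F (px p)) = \int[nu]_q ((ly q)%:E * F (qy q)))%E.
Proof.
move=> mF F0.
have m1 : measurable_fun [set: X] (fun p => (kx (p.1, p.2))%:E * F (px (p.1, p.2)))%E.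
  apply: (@emeasurable_funM _ _ _ _ (fun p : X => (kx (p.1, p.2))%:E) (fun p : X => F (px (p.1, p.2)))).
    by apply/measurable_EFinP; rewrite /kx/japanese/=; meas.
  by apply: (measurableT_comp mF); rewrite /px/=; meas.
have m2 : measurable_fun [set: Y] (fun q => (ly (q.1, q.2))%:E * F (qy (q.1, q.2)))%E.
  apply: (@emeasurable_funM _ _ _ _ (fun q : Y => (ly (q.1, q.2))%:E) (fun q : Y => F (qy (q.1, q.2)))).
    by apply/measurable_EFinP; rewrite /ly/halfline_pow/gauss_kernel/=; meas.
  by apply: (measurableT_comp mF); rewrite /qy/=; meas.
transitivity (\int[lebesgue_rV R k.+1]_w \int[lebesgue_rV R k.+1]_v ((kx (w, v))%:E * F (px (w, v))))%E.
  rewrite -(tonelli_prod (lebesgue_rV R k.+1) (lebesgue_rV R k.+1) (fun w v => (kx (w, v))%:E * F (px (w, v)))%E m1).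
    by apply: eq_integral => -[w v] _.
  by move=> w v; rewrite mule_ge0// lee_fin kx0.
transitivity (\int[leb R]_s \int[lebesgue_rV R k.+2]_z ((ly (s, z))%:E * F (qy (s, z))))%E; last first.
  rewrite -(tonelli_prod (leb R) (lebesgue_rV R k.+2) (fun s z => (ly (s, z))%:E * F (qy (s, z)))%E m2).
    by apply: eq_integral => -[s z] _.
  by move=> s z; rewrite mule_ge0// lee_fin ly0.
rewrite /kx/px/= ge0_integral_backprojection// -/c.
pose h (s : R) (z : 'rV[R]_k.+2) : \bar R := (((if (0 < s)%R then s ^+ k.+2 / s ^+ 2 else 0) * gauss_kernel z)%:E * F ((2 * s) *: z)%R)%E.
have mh : measurable_fun [set: measurableTypeR R * 'rV[R]_k.+2] (fun q => h q.1 q.2).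
  by rewrite /h/gauss_kernel; meas.
have h0 s z : (0 <= h s z)%E.
  rewrite mule_ge0// lee_fin mulr_ge0 ?gauss_kernel_ge0//; case: ifPn => // s0.
  by rewrite divr_ge0// exprn_ge0// ltW.
rewrite -ge0_integralZl//; last 2 first.
- exact: (measurable_integral_r (lebesgue_rV R k.+2) h mh h0).
- by move=> s _; apply: integral_ge0 => z _; exact: (h0 s z).
apply: eq_integral => s _; rewrite -ge0_integralZl//; last 2 first.
- by apply: (measurable_comp2 mh); meas.
- by move=> z _; exact: (h0 s z).
apply: eq_integral => z _; rewrite muleA -EFinM /ly/= /qy/=; congr (_%:E * _)%E.
congr (_ * (_ * _)); rewrite /halfline_pow; case: ifPn => // s0.
by rewrite -(addn2 k) exprD mulfK// expf_neq0// gt_eqF.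
Qed.

Section for_eta.
Variables (eta : 'rV[R]_k.+2 -> R) (x : 'rV[R]_k.+2).
Hypothesis te : test_function eta.
Let f (y : 'rV[R]_k.+2) : R := eta (x + y).

Let mf : measurable_fun [set: 'rV[R]_k.+2] f.
Proof.
apply: (measurableT_comp (test_measurable te)).
by apply: (@measurable_fun_rVadd _ _ _ _ (fun=> x) id); [exact: measurable_cst|exact: measurable_id].
Qed.

Let ip : nu.-integrable setT (fun p => (halfline_pow k p.1 * (gauss_kernel p.2 * eta (x + (2 * p.1) *: p.2)))%:E).
Proof.
have [B B0 HB] := test_bounded te.
by apply: (@integrable_heat_prod R k.+2 eta x B k) => //; [exact: test_measurable|exact: test_integrable].
Qed.

Let iq : nu.-integrable setT (fun q => (ly q * f (qy q))%:E).
Proof.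
rewrite (_ : (fun q => _) = (fun p => c%:E * (halfline_pow k p.1 * (gauss_kernel p.2 * eta (x + (2 * p.1) *: p.2)))%:E)%E).
  exact: integrableZl.
by apply/funext => q; rewrite -EFinM /ly /f /qy; congr EFin; ring.
Qed.

Let ip' : mu.-integrable setT (fun p => (japanese p.1 * eta (x + rVpair p.2 (2 * dotp p.1 p.2)))%:E).
Proof. exact: (transfer_integrable mkx mpx kx0 ly0 same mf iq). Qed.

Lemma integrable_plane w : (lebesgue_rV R k.+1).-integrable setT
  (fun v => (eta (x + rVpair v (2 * dotp w v)))%:E).
Proof.
have [K K0 HK] := test_gauss_le0 te; have me := test_measurable te.
apply: (dominated_integrable_by (fun v => eta (x + rVpair v (2 * dotp w v)))
  (* The Gaussian in k + 2 variables is at most the one in the first k + 1, times the normalization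
     of the omitted variable. *)
  (fun v => K * Num.sqrt pi ^- 1 * gauss_kernel (rVhead x + v))).
- by meas.
- under eq_fun do rewrite EFinM; apply: integrableZl => //.
  have := integrable_rV_affine (rVhead x) (oner_neq0 R) _ (integrable_gauss_kernel R k.+1).
  under eq_fun do rewrite scale1r addrC; apply.
  by apply: measurable_gauss_kernel; exact: measurable_id.
- move=> v; apply: le_trans (HK _) _; rewrite -mulrA ler_wpM2l// /gauss_kernel.
  rewrite expr1 mulrA -invfM -exprS ler_wpM2l ?invr_ge0 ?exprn_ge0 ?sqrtr_ge0// ler_expR lerN2.
  set y := x + _; have -> : rVhead x + v = rVhead y by apply/rowP => j; rewrite !mxE liftK.
  by rewrite -[in leRHS](rVpairK y) dotp_rVpair lerDl -expr2 sqr_ge0.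
Qed.

Lemma plane_integral_Rfubini w : \int[lebesgue_rV R k.+1]_v (japanese w * eta (x + rVpair v (2 * dotp w v))) = japanese w * plane_integral eta x w.
Proof. by rewrite /plane_integral RintegralZl//; exact: integrable_plane. Qed.

Lemma integrable_plane_integral :
  (lebesgue_rV R k.+1).-integrable setT (fun w => (japanese w * plane_integral eta x w)%:E).
Proof.
have := integrable_Rfubini (f := fun w v => japanese w * eta (x + rVpair v (2 * dotp w v))) ip'.
by under eq_fun do rewrite plane_integral_Rfubini.
Qed.

(** The factor pi^(1-n) in the definition of g cancels the pi^(k+1) of
    [ge0_integral_backprojection]; the remaining 1 / [gauss_moment R k] is the normalization of
    [mean_heat]. *)
Lemma Rintegral_plane_integral :
  pi ^- k.+1 * \int[lebesgue_rV R k.+1]_w (japanese w * plane_integral eta x w) = mean_heat k eta x.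
Proof.
have E1 := Rfubini (f := fun w v => japanese w * eta (x + rVpair v (2 * dotp w v))) ip'.
have E2 := Rfubini (f := fun (s : measurableTypeR R) z => halfline_pow k s * (gauss_kernel z * eta (x + (2 * s) *: z))) ip.
have : \int[mu]_p (kx p * f (px p)) = \int[nu]_q (ly q * f (qy q)) by exact: (transfer_Rintegral kx0 ly0 same).
have -> : \int[mu]_p (kx p * f (px p)) = \int[lebesgue_rV R k.+1]_w (japanese w * plane_integral eta x w).
  by apply: etrans E1 _; apply: eq_Rintegral => w _; exact: plane_integral_Rfubini.
have -> : \int[nu]_q (ly q * f (qy q)) = c * \int[nu]_q (halfline_pow k q.1 * (gauss_kernel q.2 * eta (x + (2 * q.1) *: q.2))).
  by rewrite -RintegralZl//; apply: eq_Rintegral => q _; rewrite /ly /f /qy; ring.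
rewrite E2 => ->; rewrite /mean_heat /heat_moment mulrA mulrC.
rewrite (_ : pi ^- k.+1 * c = (gauss_moment R k)^-1); last first.
  by rewrite /c mulKf// expf_neq0// gt_eqF// pi_gt0.
congr (_ * _); apply: eq_Rintegral => s _; rewrite /heat -RintegralZl//.
have [B _ HB] := test_bounded te; apply: integrable_heat HB; exact: test_measurable.
Qed.
End for_eta.
End plane_integrals.

Lemma dotpBB (R : realType) n (u v : 'rV[R]_n) :
  dotp (u - v) (u - v) = dotp u u - 2 * dotp u v + dotp v v.
Proof.
rewrite /dotp mulr_sumr -sumrB -big_split/=; apply: eq_bigr => i _.
by rewrite !mxE; ring.
Qed.

Lemma dotpC (R : realType) n (u v : 'rV[R]_n) : dotp u v = dotp v u.
Proof. by apply: eq_bigr => i _; rewrite mulrC. Qed.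

Lemma dotpDr (R : realType) n (w u v : 'rV[R]_n) : dotp w (u + v) = dotp w u + dotp w v.
Proof. by rewrite /dotp -big_split; apply: eq_bigr => i _; rewrite !mxE mulrDr. Qed.

Section hemisphere_integrals.
Context (R : realType) (k : nat).
Let m := k.+1.
Variable phi : 'rV[R]_m.+1 -> R.
Hypothesis phi_smooth : smooth_on (upper_half_space R m) phi.
Hypothesis phi_supp : compactly_supported_in (upper_half_space R m) phi.

Definition unfolded : 'rV[R]_m.+1 -> R := paraboloid_pullback (fun y => phi y * (rVlast y)^-1).

(** The last coordinates of the support form a compact set that does not contain 0, hence stay above
    some positive [d]. There the division by y_n is harmless. *)
Lemma tame_div_last : exists d M, 0 < d /\ tame d M (fun y => phi y * (rVlast y)^-1).
Proof.
have [cK KU] := phi_supp; set K := support_in _ _ in cK KU.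
have [M0 [_ HM]] := compact_bounded cK.
have cl : closed ((fun y : 'rV[R]_m.+1 => y 0 ord_max) @` K).
  apply: compact_closed; first exact: Rhausdorff.
  by apply: continuous_compact => //; apply: continuous_subspaceT => y; exact: coord_continuous.
have : nbhs (0 : R) (~` ((fun y : 'rV[R]_m.+1 => y 0 ord_max) @` K)).
  apply: open_nbhs_nbhs; split; first exact: closed_openC.
  by move=> [y Ky y0]; have := KU y Ky; rewrite /upper_half_space/= /rVlast y0 ltxx.
move=> /nbhs_ballP[d /= d0 Hd].
exists d, (M0 + 1); split=> //; split.
  apply/(smooth_onP _ _) => j; apply: CkM; first exact: open_upper_half_space.
    by move/smooth_onP : phi_smooth; exact.
  by apply: Ck_inv; [exact: open_upper_half_space|move=> y Uy; rewrite gt_eqF|apply: Ck_coord; exact: open_upper_half_space].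
move=> y Uy yn0.
have Ky : K y.
  apply: subset_closure; split => //=; apply: contra_neq yn0 => ->; exact: mul0r.
split; last by apply: HM => //; rewrite ltrDl.
rewrite leNgt; apply/negP => yd; apply: (Hd (rVlast y)); last by exists y.
by rewrite /ball/= sub0r normrN gtr0_norm.
Qed.

Lemma test_unfolded : test_function unfolded.
Proof.
have [d [M [d0 Ht]]] := tame_div_last; split; first exact: smooth_paraboloid_pullback d0 Ht.
(* On the support the coordinates of x' are at most [M], and x_n = [height2 x] + |x'|^2 is at most
   M^2 + m M^2. *)
exists (`|M| + M ^+ 2 + m%:R * M ^+ 2) => x; apply: contraTeq => x0.
move: x0; rewrite /unfolded /paraboloid_pullback; case: ifPn => [x0|_]; last by rewrite eqxx.
move=> /(Ht.2 _ (unfold_paraboloid_upper x0))[_ TM].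
have M0 : 0 <= M by apply: le_trans TM.
have hj j : `|rVhead x 0 j| <= M.
  apply: le_trans TM; apply: le_trans (norm_coord_le _ (lift ord_max j)).
  by rewrite /unfold_paraboloid [in leRHS]mxE liftK.
have hn : Num.sqrt (height2 x) <= M.
  apply: le_trans TM; apply: le_trans (norm_coord_le _ ord_max).
  by rewrite /unfold_paraboloid [in leRHS]mxE unlift_none ler_norm.
have M2 : height2 x <= M ^+ 2.
  by rewrite -(sqr_sqrtr (ltW x0)) lerXn2r ?nnegrE// sqrtr_ge0.
have hd : dotp (rVhead x) (rVhead x) <= m%:R * M ^+ 2.
  rewrite (_ : m%:R * _ = \sum_(i < m) M ^+ 2); last by rewrite sumr_const card_ord mulr_natl.
  apply: ler_sum => i _; rewrite -expr2 -[_ ^+ 2]real_normK ?num_real//.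
  by rewrite lerXn2r ?nnegrE.
have s0 := sqr_ge0 M; have d00 := dotp_ge0 (rVhead x); have mM : 0 <= m%:R * M ^+ 2 by rewrite mulr_ge0.
rewrite -leNgt; apply: norm_rV_le; first by rewrite !addr_ge0.
move=> i; case: (unliftP ord_max i) => [j ->|->].
  by have := hj j; rewrite mxE (ger0_norm M0); lra.
rewrite -/(rVlast x) ler_norml (ger0_norm M0); move: M2 x0; rewrite /height2.
by move=> M2 x0; apply/andP; split; lra.
Qed.

Lemma partial_hemisphere_height (x' : 'rV[R]_m) (r : R) (u : 'rV[R]_m) i :
  enorm (u - x') < r ->
  partial i (hemisphere_height x' r) u = - (u - x') 0 i / hemisphere_height x' r u.
Proof.
move=> ur; have r0 : 0 < r by apply: le_lt_trans ur; exact: enorm_ge0.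
have h0 : 0 < r ^+ 2 - dotp (u - x') (u - x').
  by rewrite -enorm_sq subr_gt0 ltrXn2r ?nnegrE ?enorm_ge0// ltW.
suff [_ <-] : is_derive u (delta_mx 0 i) (hemisphere_height x' r) (- (u - x') 0 i / hemisphere_height x' r u) by [].
apply: is_derive_line0.
pose g (t : R) := (r ^+ 2 - dotp (u - x') (u - x')) - (2 * (u - x') 0 i * t + t ^+ 2).
have E (t : R) : hemisphere_height x' r (u + t *: delta_mx 0 i) = Num.sqrt (g t).
  rewrite /hemisphere_height enorm_sq /g; congr Num.sqrt.
  transitivity (r ^+ 2 - (dotp (u - x') (u - x') + (2 * (u - x') 0 i * t + t ^+ 2))); last by ring.
  congr (_ - _).
  rewrite /dotp (bigD1 i)//= [in RHS](bigD1 i)//= !mxE !eqxx/=.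
  rewrite [X in _ + X](eq_bigr (fun j => (u - x') 0 j * (u - x') 0 j)); last first.
    by move=> j ji; rewrite !mxE (negPf ji) andbF mulr0 addr0.
  by ring.
rewrite (funext E : (fun t : R => _) = _).
have g00 : g 0 = r ^+ 2 - dotp (u - x') (u - x') by rewrite /g mulr0 expr0n/= addr0 subr0.
have dg : is_derive (0 : R) 1 g (- (2 * (u - x') 0 i)).
  rewrite /g; apply: is_derive_eq.
  by have A (a : R) : a *: (1 : R) = a by [exact: mulr1]; rewrite !A; ring.
have ds : is_derive (g 0) 1 (@Num.sqrt R) (2 * Num.sqrt (g 0))^-1.
  by apply: is_derive1_sqrt; rewrite g00.
have := is_derive1_comp ds dg; rewrite /comp => H; apply: is_derive_eq H _.
rewrite /hemisphere_height enorm_sq g00; field; rewrite gt_eqF// sqrtr_gt0//.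
Qed.

Lemma graph_domain_hemisphere (x' : 'rV[R]_m) (r : R) : 0 < r ->
  graph_domain (hemisphere x' r) (hemisphere_height x' r) = [set u | enorm (u - x') < r].
Proof.
move=> r0; apply/seteqP; split => u /=.
  by move=> /(hemisphere_graph _ _ r0)[]; rewrite rVpair_head.
by move=> ur; apply/(hemisphere_graph _ _ r0); rewrite rVpair_head rVpair_last.
Qed.

(** On the hemisphere |y|^2 = r^2 - |x'|^2 + 2 x' . y' is affine in y', so the unfolded hemisphere
    lies in a hyperplane. The surface density is r / y_n, and its 1 / y_n is the one built into
    [unfolded]. Outside the disc both sides vanish, as the hyperplane is then on or below the
    paraboloid. *)
Lemma hemisphere_integrandE (x' : 'rV[R]_m) (r : R) : 0 < r ->
  (fun u => (graph_integrand (hemisphere_height x' r) phi \_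
     (graph_domain (hemisphere x' r) (hemisphere_height x' r))) u) =
  (fun u => r * unfolded (rVpair 0 (r ^+ 2 - dotp x' x') + rVpair u (2 * dotp x' u))).
Proof.
move=> r0; apply/funext => u; rewrite graph_domain_hemisphere// patchE.
set y := rVpair 0 _ + _.
have hy : rVhead y = u by apply/rowP => j; rewrite !mxE liftK mxE add0r.
have ly : height2 y = r ^+ 2 - dotp (u - x') (u - x').
  rewrite /height2 hy /y /rVlast !mxE unlift_none dotpBB (dotpC x'); ring.
rewrite /unfolded /paraboloid_pullback ly.
have [ur|ur] := ltP (enorm (u - x')) r; last first.
  rewrite memNset/=; last by apply/negP; rewrite -leNgt.
  rewrite ltNge -enorm_sq subr_le0 lerXn2r ?nnegrE ?enorm_ge0 ?(ltW r0)//=.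
  by rewrite mulr0.
have h0 : 0 < r ^+ 2 - dotp (u - x') (u - x').
  by rewrite -enorm_sq subr_gt0 ltrXn2r ?nnegrE ?enorm_ge0// ltW.
rewrite mem_set//= h0 /unfold_paraboloid hy ly rVpair_last /graph_integrand.
have hE : hemisphere_height x' r u = Num.sqrt (r ^+ 2 - dotp (u - x') (u - x')).
  by rewrite /hemisphere_height enorm_sq.
under eq_bigr => i _ do rewrite (partial_hemisphere_height i ur).
rewrite hE; set q := r ^+ 2 - _.
have -> : 1 + \sum_i (- (u - x') 0 i / Num.sqrt q) ^+ 2 = r ^+ 2 / q.
  transitivity (1 + dotp (u - x') (u - x') / q).
    congr (_ + _); rewrite /dotp mulr_suml; apply: eq_bigr => i _.
    by rewrite expr_div_n sqrrN sqr_sqrtr ?(ltW h0)// expr2.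
  by rewrite /q; field; rewrite gt_eqF.
rewrite sqrtrM ?sqr_ge0// sqrtr_sqr gtr0_norm// sqrtrV ?(ltW h0)//.
by rewrite mulrCA mulrA mulrAC -mulrA.
Qed.

Lemma integrable_hemisphere (x' : 'rV[R]_m) (r : R) : 0 < r ->
  hemispherical_transform_exists phi x' r.
Proof.
move=> r0; rewrite /hemispherical_transform_exists.
have mD : measurable (graph_domain (hemisphere x' r) (hemisphere_height x' r)).
  rewrite graph_domain_hemisphere//.
  have mg : measurable_fun [set: 'rV[R]_m] (fun u => r - enorm (u - x')) by meas.
  have := mg measurableT _ (measurable_itv `]0, +oo[); rewrite setTI.
  rewrite (_ : _ @^-1` _ = [set u | enorm (u - x') < r])//.
  by apply/seteqP; split => u /=; rewrite in_itv/= andbT subr_gt0.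
rewrite integrable_mkcond//.
rewrite (_ : _ \_ _ = (fun u => (r * unfolded (rVpair 0 (r ^+ 2 - dotp x' x') + rVpair u (2 * dotp x' u)))%:E)).
  under eq_fun do rewrite EFinM; apply: integrableZl => //.
  exact: (integrable_plane (rVpair 0 (r ^+ 2 - dotp x' x')) test_unfolded).
rewrite restrict_EFin; apply/funext => u /=; congr EFin.
exact: (congr1 (fun f => f u) (hemisphere_integrandE x' r0)).
Qed.

Lemma hemispherical_transformE (x' : 'rV[R]_m) (r : R) : 0 < r ->
  hemispherical_transform phi x' r =
  r * plane_integral unfolded (rVpair 0 (r ^+ 2 - dotp x' x')) x'.
Proof.
move=> r0; rewrite /hemispherical_transform Rintegral_mkcond hemisphere_integrandE//.
by rewrite RintegralZl//; exact: integrable_plane test_unfolded _.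
Qed.

Lemma sqrt_powR_half (a : R) j : 0 <= a -> a `^ (j%:R / 2) = Num.sqrt a ^+ j.
Proof. by move=> a0; rewrite mulrC powRrM powR12_sqrt// powR_mulrn// sqrtr_ge0. Qed.

(** With r = sqrt X the factor r of [hemispherical_transformE] cancels X^(-1/2), and r^2 - |z|^2 =
    x_n - 2 z . x' makes the hyperplane pass through [x]; a translation by x' centres it there. For
    X <= 0 the hyperplane does not rise above the paraboloid and the plane integral is 0, in
    agreement with [pos_power]. *)
Lemma backprojection_integrandE (x : 'rV[R]_m.+1) (z : 'rV[R]_m) :
  backprojection_integrand (hemispherical_transform phi) x z =
  Num.sqrt (1 + 4 * dotp z z) ^- m * plane_integral unfolded x z.
Proof.
rewrite /backprojection_integrand enorm_sq; set X := _ - _ + _.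
rewrite sqrt_powR_half ?addr_ge0 ?mulr_ge0 ?dotp_ge0// mulrC; congr (_ * _).
have heightX v : height2 (x + rVpair v (2 * dotp z v)) = X - dotp (rVhead x + v - z) (rVhead x + v - z).
  have hy : rVhead (x + rVpair v (2 * dotp z v)) = rVhead x + v by apply/rowP => j; rewrite !mxE liftK.
  rewrite /height2 hy dotpBB {1}/rVlast !mxE unlift_none -/(rVlast x) /X (dotpC (rVhead x + v) z) (dotpDr z); ring.
rewrite /pos_power; case: ifPn => X0; last first.
  rewrite mul0r; transitivity (\int[lebesgue_rV R k.+1]_v (0 : R)).
    by rewrite Rintegral_cst// mul0r.
  apply: eq_Rintegral => v _; rewrite /unfolded /paraboloid_pullback heightX ltNge; case: ifPn => //.
  by rewrite -ltNge subr_gt0 => H; move: X0; rewrite (le_lt_trans _ H)// dotp_ge0.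
rewrite hemispherical_transformE ?sqrtr_gt0// sqr_sqrtr ?(ltW X0)//.
rewrite powRN powR12_sqrt ?(ltW X0)// mulrA mulVf ?mul1r; last by rewrite gt_eqF// sqrtr_gt0.
rewrite /plane_integral; set a := rVpair 0 _.
rewrite (Rintegral_rV_affine (rVhead x) (oner_neq0 R)); last 2 first.
- by have me := test_measurable test_unfolded; meas.
- exact: integrable_plane test_unfolded _.
rewrite normr1 expr1n mul1r; apply: eq_Rintegral => v _; congr unfolded.
rewrite scale1r /a (dotpDr z); apply/rowP => j; rewrite !mxE.
case: (unliftP ord_max j) => [l ->|->]; first by rewrite !mxE add0r addrC.
by rewrite /X -/(rVlast x); ring.
Qed.

Lemma backprojection_mean_heat :
  backprojection (hemispherical_transform phi) = mean_heat k unfolded.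
Proof.
apply/funext => x; rewrite -(Rintegral_plane_integral x test_unfolded) /backprojection.
by under eq_Rintegral do rewrite backprojection_integrandE.
Qed.

Lemma integrable_backprojection (x : 'rV[R]_m.+1) :
  (lebesgue_rV R m).-integrable setT (EFin \o backprojection_integrand (hemispherical_transform phi) x).
Proof.
have := integrable_plane_integral x test_unfolded.
by apply: eq_integrable => // z _ /=; rewrite backprojection_integrandE.
Qed.

Lemma Q1inv_unfolded (y : 'rV[R]_m.+1) : upper_half_space R m y -> phi y = Q1inv unfolded y.
Proof.
move=> y0; rewrite /Q1inv /unfolded /paraboloid_pullback.
set w := rVpair _ _.
have hw : height2 w = rVlast y ^+ 2 by rewrite /height2 rVpair_head rVpair_last enorm_sq addrK.
rewrite hw exprn_gt0// /unfold_paraboloid hw rVpair_last sqrtr_sqr gtr0_norm//.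
by rewrite rVpair_head rVpairK mulrCA mulfV ?mulr1// gt_eqF.
Qed.
End hemisphere_integrals.

(** * The singular integral *)

Section mean_heat_bounds.
Context (R : realType) (n : nat).
Implicit Types (eta : 'rV[R]_n -> R) (x : 'rV[R]_n) (s : R).

Lemma heat_moment_bounded eta k : (k.+2 <= n)%N -> test_function eta ->
  exists2 B, 0 <= B & forall x, `|heat_moment k eta x| <= B.
Proof.
move=> kn te; have [B B0 HB] := test_bounded te; have me := test_measurable te.
have [C C0 HC] := heat_decay me (test_integrable te).
have ib : (leb R).-integrable setT (fun s => (2 * (B + C) * (if 0 < s then oneDsqr_inv s else 0))%:E).
  by under eq_fun do rewrite EFinM; apply: integrableZl => //; exact: integrable_oneDsqr_inv.
exists (\int[leb R]_s (2 * (B + C) * (if 0 < s then oneDsqr_inv s else 0))).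
  apply: Rintegral_ge0 => s _; rewrite !mulr_ge0 ?addr_ge0//.
  by case: ifP => // _; exact: oneDsqr_inv_ge0.
move=> x; have ih := integrable_heat_moment x kn te.
apply: le_trans (le_normr_Rintegral measurableT ih) _; apply: le_Rintegral => //.
  exact: (integrable_norm ih).
move=> s _; rewrite /halfline_pow; case: ifPn => s0; last by rewrite mul0r normr0 mulr0.
apply: (decay_le_oneDsqr_inv kn B0 C0 (h := fun s => heat s eta x)) => //.
  by move=> t _; exact: heat_le_bound.
by move=> t; exact: HC.
Qed.

Lemma mean_heat_bounded eta k : (k.+2 <= n)%N -> test_function eta ->
  exists2 B, 0 <= B & forall x, `|mean_heat k eta x| <= B.
Proof.
move=> kn te; have [B B0 HB] := heat_moment_bounded kn te; have G0 := gauss_moment_gt0 R k.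
exists (B / gauss_moment R k); first by rewrite divr_ge0// ltW.
move=> x; rewrite /mean_heat normrM (gtr0_norm (x := (gauss_moment R k)^-1)) ?invr_gt0//.
by rewrite ler_wpM2r// invr_ge0 ltW.
Qed.

Lemma increment_le (f : 'rV[R]_n -> R) (B c : R) (x h : 'rV[R]_n) :
  (forall y i, derivable f y (delta_mx 0 i)) ->
  (forall y i, `|partial i f y| <= B) -> (forall i, `|h 0 i| <= c) ->
  `|f (x + h) - f x| <= n%:R * B * c.
Proof.
move=> df fB hc; have [xi [_ ->]] := @MVT_coordinates R n f x h (fun y i _ => df y i).
apply: le_trans (ler_norm_sum _ _ _) _.
rewrite -mulrA mulr_natl -[X in _ *+ X]card_ord -sumr_const; apply: ler_sum => i _.
by rewrite normrM mulrC ler_pM.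
Qed.

Lemma lipschitz_continuous_rV (f : 'rV[R]_n -> R) (C : R) : 0 <= C ->
  (forall x h, `|f (x + h) - f x| <= C * `|h|) -> continuous f.
Proof.
move=> C0 fC x.
have : forall e, 0 < e -> \forall y \near x, `|f x - f y| < e.
  move=> e e0; apply/nbhs_normP; exists (e / (C + 1)) => /=.
    by rewrite divr_gt0// ltr_wpDl.
  move=> y /= xy; have := fC x (y - x); rewrite (addrC x) subrK => h.
  rewrite distrC; apply: le_lt_trans h _; rewrite distrC in xy; apply: (@le_lt_trans _ _ ((C + 1) * `|y - x|)).
    by rewrite ler_wpM2r// lerDl.
  by rewrite mulrC -ltr_pdivlMr// ltr_wpDl.
by move/cvgrPdist_lt.
Qed.

Lemma mean_heat_partials_bounded eta k : (k.+2 <= n)%N -> test_function eta ->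
  exists2 B, 0 <= B & forall x i, `|partial i (mean_heat k eta) x| <= B.
Proof.
move=> kn te.
have H i : exists B, forall x, `|partial i (mean_heat k eta) x| <= B.
  by rewrite partial_mean_heat//; have [B _ HB] := mean_heat_bounded kn (test_partial i te); exists B.
have [B HB] := choice H; exists (\sum_i `|B i|); first exact: sumr_ge0.
move=> x i; apply: le_trans (HB i x) _; rewrite (bigD1 i)//=.
by apply: le_trans (ler_norm _) _; rewrite lerDl; exact: sumr_ge0.
Qed.

Lemma derivable_mean_heat eta k x i : (k.+2 <= n)%N -> test_function eta ->
  derivable (mean_heat k eta) x (delta_mx 0 i).
Proof. by move=> kn te; case: (is_derive_mean_heat x i kn te). Qed.

Lemma continuous_mean_heat eta k : (k.+2 <= n)%N -> test_function eta -> continuous (mean_heat k eta).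
Proof.
move=> kn te; have [B B0 HB] := mean_heat_partials_bounded kn te.
apply: (@lipschitz_continuous_rV _ (n%:R * B)) => [|x h]; first by rewrite mulr_ge0.
apply: increment_le => //; last exact: norm_coord_le.
by move=> y i; exact: derivable_mean_heat.
Qed.

(** For |z| >= 1 four times the bound of [f] suffices. For |z| < 1 the second difference is a first
    difference of [chi], whose partial derivatives are first differences of those of [f];
    [increment_le] applied twice yields |z|^2. *)
Lemma second_difference_le_gen (f : 'rV[R]_n -> R) (B B2 : R) x z :
  (forall y, `|f y| <= B) ->
  (forall y i, derivable f y (delta_mx 0 i)) ->
  (forall y i j, derivable (partial i f) y (delta_mx 0 j)) ->
  (forall y i j, `|partial j (partial i f) y| <= B2) -> 0 <= B2 ->
  `|2 * f x - f (x - z) - f (x + z)| <= (4 * B + n%:R * (n%:R * B2)) * Num.min 1 (dotp z z).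
Proof.
move=> HB df ddf HB2 B20; have B0 : 0 <= B by apply: le_trans (HB 0).
rewrite minEle; case: ifPn => _ /=.
  rewrite mulr1; apply: (@le_trans _ _ (4 * B)); last by rewrite lerDl !mulr_ge0.
  have key (a b c : R) : `|a| <= B -> `|b| <= B -> `|c| <= B -> `|2 * a - b - c| <= 4 * B.
    by rewrite !ler_norml => /andP[? ?] /andP[? ?] /andP[? ?]; apply/andP; split; lra.
  by apply: key; exact: HB.
apply: (@le_trans _ _ (n%:R * (n%:R * B2) * dotp z z)); last first.
  by rewrite ler_wpM2r ?dotp_ge0// lerDr mulr_ge0.
pose chi y := f y - f (y - z).
have dfz y i : is_derive y (delta_mx 0 i) (fun y => f (y - z)) (partial i f (y - z)).
  apply: is_derive_line0.
  rewrite (_ : (fun t : R => _) = (fun t : R => f ((y - z) + t *: delta_mx 0 i))); last first.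
    by apply/funext => t; rewrite addrAC.
  rewrite -{2}[y - z]addr0 -[X in partial i f (_ + X)](scale0r (delta_mx 0 i : 'rV[R]_n)).
  by apply: is_derive_line; rewrite scale0r addr0.
have dchi y i : is_derive y (delta_mx 0 i) chi (partial i f y - partial i f (y - z)).
  by apply: is_deriveB => //; exact/derivableP.
have zi i : `|z 0 i| <= enorm z by exact: norm_coord_enorm.
have chiB y i : `|partial i chi y| <= n%:R * B2 * enorm z.
  have [_ E] := dchi y i; rewrite /partial E.
  rewrite -{1}(subrK z y) [y - z + z]addrC [z + _]addrC.
  by apply: increment_le => // w j; exact: ddf.
have -> : 2 * f x - f (x - z) - f (x + z) = - (chi (x + z) - chi x).
  by rewrite /chi addrK; ring.
rewrite normrN; apply: le_trans (increment_le x _ chiB zi) _.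
  by move=> y i; case: (dchi y i).
by rewrite -!mulrA -expr2 enorm_sq.
Qed.

Lemma second_difference_le eta k : (k.+2 <= n)%N -> test_function eta ->
  exists2 C, 0 <= C & forall x z,
  `|2 * mean_heat k eta x - mean_heat k eta (x - z) - mean_heat k eta (x + z)| <= C * Num.min 1 (dotp z z).
Proof.
move=> kn te; have [B B0 HB] := mean_heat_bounded kn te.
have H i : exists B, forall x j, `|partial j (partial i (mean_heat k eta)) x| <= B.
  rewrite partial_mean_heat//.
  by have [B' _ HB'] := mean_heat_partials_bounded kn (test_partial i te); exists B'.
have [B1 HB1] := choice H; pose B2 := \sum_i `|B1 i|.
have B20 : 0 <= B2 by exact: sumr_ge0.
have HB2 x i j : `|partial j (partial i (mean_heat k eta)) x| <= B2.
  apply: le_trans (HB1 i x j) _; rewrite /B2 (bigD1 i)//=.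
  by apply: le_trans (ler_norm _) _; rewrite lerDl; exact: sumr_ge0.
exists (4 * B + n%:R * (n%:R * B2)) => [|x z]; first by rewrite addr_ge0// !mulr_ge0.
apply: second_difference_le_gen => // y i; first exact: derivable_mean_heat.
by move=> j; rewrite partial_mean_heat//; apply: derivable_mean_heat => //; exact: test_partial.
Qed.
End mean_heat_bounds.

Lemma uniform_cvg_at_right (R : realType) n (F : R -> 'rV[R]_n -> R) (S : 'rV[R]_n -> R) (C : R) : 0 <= C ->
  (forall e, 0 < e -> e <= 1 -> forall x, `|S x - F e x| <= C * e) ->
  {uniform, F e @[e --> 0^'+] --> S} /\ forall x, F e x @[e --> 0^'+] --> S x.
Proof.
move=> C0 H.
have H' (d : R) : 0 < d -> \forall e \near 0^'+, forall x, `|S x - F e x| < d.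
  move=> d0; near=> e.
  have e0 : 0 < e by near: e; exact: nbhs_right_gt.
  have e1 : e < 1 by near: e; apply: nbhs_right_lt.
  have ed : e < d / (C + 1) by near: e; apply: nbhs_right_lt; rewrite divr_gt0// ltr_wpDl.
  move=> x; apply: le_lt_trans (H e e0 (ltW e1) x) _.
  apply: (@le_lt_trans _ _ ((C + 1) * e)); first by rewrite ler_wpM2r ?lerDl// ltW.
  by rewrite mulrC -ltr_pdivlMr// ltr_wpDl.
split.
  rewrite uniform_nbhsT; apply/cvg_fct_entourageP => A.
  rewrite -entourage_from_ballE => -[d /= d0 dA].
  by apply: filterS (H' d d0) => e He x; apply: dA; exact: He.
move=> x; apply/cvgrPdist_lt => d d0; apply: filterS (H' d d0) => e; exact.
Unshelve. all: by end_near.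
Qed.

Lemma integrable_prod_mul (R : realType) d1 d2 (X : measurableType d1) (Y : measurableType d2)
    (m1 : {sigma_finite_measure set X -> \bar R}) (m2 : {sigma_finite_measure set Y -> \bar R})
    (a : X -> R) (b : Y -> R) : (forall x, 0 <= a x) -> (forall y, 0 <= b y) ->
  m1.-integrable setT (fun x => (a x)%:E) -> m2.-integrable setT (fun y => (b y)%:E) ->
  (m1 \x m2)%E.-integrable setT (fun p => (a p.1 * b p.2)%:E).
Proof.
move=> a0 b0 ia ib.
have ma : measurable_fun [set: X] a by have /integrableP[/measurable_EFinP] := ia.
have mb : measurable_fun [set: Y] b by have /integrableP[/measurable_EFinP] := ib.
have mab : measurable_fun [set: X * Y] (fun p => a p.1 * b p.2).
  by apply: measurable_funM; exact: measurableT_comp.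
apply: (ge0_integrable (fun p : X * Y => a p.1 * b p.2)) => //.
  by move=> p; exact: mulr_ge0.
have mabE : measurable_fun [set: X * Y] (fun p => (a p.1 * b p.2)%:E) by exact/measurable_EFinP.
rewrite (tonelli_prod m1 m2 (fun x y => (a x * b y)%:E) mabE); last first.
  by move=> x y; rewrite lee_fin mulr_ge0.
have E x : (\int[m2]_y (a x * b y)%:E = (\int[m2]_y b y)%:E * (a x)%:E)%E.
  rewrite muleC /Rintegral fineK; last exact: integrable_fin_num.
  rewrite -ge0_integralZl//; last 3 first.
  - by apply/measurable_EFinP.
  - by move=> y _; rewrite lee_fin.
  - by rewrite lee_fin.
under eq_integral do rewrite E.
rewrite ge0_integralZl//; last 3 first.
- exact/measurable_EFinP.
- by move=> x _; rewrite lee_fin.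
- by rewrite lee_fin; apply: Rintegral_ge0.
have := integrable_fin_num measurableT ia.
rewrite ge0_fin_numE; last by apply: integral_ge0 => x _; rewrite lee_fin.
move=> ioo; apply: lte_mul_pinfty => //.
by rewrite lee_fin; apply: Rintegral_ge0.
Qed.

(** * The kernel |z|^(-n-1) as a superposition of Gaussians *)

Section riesz.
Context (R : realType) (m : nat).
Let n := m.+1.

Let Y := (measurableTypeR R * 'rV[R]_n)%type.
Let mu : {measure set _ -> \bar R} := (leb R \x lebesgue_rV R n)%E.
(* This is [s ^- 2], written in the unreduced form of [ge0_integral_riesz]. *)
Definition inv_square_weight (s : R) : R := if 0 < s then s ^+ n / s ^+ n.+2 else 0.
(** The constant of [ge0_integral_riesz] for the kernel |z|^(-n-1). It simplifies to Gamma ((n+1)/2)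
    / pi^(n/2), which is sqrt pi times c_n. *)
Definition riesz_factor : R := 2 ^- n * Num.sqrt pi ^- n * (2 ^+ n.+1 * gauss_moment R n).
Let kx (p : Y) : R := inv_square_weight p.1 * gauss_kernel p.2.
Let px (p : Y) : 'rV[R]_n := (2 * p.1) *: p.2.
Let ly (y : 'rV[R]_n) : R := riesz_factor * enorm y ^- n.+1.

Lemma riesz_factor_gt0 : 0 < riesz_factor.
Proof.
have p0 : (0 : R) < Num.sqrt pi by rewrite sqrtr_gt0 pi_gt0.
by apply: mulr_gt0; apply: mulr_gt0; rewrite ?invr_gt0 ?exprn_gt0 ?gauss_moment_gt0.
Qed.

Lemma inv_square_weight_ge0 s : 0 <= inv_square_weight s.
Proof. by rewrite /inv_square_weight; case: ifPn => // s0; rewrite divr_ge0// exprn_ge0// ltW. Qed.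

Let mkx : measurable_fun [set: Y] kx.
Proof. by rewrite /kx /inv_square_weight /gauss_kernel; meas. Qed.

Let mpx : measurable_fun [set: Y] px.
Proof. by rewrite /px; meas. Qed.

Let mly : measurable_fun [set: 'rV[R]_n] ly.
Proof. by rewrite /ly; meas. Qed.

Let kx0 p : 0 <= kx p.
Proof. by rewrite mulr_ge0 ?inv_square_weight_ge0 ?gauss_kernel_ge0. Qed.

Let ly0 y : 0 <= ly y.
Proof. by rewrite mulr_ge0 ?(ltW riesz_factor_gt0)// invr_ge0 exprn_ge0// enorm_ge0. Qed.

Let same (F : 'rV[R]_n -> \bar R) : measurable_fun [set: 'rV[R]_n] F -> (forall z, 0 <= F z)%E ->
  (\int[lebesgue_rV R n]_y ((ly y)%:E * F (id y)) = \int[mu]_p ((kx p)%:E * F (px p)))%E.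
Proof.
move=> mF F0.
pose h (s : R) (z : 'rV[R]_n) := ((kx (s, z))%:E * F (px (s, z)))%E.
have mh : measurable_fun [set: Y] (fun p => h p.1 p.2).
  apply: (@emeasurable_funM _ _ _ _ (fun q : Y => (kx (q.1, q.2))%:E) (fun q : Y => F (px (q.1, q.2)))).
    by apply/measurable_EFinP; rewrite /kx/inv_square_weight/gauss_kernel/=; meas.
  by apply: (measurableT_comp mF); rewrite /px/=; meas.
transitivity (\int[leb R]_s \int[lebesgue_rV R n]_z h s z)%E; last first.
  rewrite -(tonelli_prod (leb R) (lebesgue_rV R n) h mh).
    by apply: eq_integral => -[s z] _.
  by move=> s z; rewrite mule_ge0// lee_fin kx0.
rewrite /h/kx/px/= /inv_square_weight (@ge0_integral_riesz R m n F)//.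
rewrite -ge0_integralZl//; last 3 first.
- by meas.
- by move=> y _; rewrite mule_ge0// lee_fin invr_ge0 exprn_ge0// enorm_ge0.
- by rewrite lee_fin ltW// riesz_factor_gt0.
by apply: eq_integral => y _; rewrite muleA -EFinM.
Qed.

(** The common dominating function: up to constants it bounds the symmetrized quotient everywhere,
    and the plain difference quotient away from the origin. *)
Definition riesz_cut (z : 'rV[R]_n) : R := Num.min 1 (dotp z z) / enorm z ^+ n.+1.

Lemma min1_ge0 (t : R) : 0 <= t -> 0 <= Num.min 1 t.
Proof. by move=> t0; rewrite le_min ler01. Qed.

Lemma riesz_cut_ge0 z : 0 <= riesz_cut z.
Proof. by rewrite divr_ge0 ?min1_ge0 ?dotp_ge0// exprn_ge0// enorm_ge0. Qed.

Lemma measurable_min1 : measurable_fun [set: 'rV[R]_n] (fun z : 'rV[R]_n => Num.min 1 (dotp z z)).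
Proof. by apply: measurable_minr; [exact: measurable_cst|meas]. Qed.

Lemma measurable_riesz_cut : measurable_fun [set: 'rV[R]_n] riesz_cut.
Proof. by have mm := measurable_min1; rewrite /riesz_cut; meas. Qed.

Lemma riesz_integrable (F : 'rV[R]_n -> R) : measurable_fun [set: 'rV[R]_n] F ->
  mu.-integrable setT (fun p => (inv_square_weight p.1 * (gauss_kernel p.2 * F ((2 * p.1) *: p.2)))%:E) ->
  (lebesgue_rV R n).-integrable setT (fun y => (F y / enorm y ^+ n.+1)%:E).
Proof.
move=> mF iF; have iF' : mu.-integrable setT (fun p => (kx p * F (px p))%:E).
  by under eq_fun do rewrite /kx -mulrA.
have := transfer_integrable mly (@measurable_id _ _ _) ly0 kx0 same mF iF'.
have c0 := riesz_factor_gt0 => H.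
rewrite (_ : (fun y => _) = (fun y => riesz_factor^-1%:E * (ly y * F (id y))%:E)%E).
  exact: integrableZl.
apply/funext => y; rewrite -EFinM /ly; congr EFin.
by rewrite -mulrA mulKf ?gt_eqF// mulrC.
Qed.

Lemma riesz_Rintegral (F : 'rV[R]_n -> R) : measurable_fun [set: 'rV[R]_n] F ->
  mu.-integrable setT (fun p => (inv_square_weight p.1 * (gauss_kernel p.2 * F ((2 * p.1) *: p.2)))%:E) ->
  riesz_factor * \int[lebesgue_rV R n]_y (F y / enorm y ^+ n.+1) =
  \int[leb R]_s \int[lebesgue_rV R n]_z (inv_square_weight s * (gauss_kernel z * F ((2 * s) *: z))).
Proof.
move=> mF iF; have iF' : mu.-integrable setT (fun p => (kx p * F (px p))%:E).
  by under eq_fun do rewrite /kx -mulrA.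
rewrite -RintegralZl//; last exact: riesz_integrable.
rewrite -(Rfubini (f := fun (s : measurableTypeR R) z => inv_square_weight s * (gauss_kernel z * F ((2 * s) *: z))) iF).
transitivity (\int[lebesgue_rV R n]_y (ly y * F (id y))).
  by apply: eq_Rintegral => y _; rewrite /ly mulrCA mulrC.
have := transfer_Rintegral ly0 kx0 same mF.
move=> ->; apply: eq_Rintegral => p _; by rewrite /kx mulrA.
Qed.

Lemma wide_gauss_dominates (z : 'rV[R]_n) :
  (1 + 4 * dotp z z) * gauss_kernel z <= 6 * Num.sqrt pi ^- n * wide_gauss z.
Proof.
rewrite /gauss_kernel mulrCA [leRHS]mulrAC [leRHS]mulrC ler_wpM2l ?invr_ge0 ?exprn_ge0 ?sqrtr_ge0//.
have q0 := dotp_ge0 z; set q := dotp z z in q0 *.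
rewrite /wide_gauss -/q (_ : - q = - ((1/2)^+2 * q) + - (3/4 * q)); last by field.
rewrite expRD mulrCA mulrC ler_wpM2r ?expR_ge0//.
rewrite expRN ler_pdivrMr ?expR_gt0//.
(* With e^(3q/4) >= 1 + 3q/4 the claim reduces to 1 + 4 q <= 6 + 9/2 q. *)
by have := expR_ge1Dx (3/4 * q); lra.
Qed.

Lemma inv_square_weightE s : 0 < s -> inv_square_weight s = s ^- 2.
Proof.
move=> s0; rewrite /inv_square_weight s0 -addn2 exprD invfM mulrA divff ?mul1r//.
by rewrite expf_neq0// gt_eqF.
Qed.

(** For s at most 1 the term 4 s^2 q of the minimum compensates s^-2, for larger s the term 1
    suffices. The bound is a product of a function of s and one of q, ready for
    [integrable_prod_mul]. *)
Lemma inv_square_weight_min s (q : R) : 0 <= q ->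
  inv_square_weight s * Num.min 1 (4 * s ^+ 2 * q) <= 2 * (1 + 4 * q) * (if 0 < s then oneDsqr_inv s else 0).
Proof.
move=> q0; have [s0|s0] := boolP (0 < s); last by rewrite /inv_square_weight (negPf s0) mul0r mulr0.
rewrite inv_square_weightE// /oneDsqr_inv.
have d0 : 0 < 1 + s ^+ 2 by rewrite ltr_pwDl// sqr_ge0.
have s20 : 0 < s ^+ 2 by rewrite exprn_gt0.
rewrite ler_pdivlMr// -(mulrA (s ^- 2)) [leLHS]mulrC ler_pdivrMr//.
move: (s ^+ 2) s20 d0 => t t0 d0.
have m0 : 0 <= Num.min 1 (4 * t * q) by rewrite min1_ge0// !mulr_ge0// ltW.
have [t1|t1] := leP t 1.
  apply: (@le_trans _ _ ((4 * t * q) * 2)).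
    by apply: ler_pM => //; [exact: ltW|rewrite ge_min lexx orbT|lra].
  by have : 0 <= t * q by [rewrite mulr_ge0// ltW]; nra.
apply: (@le_trans _ _ (1 * (2 * t))).
  by apply: ler_pM => //; [exact: ltW|rewrite ge_min lexx|lra].
by rewrite mul1r ler_wpM2r ?(ltW t0)//; lra.
Qed.

Lemma dominated_riesz (F : 'rV[R]_n -> R) (C : R) : 0 <= C -> measurable_fun [set: 'rV[R]_n] F ->
  (forall y, `|F y| <= C * Num.min 1 (dotp y y)) ->
  mu.-integrable setT (fun p => (inv_square_weight p.1 * (gauss_kernel p.2 * F ((2 * p.1) *: p.2)))%:E).
Proof.
move=> C0 mF FC.
have i1 : mu.-integrable setT (fun p => ((if 0 < p.1 then oneDsqr_inv p.1 else 0) * wide_gauss p.2)%:E).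
  apply: (integrable_prod_mul (a := fun s : measurableTypeR R => if 0 < s then oneDsqr_inv s else 0)
     (b := @wide_gauss R n) (m1 := leb R) (m2 := lebesgue_rV R n)).
  - by move=> s; case: ifP => // _; exact: oneDsqr_inv_ge0.
  - by move=> z; exact: expR_ge0.
  - exact: integrable_oneDsqr_inv.
  - exact: integrable_wide_gauss.
apply: (dominated_integrable_by (fun p : Y => inv_square_weight p.1 * (gauss_kernel p.2 * F ((2 * p.1) *: p.2)))
   (fun p => (C * (2 * (6 * Num.sqrt pi ^- n))) * ((if 0 < p.1 then oneDsqr_inv p.1 else 0) * wide_gauss p.2))).
- by rewrite /inv_square_weight /gauss_kernel; meas.
- by under eq_fun do rewrite EFinM; exact: integrableZl.
move=> [s z] /=; have q0 := dotp_ge0 z.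
rewrite (normrM (inv_square_weight s)) (ger0_norm (inv_square_weight_ge0 s)).
have := wide_gauss_dominates z; move: (gauss_kernel z) (gauss_kernel_ge0 z) => g g0 gw.
rewrite normrM (ger0_norm g0).
set a := if _ then _ else _; have a0 : 0 <= a by rewrite /a; case: ifP => // _; exact: oneDsqr_inv_ge0.
apply: (@le_trans _ _ (inv_square_weight s * (g * (C * Num.min 1 (dotp ((2 * s) *: z) ((2 * s) *: z)))))).
  by rewrite ler_wpM2l ?inv_square_weight_ge0// ler_wpM2l.
rewrite dotpZ (_ : (2 * s) ^+ 2 * _ = 4 * s ^+ 2 * dotp z z); last by ring.
rewrite (_ : inv_square_weight s * _ = C * (g * (inv_square_weight s * Num.min 1 (4 * s ^+ 2 * dotp z z)))); last by ring.
rewrite -!mulrA ler_wpM2l//.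
apply: (@le_trans _ _ (g * (2 * (1 + 4 * dotp z z) * a))).
  by apply: ler_wpM2l => //; have := inv_square_weight_min s q0; rewrite !mulrA.
rewrite (_ : g * _ = 2 * a * ((1 + 4 * dotp z z) * g)); last by ring.
rewrite [leRHS](_ : _ = 2 * a * (6 * Num.sqrt pi ^- n * wide_gauss z)); last by ring.
by rewrite ler_wpM2l ?mulr_ge0.
Qed.

(** Instead of polar coordinates in dimension n, the Gaussian superposition of |z|^(-n-1) reduces
    the question to a product of integrable functions of s and of z. *)
Lemma integrable_riesz_cut : (lebesgue_rV R n).-integrable setT (fun z => (riesz_cut z)%:E).
Proof.
apply: riesz_integrable; first exact: measurable_min1.
apply: (@dominated_riesz (fun z => Num.min 1 (dotp z z)) 1) => //; first exact: measurable_min1.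
by move=> y; rewrite mul1r ger0_norm// min1_ge0// dotp_ge0.
Qed.
End riesz.

(** * Symmetrization of the principal value *)

Section symmetrization.
Context (R : realType) (m : nat).
Let n := m.+1.
Variables (f : 'rV[R]_n -> R) (B C : R).
Hypotheses (mf : measurable_fun [set: 'rV[R]_n] f) (fB : forall x, `|f x| <= B) (C0 : 0 <= C)
  (fC : forall x z, `|2 * f x - f (x - z) - f (x + z)| <= C * Num.min 1 (dotp z z)).

(** The sum of the difference quotients at z and -z. Its second-order numerator makes it absolutely
    integrable, so the principal value becomes half of an ordinary integral. *)
Definition symmetric_quotient x (z : 'rV[R]_n) : R :=
  (2 * f x - f (x - z) - f (x + z)) / enorm z ^+ n.+1.

Definition symmetric_integral x : R := 2^-1 * \int[lebesgue_rV R n]_z symmetric_quotient x z.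

Let outside (eps : R) (h : 'rV[R]_n -> R) z : R := if 0 < enorm z - eps then h z else 0.

Lemma measurable_difference_quotient x :
  measurable_fun [set: 'rV[R]_n] (difference_quotient f x).
Proof. by rewrite /difference_quotient; meas. Qed.

Lemma measurable_enorm_gt (eps : R) : measurable [set z : 'rV[R]_n | eps < enorm z].
Proof.
have mg : measurable_fun [set: 'rV[R]_n] (fun u => enorm u - eps) by meas.
have := mg measurableT _ (measurable_itv `]0, +oo[); rewrite setTI.
rewrite (_ : _ @^-1` _ = [set u | eps < enorm u])//.
by apply/seteqP; split => u /=; rewrite in_itv/= andbT subr_gt0.
Qed.

Lemma outsideE (eps : R) (h : 'rV[R]_n -> R) : h \_ [set z | eps < enorm z] = outside eps h.
Proof.
apply/funext => z; rewrite patchE /outside subr_gt0.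
by have [ez|ez] := boolP (eps < enorm z); [rewrite mem_set|rewrite memNset//=; exact/negP].
Qed.

Lemma integrable_outside (eps : R) x : 0 < eps ->
  (lebesgue_rV R n).-integrable setT (fun z => (outside eps (difference_quotient f x) z)%:E).
Proof.
(* For |z| > eps the numerator of [riesz_cut] is at least min (1, eps^2), while the increment of [f]
   is at most 2 B. *)
move=> e0; pose K := 2 * B / Num.min 1 (eps ^+ 2).
have me0 : 0 < Num.min 1 (eps ^+ 2) by rewrite lt_min ltr01 exprn_gt0.
have B0 : 0 <= B by apply: le_trans (fB 0).
apply: (dominated_integrable_by (outside eps (difference_quotient f x)) (fun z => K * riesz_cut z)).
- by have mq := measurable_difference_quotient x; rewrite /outside; meas.
- by under eq_fun do rewrite EFinM; apply: integrableZl => //; exact: integrable_riesz_cut.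
move=> z; rewrite /outside subr_gt0; case: ifPn => ez; last first.
  by rewrite normr0 mulr_ge0 ?riesz_cut_ge0// divr_ge0 ?mulr_ge0// ltW.
have z0 : 0 < enorm z by apply: lt_trans ez.
rewrite /difference_quotient /riesz_cut normrM (ger0_norm (x := _^-1)) ?invr_ge0 ?exprn_ge0 ?(ltW z0)//.
rewrite mulrA ler_wpM2r ?invr_ge0 ?exprn_ge0 ?(ltW z0)//.
apply: (@le_trans _ _ (2 * B)).
  by apply: le_trans (ler_normB _ _) _; have := fB x; have := fB (x - z); lra.
rewrite /K -mulrA ler_peMr ?mulr_ge0// mulrC ler_pdivlMr// mul1r le_min !ge_min lexx/=.
by apply/orP; right; rewrite -enorm_sq lerXn2r ?nnegrE ?(ltW e0) ?(ltW z0)// ltW.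
Qed.

Lemma integrable_difference_quotient (eps : R) x : 0 < eps ->
  (lebesgue_rV R n).-integrable [set z | eps < enorm z] (EFin \o difference_quotient f x).
Proof.
move=> e0; rewrite integrable_mkcond; last exact: measurable_enorm_gt.
rewrite restrict_EFin outsideE; exact: integrable_outside.
Qed.

Lemma enormN (z : 'rV[R]_n) : enorm (- z) = enorm z.
Proof. by congr Num.sqrt; apply: eq_bigr => i _; rewrite !mxE mulrNN. Qed.

Lemma integrable_symmetric_quotient x :
  (lebesgue_rV R n).-integrable setT (fun z => (symmetric_quotient x z)%:E).
Proof.
apply: (dominated_integrable_by (symmetric_quotient x) (fun z => C * riesz_cut z)).
- have mx : measurable_fun [set: 'rV[R]_n] (fun z => f (x + z)).
    apply: (measurableT_comp mf).
    by apply: (@measurable_fun_rVadd _ _ _ _ (fun=> x) id); [exact: measurable_cst|exact: measurable_id].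
  by rewrite /symmetric_quotient; meas.
- by under eq_fun do rewrite EFinM; apply: integrableZl => //; exact: integrable_riesz_cut.
move=> z; rewrite /symmetric_quotient /riesz_cut normrM (ger0_norm (x := _^-1)) ?invr_ge0 ?exprn_ge0 ?enorm_ge0//.
by rewrite mulrA ler_wpM2r ?invr_ge0 ?exprn_ge0 ?enorm_ge0.
Qed.

Lemma truncated_integral_symmetric (eps : R) x : 0 < eps ->
  truncated_integral f eps x = 2^-1 * \int[lebesgue_rV R n]_z outside eps (symmetric_quotient x) z.
Proof.
move=> e0; rewrite /truncated_integral Rintegral_mkcond outsideE.
set q := outside eps (difference_quotient f x).
have iq : (lebesgue_rV R n).-integrable setT (fun z => (q z)%:E) by exact: integrable_outside.
have mq : measurable_fun [set: 'rV[R]_n] q by have /integrableP[/measurable_EFinP] := iq.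
have N0 : -1 != 0 :> R by rewrite oppr_eq0 oner_neq0.
have E : \int[lebesgue_rV R n]_z q z = \int[lebesgue_rV R n]_z q (-1 *: z + 0).
  by rewrite (Rintegral_rV_affine 0 N0)// normrN1 expr1n mul1r.
have iq' := integrable_rV_affine 0 N0 mq iq.
have -> : \int[lebesgue_rV R n]_z outside eps (symmetric_quotient x) z =
    \int[lebesgue_rV R n]_z q z + \int[lebesgue_rV R n]_z q (-1 *: z + 0).
  rewrite -RintegralD//; apply: eq_Rintegral => z _.
  rewrite addr0 scaleN1r /q /outside enormN; case: ifPn => _; last by rewrite addr0.
  by rewrite /symmetric_quotient /difference_quotient enormN opprK -mulrDl; congr (_ / _); ring.
by rewrite -E; field.
Qed.

(** On the unit ball [riesz_cut] is |z|^(1-n), so scaling by eps gives the factor eps^n eps^(1-n) =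
    eps. *)
Lemma Rintegral_riesz_cut_ball (eps : R) : 0 < eps -> eps <= 1 ->
  \int[lebesgue_rV R n]_z (if 0 < enorm z - eps then 0 else riesz_cut z) <=
  eps * \int[lebesgue_rV R n]_z riesz_cut z.
Proof.
move=> e0 e1; have ic := integrable_riesz_cut R m; have mc := @measurable_riesz_cut R m.
pose h (z : 'rV[R]_n) : R := if 0 < enorm z - eps then 0 else riesz_cut z.
have mh : measurable_fun [set: 'rV[R]_n] h by rewrite /h; meas.
have ih : (lebesgue_rV R n).-integrable setT (fun z => (h z)%:E).
  apply: (dominated_integrable_by h _ mh ic) => z; rewrite /h; case: ifP => _.
    by rewrite normr0 riesz_cut_ge0.
  by rewrite ger0_norm// riesz_cut_ge0.
have en0 : eps != 0 by rewrite gt_eqF.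
rewrite -/(\int[lebesgue_rV R n]_z h z) (Rintegral_rV_affine 0 en0 mh ih) gtr0_norm//.
have ih' := integrable_rV_affine 0 en0 mh ih.
have i1 : (lebesgue_rV R n).-integrable setT (fun z => (eps ^+ n * h (eps *: z + 0))%:E).
  by under eq_fun do rewrite EFinM; exact: integrableZl.
have i2 : (lebesgue_rV R n).-integrable setT (fun z => (eps * riesz_cut z)%:E).
  by under eq_fun do rewrite EFinM; exact: integrableZl.
rewrite -RintegralZl// -RintegralZl//; apply: le_Rintegral => // z _.
rewrite addr0 /h.
have ez : enorm (eps *: z) = eps * enorm z.
  by rewrite /enorm dotpZ sqrtrM ?sqr_ge0// sqrtr_sqr gtr0_norm.
rewrite ez (_ : eps * enorm z - eps = eps * (enorm z - 1)); last by ring.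
rewrite pmulr_rgt0// subr_gt0.
have [z1|z1] := ltP 1 (enorm z); first by rewrite mulr0 mulr_ge0 ?riesz_cut_ge0// ltW.
have d1 : dotp z z <= 1 by rewrite -enorm_sq exprn_ile1// enorm_ge0.
have q0 := dotp_ge0 z.
have ed1 : eps ^+ 2 * dotp z z <= 1.
  by rewrite -[leRHS]mulr1 ler_pM// ?sqr_ge0// exprn_ile1// ltW.
rewrite /riesz_cut dotpZ ez (min_idPr ed1) (min_idPr d1) exprMn.
have [->|z0] := eqVneq (enorm z) 0; first by rewrite expr0n/= mulr0 !invr0 !mulr0.
rewrite le_eqVlt; apply/orP; left; apply/eqP; rewrite !exprS.
by field; rewrite z0 en0 expf_neq0// expf_neq0.
Qed.

(** The error is half the integral of the symmetric quotient over the ball of radius eps. Its bound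
    does not involve [x], which is the source of the uniform convergence. *)
Lemma truncated_integral_error (eps : R) x : 0 < eps -> eps <= 1 ->
  `|symmetric_integral x - truncated_integral f eps x| <=
  (2^-1 * C * \int[lebesgue_rV R n]_z riesz_cut z) * eps.
Proof.
move=> e0 e1; rewrite truncated_integral_symmetric// /symmetric_integral -mulrBr.
have is_ := integrable_symmetric_quotient x.
have ms : measurable_fun [set: 'rV[R]_n] (symmetric_quotient x) by have /integrableP[/measurable_EFinP] := is_.
have io : (lebesgue_rV R n).-integrable setT (fun z => (outside eps (symmetric_quotient x) z)%:E).
  apply: (dominated_integrable_by (outside eps (symmetric_quotient x)) (fun z => `|symmetric_quotient x z|)).
  - by rewrite /outside; meas.
  - exact: (integrable_norm is_).
  - by move=> z; rewrite /outside; case: ifP => // _; rewrite normr0.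
rewrite -RintegralB// normrM ger0_norm ?invr_ge0// -!mulrA ler_wpM2l ?invr_ge0//.
have ib := integrableB measurableT is_ io.
apply: le_trans (le_normr_Rintegral measurableT ib) _.
have ic : (lebesgue_rV R n).-integrable setT (fun z => (if 0 < enorm z - eps then 0 else riesz_cut z)%:E).
  apply: (dominated_integrable_by (fun z : 'rV[R]_n => if 0 < enorm z - eps then 0 else riesz_cut z) _ _ (integrable_riesz_cut R m)).
    by have mc := @measurable_riesz_cut R m; meas.
  move=> z; case: ifP => _; first by rewrite normr0 riesz_cut_ge0.
  by rewrite ger0_norm// riesz_cut_ge0.
apply: (@le_trans _ _ (C * \int[lebesgue_rV R n]_z (if 0 < enorm z - eps then 0 else riesz_cut z))).
  have iC : (lebesgue_rV R n).-integrable setT (fun z => (C * (if 0 < enorm z - eps then 0 else riesz_cut z))%:E).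
    by under eq_fun do rewrite EFinM; exact: integrableZl.
  rewrite -RintegralZl//; apply: le_Rintegral => //.
  - exact: (integrable_norm ib).
  move=> z _; rewrite /outside; case: ifP => _; first by rewrite subrr normr0 mulr0.
  rewrite subr0 /symmetric_quotient /riesz_cut normrM (ger0_norm (x := _^-1)) ?invr_ge0 ?exprn_ge0 ?enorm_ge0//.
  by rewrite mulrA ler_wpM2r ?invr_ge0 ?exprn_ge0 ?enorm_ge0.
by rewrite ler_wpM2l// mulrC Rintegral_riesz_cut_ball.
Qed.

Lemma singular_integral_symmetric :
  singular_integral f = symmetric_integral /\
  {uniform, truncated_integral f eps @[eps --> 0^'+] --> singular_integral f}.
Proof.
have K0 : 0 <= 2^-1 * C * \int[lebesgue_rV R n]_z riesz_cut z.
  rewrite mulr_ge0 ?mulr_ge0 ?invr_ge0//; apply: Rintegral_ge0 => z _; exact: riesz_cut_ge0.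
have [H1 H2] := uniform_cvg_at_right K0 (fun e e0 e1 x => truncated_integral_error x e0 e1).
suff E : singular_integral f = symmetric_integral by rewrite E.
by apply/funext => x; rewrite /singular_integral; apply: cvg_lim => //; exact: H2.
Qed.
End symmetrization.

(** * Exchange of integrals and polar coordinates in a quadrant *)

Section more_fubini.
Context (R : realType) d1 d2 (X : measurableType d1) (Y : measurableType d2).
Variables (m1 : {sigma_finite_measure set X -> \bar R}) (m2 : {sigma_finite_measure set Y -> \bar R}).
Variable f : X -> Y -> R.

Lemma Rfubini_swap : (m1 \x m2)%E.-integrable setT (fun p => (f p.1 p.2)%:E) ->
  \int[m1]_x \int[m2]_y f x y = \int[m2]_y \int[m1]_x f x y.
Proof.
move=> intf; rewrite -(Rfubini intf).
have E := integral21_prod_meas1 intf.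
rewrite /Rintegral -E; congr fine.
have mR : measurable_fun [set: Y] (fun y => (fine (\int[m1]_x (f x y)%:E))%:E).
  by apply/measurable_EFinP; apply: measurableT_comp => //; exact: (measurable_fubini_G intf).
apply: ae_eq_integral => //.
- exact: (measurable_fubini_G intf).
- apply: filterS (ae_integrable2 intf) => y iy _.
  by rewrite fineK//; exact: (integrable_fin_num measurableT iy).
Qed.

Lemma measurable_Rintegral : measurable_fun [set: X * Y] (fun p => f p.1 p.2) ->
  measurable_fun [set: X] (fun x => \int[m2]_y f x y).
Proof.
move=> mf; rewrite /Rintegral; apply: measurableT_comp => //.
under eq_fun do rewrite integralE.
apply: emeasurable_funB.
- under eq_fun do under eq_integral do rewrite funeposE.
  apply: (measurable_integral_r m2 (fun x y => maxe (f x y)%:E 0)%E).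
    by apply: measurable_maxe; [exact/measurable_EFinP|exact: measurable_cst].
  by move=> x y; rewrite le_max lexx orbT.
- under eq_fun do under eq_integral do rewrite funenegE.
  apply: (measurable_integral_r m2 (fun x y => maxe (- (f x y)%:E) 0)%E).
    by apply: measurable_maxe; [apply: measurableT_comp => //; exact/measurable_EFinP|exact: measurable_cst].
  by move=> x y; rewrite le_max lexx orbT.
Qed.
End more_fubini.

Section polar.
Context (R : realType).
(** Two affine substitutions replace polar coordinates: s = q u, then p = sqrt (1 + u^2) q. Here u
    is the tangent of the angle, and the integral of 1 / (1 + u^2) over u > 0 gives the angle pi/2
    of the quadrant. *)
Lemma ge0_integral_polar (F : R -> \bar R) :
  measurable_fun [set: R] F -> (forall t, 0 <= F t)%E ->
  (\int[leb R]_q \int[leb R]_s ((halfline_pow 0 q * halfline_pow 0 s)%:E * F (Num.sqrt (q ^+ 2 + s ^+ 2))) =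
   \int[leb R]_p ((pi / 2 * halfline_pow 1 p)%:E * F p))%E.
Proof.
move=> mF F0.
pose h (q u : measurableTypeR R) : \bar R := ((halfline_pow 1 q * halfline_pow 0 u)%:E * F (Num.sqrt (1 + u ^+ 2) * q)%R)%E.
have mh : measurable_fun [set: measurableTypeR R * measurableTypeR R] (fun p => h p.1 p.2).
  by rewrite /h /halfline_pow; meas.
have h0 q u : (0 <= h q u)%E by rewrite mule_ge0// lee_fin mulr_ge0// halfline_pow_ge0.
transitivity (\int[leb R]_q \int[leb R]_u h q u)%E.
  apply: eq_integral => q _; have [q0|q0] := boolP (0 < q); last first.
    by rewrite !integral0_eq// => s _; rewrite /h {1}/halfline_pow (negPf q0) !mul0r mul0e.
  rewrite (ge0_integral_affine (c := q) 0) ?gt_eqF//; last 2 first.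
  - by rewrite /halfline_pow; meas.
  - by move=> s; rewrite mule_ge0// lee_fin mulr_ge0// halfline_pow_ge0.
  rewrite gtr0_norm// -ge0_integralZl//; last 3 first.
  - by rewrite /halfline_pow; meas.
  - by move=> s _; rewrite mule_ge0// lee_fin mulr_ge0// halfline_pow_ge0.
  - by rewrite lee_fin ltW.
  apply: eq_integral => u _; rewrite muleA -EFinM addr0 /h; congr (_%:E * F _)%E.
    by rewrite /halfline_pow q0 pmulr_rgt0// expr1 !expr0 mul1r.
  rewrite (_ : q ^+ 2 + _ = (1 + u ^+ 2) * q ^+ 2); last by ring.
  by rewrite sqrtrM ?addr_ge0 ?sqr_ge0// sqrtr_sqr gtr0_norm.
rewrite (tonelli_swap (leb R) (leb R) h mh h0).
have mF1 : measurable_fun [set: measurableTypeR R] (fun p => (halfline_pow 1 p)%:E * F p)%E.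
  by rewrite /halfline_pow; meas.
have F10 p : (0 <= (halfline_pow 1 p)%:E * F p)%E by rewrite mule_ge0// lee_fin halfline_pow_ge0.
transitivity (\int[leb R]_u ((if (0 < u)%R then oneDsqr_inv u else 0)%:E * \int[leb R]_p ((halfline_pow 1 p)%:E * F p)))%E.
  apply: eq_integral => u _; set c := Num.sqrt (1 + u ^+ 2).
  have u1 : 0 < 1 + u ^+ 2 by rewrite ltr_pwDl// sqr_ge0.
  have c0 : 0 < c by rewrite sqrtr_gt0.
  have [u0|u0] := boolP (0 < u); last first.
    by rewrite mul0e integral0_eq// => q _; rewrite /h {2}/halfline_pow (negPf u0) mulr0 mul0e.
  rewrite [in RHS](ge0_integral_affine (c := c) 0) ?gt_eqF//.
  rewrite gtr0_norm// muleA -EFinM -ge0_integralZl//; last 2 first.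
  - by rewrite /halfline_pow; meas.
  - by rewrite lee_fin mulr_ge0// ?oneDsqr_inv_ge0// ltW.
  apply: eq_integral => q _; rewrite addr0 muleA -EFinM /h; congr (_%:E * _)%E.
  rewrite /halfline_pow u0 expr0 mulr1 pmulr_rgt0// !expr1; case: ifPn => q0; last by rewrite mulr0.
  rewrite /oneDsqr_inv -(sqr_sqrtr (ltW u1)) -/c; field; rewrite gt_eqF//.
under eq_integral do rewrite muleC.
rewrite ge0_integralZl//; last 3 first.
- by rewrite /oneDsqr_inv; meas.
- by move=> u _; rewrite lee_fin; case: ifP => // _; exact: oneDsqr_inv_ge0.
- exact: integral_ge0.
rewrite integral_halfline_oneDsqr_inv muleC -ge0_integralZl//; last first.
  by rewrite lee_fin divr_ge0// pi_ge0.
by apply: eq_integral => p _; rewrite muleA -EFinM.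
Qed.

Let mu : {measure set _ -> \bar R} := (leb R \x leb R)%E.
Let kx (p : measurableTypeR R * measurableTypeR R) : R := halfline_pow 0 p.1 * halfline_pow 0 p.2.
Let px (p : measurableTypeR R * measurableTypeR R) : measurableTypeR R := Num.sqrt (p.1 ^+ 2 + p.2 ^+ 2).
Let ly (t : measurableTypeR R) : R := pi / 2 * halfline_pow 1 t.

Let mkx : measurable_fun [set: measurableTypeR R * measurableTypeR R] kx.
Proof. by rewrite /kx /halfline_pow; meas. Qed.
Let mpx : measurable_fun [set: measurableTypeR R * measurableTypeR R] px.
Proof. by rewrite /px; meas. Qed.
Let kx0 p : 0 <= kx p.
Proof. by rewrite mulr_ge0// halfline_pow_ge0. Qed.
Let ly0 t : 0 <= ly t.
Proof. by rewrite mulr_ge0 ?halfline_pow_ge0// divr_ge0// pi_ge0. Qed.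

Let same (F : measurableTypeR R -> \bar R) : measurable_fun [set: measurableTypeR R] F -> (forall z, 0 <= F z)%E ->
  (\int[mu]_p ((kx p)%:E * F (px p)) = \int[leb R]_t ((ly t)%:E * F (id t)))%E.
Proof.
move=> mF F0; pose h (q s : measurableTypeR R) := ((kx (q, s))%:E * F (px (q, s)))%E.
have mh : measurable_fun [set: measurableTypeR R * measurableTypeR R] (fun p => h p.1 p.2).
  apply: (@emeasurable_funM _ _ _ _ (fun q : measurableTypeR R * measurableTypeR R => (kx (q.1, q.2))%:E) (fun q : measurableTypeR R * measurableTypeR R => F (px (q.1, q.2)))).
    by apply/measurable_EFinP; rewrite /kx/halfline_pow/=; meas.
  by apply: (measurableT_comp mF); rewrite /px/=; meas.
transitivity (\int[leb R]_q \int[leb R]_s h q s)%E.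
  rewrite -(tonelli_prod (leb R) (leb R) h mh).
    by apply: eq_integral => -[s z] _.
  by move=> s z; rewrite mule_ge0// lee_fin kx0.
exact: ge0_integral_polar.
Qed.

Lemma integrable_polar (h : R -> R) : measurable_fun [set: measurableTypeR R] h ->
  (leb R).-integrable setT (fun t => (halfline_pow 1 t * h t)%:E) ->
  (leb R \x leb R)%E.-integrable setT (fun p => (halfline_pow 0 p.1 * halfline_pow 0 p.2 * h (Num.sqrt (p.1 ^+ 2 + p.2 ^+ 2)))%:E).
Proof.
move=> mh ih; apply: (transfer_integrable mkx mpx kx0 ly0 same mh).
rewrite (_ : (fun y => _) = (fun t => (pi / 2)%:E * (halfline_pow 1 t * h t)%:E)%E); first exact: integrableZl.
by apply/funext => t; rewrite -EFinM /ly mulrA.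
Qed.

Lemma Rintegral_polar (h : R -> R) : measurable_fun [set: measurableTypeR R] h ->
  (leb R).-integrable setT (fun t => (halfline_pow 1 t * h t)%:E) ->
  \int[leb R]_q \int[leb R]_s (halfline_pow 0 q * halfline_pow 0 s * h (Num.sqrt (q ^+ 2 + s ^+ 2))) =
  pi / 2 * \int[leb R]_t (halfline_pow 1 t * h t).
Proof.
move=> mh ih.
rewrite -(Rfubini (f := fun q s : measurableTypeR R => halfline_pow 0 q * halfline_pow 0 s * h (Num.sqrt (q ^+ 2 + s ^+ 2))) (integrable_polar mh ih)).
rewrite -RintegralZl//; under [RHS]eq_Rintegral do rewrite mulrA.
exact: (transfer_Rintegral kx0 ly0 same mh).
Qed.
End polar.

Lemma integral_inv_sqr_tail (R : realType) (q : R) : 0 < q ->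
  (\int[leb R]_s (if (0 < s - q)%R then s ^- 2 else 0)%:E = (q^-1)%:E)%E.
Proof.
move=> q0.
have H : (\int[leb R]_(s in [set` `[q, +oo[]) (s ^- 2)%:E = (0 : R)%:E - (- q^-1)%:E)%E.
  apply: (@ge0_continuous_FTC2y R (fun s => s ^- 2) (fun s => - s^-1) q 0).
  - by move=> s _; rewrite invr_ge0 sqr_ge0.
  - have cs : {in [set` `[q, +oo[], continuous (fun s : R => s ^- 2)}.
      move=> s /set_mem; rewrite /= in_itv/= andbT => qs.
      apply: cvgV; first by rewrite expf_neq0// gt_eqF// (lt_le_trans q0).
      exact: exprn_continuous.
    exact: continuous_in_subspaceT.
  - rewrite -oppr0; apply: cvgN; apply: (@cvg_pinfty0 _ _ 1) => // s s1.
    by rewrite div1r ger0_norm// invr_ge0 ltW// (lt_trans _ s1).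
  - by move=> s qs; apply: derivableN; apply: derivableV => //; rewrite gt_eqF// (lt_trans q0).
  - apply: cvg_at_right_filter; apply: cvgN; apply: cvgV; [by rewrite gt_eqF|exact: cvg_id].
  - move=> s; rewrite in_itv/= andbT => qs; have s0 : s != 0 by rewrite gt_eqF// (lt_trans q0).
    rewrite derive1E deriveN; last exact: derivableV.
    by rewrite deriveV// derive_id scaleNr opprK [LHS]mulr1.
rewrite -EFinB sub0r opprK in H; rewrite -H.
rewrite -integral_itv_obnd_cbnd; last first.
  apply: measurable_funTS; apply/measurable_EFinP; apply: measurable_fun_inv.
  by apply: measurable_funX.
rewrite [RHS]integral_mkcond; apply: eq_integral => s _; rewrite patchE subr_gt0.
have [qs|qs] := boolP (q < s); first by rewrite mem_set//= in_itv/= qs.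
by rewrite memNset//= in_itv/= andbT; exact/negP.
Qed.

(** * The semigroup law *)

Section heat_semigroup.
Context (R : realType) (n : nat).
Implicit Types (eta : 'rV[R]_n -> R) (x z : 'rV[R]_n) (s : R).

Lemma gauss_kernel_rotation (c d : R) x y : c ^+ 2 + d ^+ 2 = 1 ->
  gauss_kernel (c *: x - (- d) *: y) * gauss_kernel (- d *: x + c *: y) = gauss_kernel x * gauss_kernel y.
Proof.
move=> cd; rewrite /gauss_kernel mulrACA [RHS]mulrACA; congr (_ * _).
rewrite -!expRD; congr expR; rewrite -!opprD; congr (- _).
rewrite /dotp -!big_split/=; apply: eq_bigr => i _; rewrite !mxE.
transitivity ((c ^+ 2 + d ^+ 2) * (x 0 i * x 0 i + y 0 i * y 0 i)); last by rewrite cd mul1r.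
by ring.
Qed.

Let mu : {measure set _ -> \bar R} := (lebesgue_rV R n \x lebesgue_rV R n)%E.

(** The product of two Gaussians is invariant under the rotation that makes [c *: z + d *: w] the
    first variable; the second one then integrates to 1. *)
Lemma ge0_integral_gauss_convolution (c d : R) (F : 'rV[R]_n -> \bar R) :
  c ^+ 2 + d ^+ 2 = 1 -> c != -1 ->
  measurable_fun [set: 'rV[R]_n] F -> (forall z, 0 <= F z)%E ->
  (\int[lebesgue_rV R n]_z \int[lebesgue_rV R n]_w
     ((gauss_kernel z * gauss_kernel w)%:E * F (c *: z + d *: w)%R) =
   \int[lebesgue_rV R n]_u ((gauss_kernel u)%:E * F u))%E.
Proof.
move=> cd c1 mF F0.
pose G (x y : 'rV[R]_n) := ((gauss_kernel x * gauss_kernel y)%:E * F x)%E.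
have mG : measurable_fun [set: 'rV[R]_n * 'rV[R]_n] (fun p => G p.1 p.2).
  by rewrite /G /gauss_kernel; meas.
have G0 x y : (0 <= G x y)%E by rewrite mule_ge0// lee_fin mulr_ge0 ?gauss_kernel_ge0.
have GE x y : G x y = ((gauss_kernel x * gauss_kernel y)%:E * F x)%E by [].
clearbody G.
have cd' : c ^+ 2 + (- d) ^+ 2 = 1 by rewrite sqrrN.
have := ge0_integral_rotation_rV cd' c1 mG G0.
have -> : (\int[lebesgue_rV R n]_x \int[lebesgue_rV R n]_y G x y = \int[lebesgue_rV R n]_u ((gauss_kernel u)%:E * F u))%E.
  apply: eq_integral => z _.
  under eq_integral do rewrite GE EFinM muleAC.
  rewrite ge0_integralZl//; last 3 first.
  - by apply/measurable_EFinP; apply: measurable_gauss_kernel; exact: measurable_id.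
  - by move=> w _; rewrite lee_fin gauss_kernel_ge0.
  - by rewrite mule_ge0// lee_fin gauss_kernel_ge0.
  by rewrite integral_gauss_kernel mule1.
move=> ->; apply: eq_integral => z _; apply: eq_integral => w _.
rewrite GE [in RHS](gauss_kernel_rotation z w cd).
by have -> : c *: z - - d *: w = c *: z + d *: w by rewrite scaleNr opprK.
Qed.

(** With p = sqrt (s^2 + t^2), the total displacement 2 s z + 2 t w is 2 p (c z + d w) for c = s/p
    and d = t/p, a point of the unit circle. *)
Lemma heat_comp eta (s t : R) x : 0 < s -> test_function eta ->
  heat s (heat t eta) x = heat (Num.sqrt (s ^+ 2 + t ^+ 2)) eta x.
Proof.
move=> s0 te; have [B B0 HB] := test_bounded te; have me := test_measurable te.
pose p := Num.sqrt (s ^+ 2 + t ^+ 2).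
have p20 : 0 < s ^+ 2 + t ^+ 2 by rewrite ltr_pwDl ?exprn_gt0// sqr_ge0.
have p0 : 0 < p by rewrite sqrtr_gt0.
have pp : p ^+ 2 = s ^+ 2 + t ^+ 2 by rewrite sqr_sqrtr// ltW.
have cd : (s / p) ^+ 2 + (t / p) ^+ 2 = 1.
  by rewrite !expr_div_n -mulrDl -pp divff// expf_neq0// gt_eqF.
have c1 : s / p != -1 by rewrite gt_eqF// (@lt_trans _ _ 0) ?divr_gt0// oppr_lt0.
pose kx (q : 'rV[R]_n * 'rV[R]_n) : R := gauss_kernel q.1 * gauss_kernel q.2.
pose px (q : 'rV[R]_n * 'rV[R]_n) : 'rV[R]_n := (s / p) *: q.1 + (t / p) *: q.2.
have mkx : measurable_fun [set: 'rV[R]_n * 'rV[R]_n] kx by rewrite /kx /gauss_kernel; meas.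
have mpx : measurable_fun [set: 'rV[R]_n * 'rV[R]_n] px by rewrite /px; meas.
have kx0 q : 0 <= kx q by rewrite mulr_ge0 ?gauss_kernel_ge0.
have same (F : 'rV[R]_n -> \bar R) : measurable_fun [set: 'rV[R]_n] F -> (forall z, 0 <= F z)%E ->
  (\int[mu]_q ((kx q)%:E * F (px q)) = \int[lebesgue_rV R n]_y ((gauss_kernel y)%:E * F (id y)))%E.
  move=> mF F0; rewrite -(ge0_integral_gauss_convolution cd c1 mF F0).
  pose h (z w : 'rV[R]_n) := ((kx (z, w))%:E * F (px (z, w)))%E.
  have mh : measurable_fun [set: 'rV[R]_n * 'rV[R]_n] (fun q => h q.1 q.2).
    apply: (@emeasurable_funM _ _ _ _ (fun q : 'rV[R]_n * 'rV[R]_n => (kx (q.1, q.2))%:E) (fun q : 'rV[R]_n * 'rV[R]_n => F (px (q.1, q.2)))).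
      by apply/measurable_EFinP; rewrite /kx/gauss_kernel/=; meas.
    by apply: (measurableT_comp mF); rewrite /px/=; meas.
  rewrite -(tonelli_prod (lebesgue_rV R n) (lebesgue_rV R n) h mh).
    by apply: eq_integral => -[z w] _.
  by move=> z w; rewrite mule_ge0// lee_fin kx0.
pose f u := eta (x + (2 * p) *: u).
have mf : measurable_fun [set: 'rV[R]_n] f by rewrite /f; meas.
have iheat : (lebesgue_rV R n).-integrable setT (fun y => (gauss_kernel y * f (id y))%:E).
  exact: integrable_heat HB.
have gk0 := @gauss_kernel_ge0 R n.
have E := transfer_Rintegral kx0 gk0 same mf.
have I := transfer_integrable mkx mpx kx0 gk0 same mf iheat.
rewrite [RHS]/heat -/p -E.
rewrite [RHS](Rfubini (f := fun z w => kx (z, w) * f (px (z, w))) I) /heat.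
apply: eq_Rintegral => z _; rewrite -RintegralZl//; last exact: integrable_heat HB.
apply: eq_Rintegral => w _; rewrite /kx /f /px/= mulrA; congr (_ * eta _).
rewrite scalerDr !scalerA -addrA; congr (_ + (_ *: _ + _ *: _)); by field; rewrite gt_eqF.
Qed.

Lemma measurable_heat_joint d (T : measurableType d) eta (s : T -> R) (x : T -> 'rV[R]_n) :
  measurable_fun [set: 'rV[R]_n] eta -> measurable_fun [set: T] s -> measurable_fun [set: T] x ->
  measurable_fun [set: T] (fun t => heat (s t) eta (x t)).
Proof.
move=> me ms mx; rewrite /heat.
apply: (measurable_Rintegral (lebesgue_rV R n) (f := fun t z => gauss_kernel z * eta (x t + (2 * s t) *: z))).
by rewrite /gauss_kernel; meas.
Qed.

Lemma heatN eta s x : measurable_fun [set: 'rV[R]_n] eta -> (exists B, forall z, `|eta z| <= B) ->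
  heat (- s) eta x = heat s eta x.
Proof.
move=> me [B HB]; rewrite [LHS]/heat (Rintegral_rV_affine 0 (c := -1)); last 3 first.
- by rewrite oppr_eq0 oner_neq0.
- by rewrite /gauss_kernel; meas.
- exact: integrable_heat HB.
rewrite normrN1 expr1n mul1r /heat; apply: eq_Rintegral => z _.
rewrite addr0 scaleN1r; congr (_ * eta (_ + _)); last by rewrite mulrN scaleNr scalerN opprK.
rewrite /gauss_kernel; congr (_ * expR (- _)); apply: eq_bigr => i _; by rewrite !mxE mulrNN.
Qed.
End heat_semigroup.

(** * An Abel-type integral *)

Section abel.
Context (R : realType).
Variables (D b : R -> R) (B C : R) (l : nat).
Hypotheses (cb : continuous b) (B0 : 0 <= B) (C0 : 0 <= C) (l3 : (3 <= l)%N)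
  (bB : forall p, `|b p| <= B) (bC : forall p, 0 < p -> `|b p| <= C / p ^+ l)
  (dD : forall p : R, is_derive p 1 D (- (2 * p) * b p)).

Let H (q s : R) : R := halfline_pow 0 q * halfline_pow 0 s * b (Num.sqrt (q ^+ 2 + s ^+ 2)).
Let A (q : R) : R := \int[leb R]_s H q s.
(** The lower cut-off 0 < q is supplied by the factor [halfline_pow 0 q] of [H] (or of [A]). *)
Let K (s q : R) : R := if 0 < s - q then 2 * q else 0.

Let mb : measurable_fun [set: measurableTypeR R] b.
Proof. exact: continuous_measurable_fun. Qed.

Let mH : measurable_fun [set: measurableTypeR R * measurableTypeR R] (fun p => H p.1 p.2).
Proof. by rewrite /H /halfline_pow; meas. Qed.

Let ib : (leb R).-integrable setT (fun t => (halfline_pow 1 t * b t)%:E).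
Proof. exact: (@integrable_halfline_decay _ b B C 1 l). Qed.

Let iH : (leb R \x leb R)%E.-integrable setT (fun p => (H p.1 p.2)%:E).
Proof. exact: integrable_polar. Qed.

Let iHq q : (leb R).-integrable setT (fun s => (H q s)%:E).
Proof.
have : (leb R).-integrable setT (fun s => (halfline_pow 0 s * b (Num.sqrt (q ^+ 2 + s ^+ 2)))%:E).
  apply: (@integrable_halfline_decay _ (fun s => b (Num.sqrt (q ^+ 2 + s ^+ 2))) B C 0 l) => //.
  - by meas.
  - by apply: ltnW.
  - move=> s s0; have sp : s <= Num.sqrt (q ^+ 2 + s ^+ 2).
      by rewrite -[leLHS]gtr0_norm// -sqrtr_sqr ler_wsqrtr// lerDr sqr_ge0.
    have p0 : 0 < Num.sqrt (q ^+ 2 + s ^+ 2) by apply: lt_le_trans sp.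
    apply: le_trans (bC p0) _; rewrite ler_wpM2l// lef_pV2 ?posrE ?exprn_gt0//.
    by rewrite lerXn2r ?nnegrE ?(ltW s0) ?(ltW p0).
move=> i; rewrite (_ : (fun s => _) = (fun s => ((halfline_pow 0 q)%:E * (halfline_pow 0 s * b (Num.sqrt (q ^+ 2 + s ^+ 2)))%:E))%E).
  exact: integrableZl.
by apply/funext => s; rewrite -EFinM mulrA.
Qed.

Let A_nonpos q : ~~ (0 < q) -> A q = 0.
Proof.
move=> q0; rewrite /A; transitivity (\int[leb R]_s (0 : R)).
  by apply: eq_Rintegral => s _; rewrite /H {1}/halfline_pow (negPf q0) !mul0r.
by rewrite Rintegral_cst// mul0r.
Qed.

Let iA : (leb R).-integrable setT (fun q => (A q)%:E).
Proof. exact: (integrable_Rfubini (f := fun q s : measurableTypeR R => H q s) iH). Qed.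

Let mA : measurable_fun [set: measurableTypeR R] A.
Proof. by have /integrableP[/measurable_EFinP] := iA. Qed.

(** The fundamental theorem along q from 0 to s for D (sqrt (q^2 + t^2)). With p = sqrt (q^2 + t^2),
    the factor p in D' = -2 p b cancels the denominator of dp/dq = q/p, so the derivative is -2 q
    b(p), without singularity. *)
Let abel_increment s t : 0 < s ->
  halfline_pow 0 t * (D t - D (Num.sqrt (s ^+ 2 + t ^+ 2))) = \int[leb R]_q (K s q * H q t).
Proof.
move=> s0; have [t0|t0] := boolP (0 < t); last first.
  rewrite {1}/halfline_pow (negPf t0) mul0r; transitivity (\int[leb R]_q (0 : R)).
    by rewrite Rintegral_cst// mul0r.
  by apply: eq_Rintegral => q _; rewrite /H {2}/halfline_pow (negPf t0) !(mul0r, mulr0).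
rewrite {1}/halfline_pow t0 expr0 mul1r.
pose g2 (q : R) : R := q ^+ 2 + t ^+ 2.
pose p (q : R) : R := Num.sqrt (g2 q).
pose F (q : R) : R := D (p q).
pose g (q : R) : R := - (2 * q * b (p q)).
have qt (q : R) : 0 < g2 q by rewrite ltr_wpDl ?sqr_ge0// exprn_gt0.
have dF (q : R) : is_derive q 1 F (g q).
  have d1 : is_derive q 1 g2 (2%:R * q).
    rewrite -[X in is_derive _ _ _ X]addr0; apply: is_deriveD.
    exact: (is_derive_exprn 2 q).
  have d2 : is_derive q 1 p ((2 * Num.sqrt (g2 q))^-1 * (2%:R * q)) := is_derive1_comp (is_derive1_sqrt (qt q)) d1.
  have d3 : is_derive q 1 F (- (2 * p q) * b (p q) * ((2 * Num.sqrt (g2 q))^-1 * (2%:R * q))) := is_derive1_comp (dD (p q)) d2.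
  apply: is_derive_eq d3 _; rewrite /g -/(p q).
  have : p q != 0 by rewrite gt_eqF// sqrtr_gt0.
  by move: (p q) (b (p q)) => y z y0; field.
have cF (q : R) : {for q, continuous F}.
  by apply: differentiable_continuous; apply/derivable1_diffP; case: (dF q).
have cg : continuous g.
  move=> q; apply: cvgN; apply: cvgM.
    by apply: cvgM; [exact: cvg_cst|exact: cvg_id].
  apply: (@continuous_comp _ _ _ p b); last exact: cb.
  apply: (@continuous_comp _ _ _ g2 Num.sqrt); last exact: sqrt_continuous.
  by apply: cvgD; [exact: exprn_continuous|exact: cvg_cst].
have mg : measurable_fun [set: measurableTypeR R] g by exact: continuous_measurable_fun.
have E : (\int[leb R]_(q in [set` `[0%R, s]]) (g q)%:E = (F s - F 0)%:E)%E.
  rewrite EFinB; apply: continuous_FTC2 => //.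
  - exact: continuous_subspaceT.
  - split.
    + by move=> q _; case: (dF q).
    + by apply: cvg_at_right_filter; exact: cF.
    + by apply: cvg_at_left_filter; exact: cF.
  - by move=> q _; rewrite derive1E; case: (dF q).
have E' : (\int[leb R]_(q in [set` `]0%R, s[]) (g q)%:E = (F s - F 0)%:E)%E.
  rewrite -E -[RHS]integral_itv_obnd_cbnd; last by apply: measurable_funTS; exact/measurable_EFinP.
  by rewrite -[RHS]integral_itv_bndo_bndc//; apply: measurable_funTS; exact/measurable_EFinP.
have F0 : F 0 = D t by rewrite /F /p /g2 expr0n/= add0r sqrtr_sqr gtr0_norm.
have KH q : (g \_ [set` `]0, s[]) q = - (K s q * H q t).
  rewrite patchE /K /H /halfline_pow subr_gt0 t0 !expr0 mulr1 -/(g2 q) -/(p q) /g.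
  have [/andP[q0 qs]|nq] := boolP ((0 < q) && (q < s)).
    by rewrite mem_set/= ?in_itv/= ?q0 ?qs// mul1r.
  rewrite memNset/=; last by rewrite in_itv/=; exact/negP.
  by move: nq; case: (0 < q); case: (q < s) => //= _; rewrite ?mul0r ?mulr0 ?oppr0.
have EK : F s - F 0 = \int[leb R]_q (- (K s q * H q t)).
  rewrite /Rintegral -[LHS]/(fine (F s - F 0)%:E) -E'; congr fine.
  rewrite [LHS]integral_mkcond; apply: eq_integral => q _.
  by rewrite -KH !patchE; case: ifP.
have iK : (leb R).-integrable setT (fun q => (- (K s q * H q t))%:E).
  have : (leb R).-integrable [set` `]0, s[] (EFin \o g).
    have i2 : (leb R).-integrable [set` `[0, s]] (EFin \o g).
      apply: continuous_compact_integrable; first exact: segment_compact.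
      exact: continuous_subspaceT.
    apply: (integrableS _ _ _ i2) => //.
    by apply: subset_itv; rewrite bnd_simp.
  rewrite integrable_mkcond// restrict_EFin.
  by rewrite (funext KH).
rewrite -F0 -[F s]/(D (p s)) in EK *.
rewrite (_ : F 0 - _ = (-1) * (F s - F 0)); last by rewrite mulN1r opprB.
by rewrite EK -RintegralZl//; apply: eq_Rintegral => q _; rewrite mulN1r opprK.
Qed.

Let integral_abel_increment s : 0 < s ->
  \int[leb R]_t (halfline_pow 0 t * (D t - D (Num.sqrt (s ^+ 2 + t ^+ 2)))) = \int[leb R]_q (K s q * A q).
Proof.
move=> s0; under eq_Rintegral do rewrite abel_increment//.
have iKH : (leb R \x leb R)%E.-integrable setT (fun p => (K s p.1 * H p.1 p.2)%:E).
  apply: (dominated_integrable_by (fun p : measurableTypeR R * measurableTypeR R => K s p.1 * H p.1 p.2) (fun p => (2 * s) * `|H p.1 p.2|)).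
  - apply: measurable_funM; last exact: mH.
    by rewrite /K; meas.
  - by under eq_fun do rewrite EFinM; apply: integrableZl => //; exact: (integrable_norm iH).
  move=> [q t] /=; rewrite normrM; have [q0|q0] := boolP (0 < q); last first.
    by rewrite /H {1 3}/halfline_pow (negPf q0) !mul0r normr0 !mulr0.
  apply: ler_wpM2r => //; rewrite /K subr_gt0; case: ifP => qs; last by rewrite normr0 mulr_ge0// ltW.
  by rewrite gtr0_norm ?mulr_gt0// ler_wpM2l// ltW.
rewrite -(Rfubini_swap (f := fun q t : measurableTypeR R => K s q * H q t) iKH).
by apply: eq_Rintegral => q _; rewrite (RintegralZl _ measurableT (iHq q)).
Qed.

Let W (s : R) : R := if 0 < s then s ^- 2 else 0.

Let integral_weight q : 0 < q -> (\int[leb R]_s (W s * K s q)%:E = 2%:E)%E.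
Proof.
move=> q0; transitivity (\int[leb R]_s ((2 * q)%:E * (if (0 < s - q)%R then s ^- 2 else 0)%:E))%E.
  apply: eq_integral => s _; rewrite -EFinM; congr EFin; rewrite /W /K subr_gt0.
  have [qs|_] := boolP (q < s); last by rewrite !mulr0.
  by rewrite (lt_trans q0 qs) mulrC.
rewrite ge0_integralZl//; last 3 first.
- by meas.
- by move=> s _; rewrite lee_fin; case: ifP => // _; rewrite invr_ge0 sqr_ge0.
- by rewrite lee_fin mulr_ge0// ltW.
by rewrite integral_inv_sqr_tail// -EFinM mulfK// gt_eqF.
Qed.

(* Writing [D t - D (sqrt (s^2 + t^2))] as the integral over [0 < q < s] of
   [2 q b (sqrt (q^2 + t^2))] makes the weight [s^-2] integrable: integrated
   over [s > q] it contributes [1 / q]. What is left is the integral of [b]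
   over a quadrant, evaluated in polar coordinates. *)
Lemma Rintegral_abel :
  \int[leb R]_s (W s * \int[leb R]_t (halfline_pow 0 t * (D t - D (Num.sqrt (s ^+ 2 + t ^+ 2))))) =
  pi * \int[leb R]_t (halfline_pow 1 t * b t).
Proof.
pose h (q s : measurableTypeR R) : R := W s * K s q * A q.
have mW : measurable_fun [set: measurableTypeR R * measurableTypeR R] (fun p => W p.2 * K p.2 p.1).
  by rewrite /W /K; meas.
have mh : measurable_fun [set: measurableTypeR R * measurableTypeR R] (fun p => h p.1 p.2).
  by apply: measurable_funM => //; exact: measurableT_comp.
have W0 q s : 0 < q -> 0 <= W s * K s q.
  move=> q0; rewrite mulr_ge0// /W /K; case: ifP => // _; first by rewrite invr_ge0 sqr_ge0.
  by rewrite mulr_ge0// ltW.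
have mWq q : measurable_fun [set: measurableTypeR R] (fun s => W s * K s q).
  by rewrite /W /K; meas.
have ih : (leb R \x leb R)%E.-integrable setT (fun p => (h p.1 p.2)%:E).
  apply/integrableP; split; first exact/measurable_EFinP.
  rewrite (tonelli_prod (leb R) (leb R) (fun q s => `|(h q s)%:E|%E)); last 2 first.
  - by apply: measurableT_comp => //; exact/measurable_EFinP.
  - by [].
  have -> : (\int[leb R]_q \int[leb R]_s `|(h q s)%:E| = \int[leb R]_q (2%:E * `|(A q)%:E|))%E.
    apply: eq_integral => q _; have [q0|q0] := boolP (0 < q); last first.
      rewrite A_nonpos// abse0 mule0 integral0_eq// => s _.
      by rewrite /h A_nonpos// mulr0 abse0.
    transitivity (\int[leb R]_s (`|A q|%:E * (W s * K s q)%:E))%E.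
      by apply: eq_integral => s _; rewrite /h /= normrM (ger0_norm (W0 q s q0)) mulrC EFinM.
    rewrite ge0_integralZl//; last 2 first.
    - by apply/measurable_EFinP; exact: mWq.
    - by move=> s _; rewrite lee_fin W0.
    by rewrite integral_weight// muleC.
  rewrite ge0_integralZl//; last by apply: measurableT_comp => //; exact/measurable_EFinP.
  by apply: lte_mul_pinfty => //; have /integrableP[] := iA.
transitivity (\int[leb R]_s \int[leb R]_q h q s).
  apply: eq_Rintegral => s _; have [s0|s0] := boolP (0 < s); last first.
    rewrite {1}/W (negPf s0) mul0r; transitivity (\int[leb R]_q (0 : R)).
      by rewrite Rintegral_cst// mul0r.
    by apply: eq_Rintegral => q _; rewrite /h /W (negPf s0) !mul0r.
  rewrite integral_abel_increment//.
  rewrite -RintegralZl//; first by apply: eq_Rintegral => q _; rewrite mulrA.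
  apply: (dominated_integrable_by (fun q : measurableTypeR R => K s q * A q) (fun q => (2 * s) * `|A q|)).
  - by rewrite /K; meas.
  - by under eq_fun do rewrite EFinM; apply: integrableZl => //; exact: (integrable_norm iA).
  move=> q; rewrite normrM; have [q0|q0] := boolP (0 < q); last by rewrite A_nonpos// normr0 !mulr0.
  apply: ler_wpM2r => //; rewrite /K subr_gt0; case: ifP => qs; last by rewrite normr0 mulr_ge0// ltW.
  by rewrite gtr0_norm ?mulr_gt0// ler_wpM2l// ltW.
rewrite -(Rfubini_swap ih).
transitivity (\int[leb R]_q (2 * A q)).
  apply: eq_Rintegral => q _; have [q0|q0] := boolP (0 < q); last first.
    rewrite /h A_nonpos// mulr0; transitivity (\int[leb R]_s (0 : R)).
      by apply: eq_Rintegral => s _; rewrite mulr0.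
    by rewrite Rintegral_cst// mul0r.
  rewrite /h; under eq_Rintegral do rewrite mulrC.
  rewrite RintegralZl//.
    by rewrite mulrC; congr (_ * _); rewrite /Rintegral integral_weight.
  apply: (ge0_integrable (fun s : measurableTypeR R => W s * K s q)).
  - exact: mWq.
  - by move=> s; exact: W0.
  - by rewrite integral_weight// ltry.
rewrite RintegralZl// /A /H Rintegral_polar// mulrA; congr (_ * _).
by field.
Qed.
End abel.

(** * Inversion of the square root of the inverse Laplacian *)

Section riesz_inversion.
Context (R : realType) (k : nat).
Let n := k.+2.
Variables (psi : 'rV[R]_n -> R) (x : 'rV[R]_n).
Hypothesis tpsi : test_function psi.
Let f := mean_heat 0 psi.

Let mf : measurable_fun [set: 'rV[R]_n] f.
Proof. by apply: continuous_measurable_rV; exact: continuous_mean_heat. Qed.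

Let integrable_heat_sqrt s :
  (leb R).-integrable setT (fun t => (halfline_pow 0 t * heat (Num.sqrt (s ^+ 2 + t ^+ 2)) psi x)%:E).
Proof.
have [B B0 HB] := test_bounded tpsi; have me := test_measurable tpsi.
have [C C0 HC] := heat_decay me (test_integrable tpsi).
apply: (@integrable_halfline_decay _ (fun t => heat (Num.sqrt (s ^+ 2 + t ^+ 2)) psi x) B C 0 n) => //.
- apply: (@measurable_heat_joint R n _ (measurableTypeR R) psi (fun t => Num.sqrt (s ^+ 2 + t ^+ 2)) (fun=> x)) => //.
  by meas.
- by move=> t _; exact: heat_le_bound.
- move=> t t0; have tp : t <= Num.sqrt (s ^+ 2 + t ^+ 2).
    by rewrite -[leLHS]gtr0_norm// -sqrtr_sqr ler_wsqrtr// lerDr sqr_ge0.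
  have p0 : 0 < Num.sqrt (s ^+ 2 + t ^+ 2) by apply: lt_le_trans tp.
  apply: le_trans (HC _ x p0) _; rewrite ler_wpM2l// lef_pV2 ?posrE ?exprn_gt0//.
  by rewrite lerXn2r ?nnegrE ?(ltW t0) ?(ltW p0).
Qed.

(** Fubini moves [heat s] inside the moment that defines [f], where the semigroup law applies. *)
Let heat_mean_heat s : 0 < s ->
  heat s f x = (\int[leb R]_t (halfline_pow 0 t * heat (Num.sqrt (s ^+ 2 + t ^+ 2)) psi x)) / gauss_moment R 0.
Proof.
move=> s0; have [B B0 HB] := test_bounded tpsi; have me := test_measurable tpsi.
have [C C0 HC] := heat_decay me (test_integrable tpsi).
pose phi (z : 'rV[R]_n) (t : measurableTypeR R) : R := gauss_kernel z * (halfline_pow 0 t * heat t psi (x + (2 * s) *: z)).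
have mphi : measurable_fun [set: 'rV[R]_n * measurableTypeR R] (fun p => phi p.1 p.2).
  apply: measurable_funM; first by rewrite /gauss_kernel; meas.
  apply: measurable_funM; first by rewrite /halfline_pow; meas.
  apply: (@measurable_heat_joint R n _ ('rV[R]_n * measurableTypeR R)%type psi (fun p => p.2) (fun p => x + (2 * s) *: p.1)) => //; by meas.
have iphi : (lebesgue_rV R n \x leb R)%E.-integrable setT (fun p => (phi p.1 p.2)%:E).
  have i1 : (lebesgue_rV R n \x leb R)%E.-integrable setT (fun p => (gauss_kernel p.1 * (if 0 < p.2 then oneDsqr_inv p.2 else 0))%:E).
    apply: (integrable_prod_mul (a := @gauss_kernel R n) (b := fun s : measurableTypeR R => if 0 < s then oneDsqr_inv s else 0)
      (m2 := leb R) (m1 := lebesgue_rV R n)).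
    - exact: gauss_kernel_ge0.
    - by move=> t; case: ifP => // _; exact: oneDsqr_inv_ge0.
    - exact: integrable_gauss_kernel.
    - exact: integrable_oneDsqr_inv.
  apply: (dominated_integrable_by (fun p : 'rV[R]_n * measurableTypeR R => phi p.1 p.2)
    (fun p => (2 * (B + C)) * (gauss_kernel p.1 * (if 0 < p.2 then oneDsqr_inv p.2 else 0)))) => //.
    by under eq_fun do rewrite EFinM; exact: integrableZl.
  move=> [z t] /=; rewrite /phi; move: (gauss_kernel z) (gauss_kernel_ge0 z) => g g0.
  rewrite normrM (ger0_norm g0) mulrCA ler_wpM2l//.
  rewrite /halfline_pow; case: ifPn => t0; last by rewrite mul0r normr0 mulr0.
  apply: (decay_le_oneDsqr_inv (l := n) (h := fun t => heat t psi (x + (2 * s) *: z))) => //.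
    by move=> r _; exact: heat_le_bound.
  by move=> r; exact: HC.
have E := Rfubini_swap iphi.
rewrite mulrC; apply: (@mulfI _ (gauss_moment R 0)); first by rewrite gt_eqF// gauss_moment_gt0.
rewrite mulrA divff ?mul1r; last by rewrite gt_eqF// gauss_moment_gt0.
transitivity (\int[lebesgue_rV R n]_z \int[leb R]_t phi z t).
  rewrite /heat -RintegralZl//.
    apply: eq_Rintegral => z _; rewrite /phi RintegralZl//; last exact: integrable_heat_moment.
    rewrite mulrCA; congr (_ * _); rewrite /f /mean_heat mulrC divfK//.
    by rewrite gt_eqF// gauss_moment_gt0.
  have [B' _ HB'] := mean_heat_bounded (isT : (0.+2 <= n)%N) tpsi.
  exact: integrable_heat HB'.
rewrite E; apply: eq_Rintegral => t _; rewrite /phi.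
under eq_Rintegral do rewrite mulrCA.
rewrite RintegralZl//; last first.
  apply: (@integrable_heat _ _ (heat t psi) s x B).
    by apply: (@measurable_heat_joint R n _ 'rV[R]_n psi (fun=> t) id).
  by move=> y; exact: heat_le_bound.
by rewrite -/(heat s (heat t psi) x) heat_comp.
Qed.

Let heat_increment s : 0 < s -> f x - heat s f x =
  (gauss_moment R 0)^-1 * \int[leb R]_t (halfline_pow 0 t * (heat t psi x - heat (Num.sqrt (s ^+ 2 + t ^+ 2)) psi x)).
Proof.
move=> s0; rewrite heat_mean_heat// [f x]/(_ / _) -mulrBl mulrC; congr (_ * _).
have i1 : (leb R).-integrable setT (fun t => (halfline_pow 0 t * heat t psi x)%:E).
  exact: integrable_heat_moment.
rewrite /heat_moment -(RintegralB measurableT i1 (integrable_heat_sqrt s)).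
by apply: eq_Rintegral => t _; rewrite mulrBr.
Qed.

Let U (s : R) : R := (if 0 < s then s ^- 2 else 0) * (f x - heat s f x).

(** [Rintegral_abel] with D the heat evolution of [psi] and b that of [neg_laplacian psi], which
    decays with exponent n + 1 >= 3. The moment of order 1 of b is [psi x / 2], so the right-hand
    side is pi/2 times [psi x]; dividing by [gauss_moment R 0], which is sqrt pi / 2, leaves sqrt
    pi. *)
Let Rintegral_heat_increment : (leb R).-integrable setT (fun s => (U s)%:E) ->
  \int[leb R]_s U s = Num.sqrt pi * psi x.
Proof.
move=> iU; have tl := test_neg_laplacian tpsi.
have [B B0 HB] := test_bounded tl; have [C C0 HC] := heat_neg_laplacian_decay tpsi.
have := @Rintegral_abel R (fun p => heat p psi x) (fun p => heat p (neg_laplacian psi) x) B C n.+1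
  (continuous_heat tl) B0 C0 isT (fun p => heat_le_bound _ _ (test_measurable tl) HB) (fun p => HC p x)
  (fun p => is_derive_heat p x tpsi).
rewrite -/(heat_moment 1 (neg_laplacian psi) x) heat_moment1_neg_laplacian// => E.
have G0 : gauss_moment R 0 != 0 by rewrite gt_eqF// gauss_moment_gt0.
apply: (mulfI G0).
have -> : gauss_moment R 0 * (Num.sqrt pi * psi x) = pi * (2^-1 * psi x).
  by rewrite gauss_moment0 -[in RHS](sqr_sqrtr (pi_ge0 R)); field.
rewrite -E -RintegralZl//; apply: eq_Rintegral => s _; rewrite /U.
have [s0|s0] := boolP (0 < s); last by rewrite !mul0r mulr0.
by rewrite heat_increment// mulrCA mulVKf.
Qed.

Let F (y : 'rV[R]_n) : R := 2 * f x - f (x - y) - f (x + y).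

(** The Gaussian is even, so the terms f (x - y) and f (x + y) have the same average [heat s f x];
    the first one is read as [heat (- s)] and treated by [heatN]. *)
Let Rintegral_second_difference s :
  \int[lebesgue_rV R n]_z (inv_square_weight k.+1 s * (gauss_kernel z * F ((2 * s) *: z))) = 2 * U s.
Proof.
have [B _ HB] := mean_heat_bounded (isT : (0.+2 <= n)%N) tpsi.
have [s0|s0] := boolP (0 < s); last first.
  rewrite /U (negPf s0) mul0r mulr0; transitivity (\int[lebesgue_rV R n]_z (0 : R)).
    by apply: eq_Rintegral => z _; rewrite /inv_square_weight (negPf s0) mul0r.
  by rewrite Rintegral_cst// mul0r.
have ig := integrable_gauss_kernel R n.
have i1 : (lebesgue_rV R n).-integrable setT (fun z => (2 * f x * gauss_kernel z)%:E).
  by under eq_fun do rewrite EFinM; exact: integrableZl.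
have i2 : (lebesgue_rV R n).-integrable setT (fun z => (gauss_kernel z * f (x + (2 * - s) *: z))%:E).
  exact: integrable_heat HB.
have i3 : (lebesgue_rV R n).-integrable setT (fun z => (gauss_kernel z * f (x + (2 * s) *: z))%:E).
  exact: integrable_heat HB.
have i12 := integrableB measurableT i1 i2.
have EF : (fun z => gauss_kernel z * F ((2 * s) *: z)) =
  (fun z => (2 * f x * gauss_kernel z - gauss_kernel z * f (x + (2 * - s) *: z)) - gauss_kernel z * f (x + (2 * s) *: z)).
  apply/funext => z; rewrite /F mulrN scaleNr !mulrBr; congr (_ - _ - _); exact: mulrC.
have EI : \int[lebesgue_rV R n]_z (gauss_kernel z * F ((2 * s) *: z)) = 2 * (f x - heat s f x).
  rewrite EF (RintegralB measurableT i12 i3) (RintegralB measurableT i1 i2).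
  have E1 : \int[lebesgue_rV R n]_z (2 * f x * gauss_kernel z) = 2 * f x.
    by rewrite (RintegralZl _ measurableT ig) Rintegral_gauss_kernel mulr1.
  transitivity (2 * f x - heat (- s) f x - heat s f x); first by congr (_ - _ - _).
  rewrite heatN//; last by exists B.
  by move: (f x) (heat s f x) => a c; ring.
rewrite RintegralZl//; last by rewrite EF; exact: (integrableB measurableT i12 i3).
by rewrite EI /U inv_square_weightE// s0; ring.
Qed.

(** The factor 1/2 of [symmetric_integral] cancels the 2 of [Rintegral_second_difference]; what
    remains is the integral of [U]. *)
Lemma riesz_symmetric_integral : riesz_factor R k.+1 * symmetric_integral f x = Num.sqrt pi * psi x.
Proof.
have [C C0 HC] := second_difference_le (isT : (0.+2 <= n)%N) tpsi.
have mF : measurable_fun [set: 'rV[R]_n] F.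
  have ma (g : 'rV[R]_n -> 'rV[R]_n) : measurable_fun [set: 'rV[R]_n] g -> measurable_fun [set: 'rV[R]_n] (fun y => f (x + g y)).
    move=> mg; apply: (measurableT_comp mf).
    by apply: measurable_fun_rVadd => //; exact: measurable_cst.
  rewrite /F; apply: measurable_funB; last exact: (ma id).
  by apply: measurable_funB; [exact: measurable_cst|apply: (ma (fun y => - y)); meas].
have iF := dominated_riesz C0 mF (fun y => HC x y).
have iU2 := integrable_Rfubini (f := fun (s : measurableTypeR R) z => inv_square_weight k.+1 s * (gauss_kernel z * F ((2 * s) *: z))) iF.
have iU : (leb R).-integrable setT (fun s => (U s)%:E).
  rewrite (_ : (fun s => _) = (fun s => 2^-1%:E * (2 * U s)%:E)%E).
    by apply: integrableZl => //; under eq_fun do rewrite -Rintegral_second_difference.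
  by apply/funext => s; rewrite -EFinM mulKf.
rewrite -(Rintegral_heat_increment iU) /symmetric_integral mulrCA (riesz_Rintegral mF iF).
by under eq_Rintegral do rewrite Rintegral_second_difference; rewrite RintegralZl// mulKf.
Qed.

Lemma riesz_singular_integral : riesz_constant R n * singular_integral f x = psi x.
Proof.
have [C C0 HC] := second_difference_le (isT : (0.+2 <= n)%N) tpsi.
have [B _ HB] := mean_heat_bounded (isT : (0.+2 <= n)%N) tpsi.
have [-> _] := singular_integral_symmetric mf HB C0 HC.
have p0 : Num.sqrt pi != 0 :> R by rewrite gt_eqF// sqrtr_gt0 pi_gt0.
(* [Gamma_gauss_moment] expresses c_n through [gauss_moment R n]; c_n has one more factor sqrt pi in
   its denominator than [riesz_factor]. *)
have -> : riesz_constant R n = (Num.sqrt pi)^-1 * riesz_factor R k.+1.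
  rewrite /riesz_constant Gamma_gauss_moment sqrt_powR_half ?pi_ge0// /riesz_factor /=.
  by rewrite -/n !exprS; field; rewrite p0 !expf_neq0.
by rewrite -mulrA riesz_symmetric_integral mulKf.
Qed.
End riesz_inversion.

Theorem theorem4p2 (R : realType) (m : nat) (hm : (2 <= m.+1)%N)
    (phi : 'rV[R]_m.+1 -> R)
    (phi_smooth : smooth_on (upper_half_space R m) phi)
    (phi_supp : compactly_supported_in (upper_half_space R m) phi) :
  let n := m.+1 in
  let Phi := hemispherical_transform phi in
  let g := backprojection Phi in
  [/\ forall (x' : 'rV[R]_m) (r : R), 0 < r ->
        hemispherical_transform_exists phi x' r,
      forall x : 'rV[R]_n,
        (lebesgue_rV R m).-integrable setT (EFin \o backprojection_integrand Phi x),
      odd n ->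
        (forall k, (k < n.-1./2)%N ->
           laplacian_exists (iter k (@neg_laplacian R n) g)) /\
        let psi := iter n.-1./2 (@neg_laplacian R n) g in
        forall y, upper_half_space R m y -> phi y = Q1inv psi y
    & ~~ odd n ->
        (forall k, (k < n./2.-1)%N ->
           laplacian_exists (iter k (@neg_laplacian R n) g)) /\
        let f := iter n./2.-1 (@neg_laplacian R n) g in
        [/\ forall (x : 'rV[R]_n) (eps : R), 0 < eps ->
              (lebesgue_rV R n).-integrable [set z | eps < enorm z]
                (EFin \o difference_quotient f x),
            {uniform, truncated_integral f eps @[eps --> 0^'+] -->
              singular_integral f}
          & let psi := fun x => riesz_constant R n * singular_integral f x in
            forall y, upper_half_space R m y -> phi y = Q1inv psi y]].
Proof.
(* The bound on the dimension leaves m = k + 1, so that n = k + 2 and k = n - 2 is the order of the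
   moment that represents g. *)
case: m hm phi phi_smooth phi_supp => // k _ phi smooth supp n Phi g.
have tu : test_function (unfolded phi) := test_unfolded smooth supp.
have gE : g = mean_heat k (unfolded phi) by exact: backprojection_mean_heat.
have iterE j : iter j (@neg_laplacian R n) g = mean_heat k (iter j (@neg_laplacian R n) (unfolded phi)).
  by rewrite gE iter_neg_laplacian_mean_heat.
have lap j : laplacian_exists (iter j (@neg_laplacian R n) g).
  by rewrite iterE; apply: laplacian_exists_mean_heat => //; exact: test_iter_neg_laplacian.
split.
- by move=> x' r; exact: integrable_hemisphere.
- exact: integrable_backprojection.
- move=> on; split => // psi y y0; rewrite (Q1inv_unfolded phi y0); congr Q1inv.
  rewrite /psi iterE.
  have ok : odd k by move: on; rewrite /n /= negbK.
  (* Of the (n-1)/2 = [k./2.+1] Laplacians, [k./2] lower the moment from order k to order 1; the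
     innermost one, split off by [iterSr], is inverted by [mean_heat1_neg_laplacian]. *)
  have kE : k = (1 + k./2.*2)%N by rewrite -[in LHS](odd_double_half k) ok.
  have -> : n.-1./2 = k./2.+1 by rewrite /n -[LHS]/(uphalf k) uphalf_half ok.
  have tl : test_function (neg_laplacian (unfolded phi)) := test_neg_laplacian tu.
  rewrite iterSr [in mean_heat k]kE mean_heat_iter_neg_laplacian//.
    by rewrite mean_heat1_neg_laplacian.
  by rewrite -kE /n addn2.
- move=> en; split => // f.
  (* Here the n/2 - 1 = [k./2] Laplacians bring the moment down to order 0, the function [f] of
     [riesz_singular_integral]. *)
  have kE : k = (0 + k./2.*2)%N by move: en; rewrite /n /= negbK => ok; rewrite -[in LHS](odd_double_half k) (negPf ok).
  have fE : f = mean_heat 0 (unfolded phi).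
    rewrite /f iterE (_ : n./2.-1 = k./2)// [in mean_heat k]kE mean_heat_iter_neg_laplacian//.
    by rewrite -kE /n addn2.
  have [C C0 HC] := second_difference_le (isT : (0.+2 <= n)%N) tu.
  have [B _ HB] := mean_heat_bounded (isT : (0.+2 <= n)%N) tu.
  have mf : measurable_fun [set: 'rV[R]_n] (mean_heat 0 (unfolded phi)).
    by apply: continuous_measurable_rV; exact: continuous_mean_heat.
  rewrite fE; split.
  + by move=> x eps; exact: integrable_difference_quotient.
  + by have [] := singular_integral_symmetric mf HB C0 HC.
  + move=> psi y y0; rewrite (Q1inv_unfolded phi y0); congr Q1inv.
    by apply/funext => x; rewrite /psi riesz_singular_integral.
Qed.
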